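(* The set $\mathrm{C}_{\mathrm{UB}}$ of spaces $X\in\mathrm{SB}$ containing an unconditional basic sequence is $\Sigma^1_1$-complete (i.e., analytic and $\Sigma^1_1$-hard).
   Context: $\mathrm{SB}$ is the standard Borel space of closed linear subspaces of $C(\Delta)$ ($\Delta$ the Cantor set) with the Effros–Borel structure. An analytic set $A$ in a standard Borel space $X$ is $\Sigma^1_1$-complete if for every standard Borel $Y$ and analytic $B\subset Y$ there is a Borel $f:Y\to X$ with $f^{-1}(A)=B$. *)

(* Defs.v *)
From HB Require Import structures.
From mathcomp Require Import all_boot all_order all_algebra.
From mathcomp Require Import all_classical all_reals all_analysis.
Set Implicit Arguments. Unset Strict Implicit. Unset Printing Implicit Defensive.
Import Order.TTheory GRing.Theory Num.Theory.
Local Open Scope classical_set_scope.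
Local Open Scope ring_scope.

Section Defs.
Variable R : realType.

Definition is_metric (T : Type) (d : T -> T -> R) :=
  [/\ (forall x y, 0 <= d x y), (forall x y, d x y = 0 <-> x = y),
      (forall x y, d x y = d y x) & (forall x y z, d x z <= d x y + d y z)].

Definition metric_open (T : Type) (d : T -> T -> R) (U : set T) :=
  forall x, U x -> exists2 e, 0 < e & forall y, d x y < e -> U y.

Definition metric_complete (T : Type) (d : T -> T -> R) :=
  forall u : nat -> T,
    (forall e, 0 < e -> exists N, forall m n, (N <= m)%N -> (N <= n)%N -> d (u m) (u n) < e) ->
    exists x, forall e, 0 < e -> exists N, forall n, (N <= n)%N -> d (u n) x < e.

Definition metric_separable (T : Type) (d : T -> T -> R) :=
  exists D : set T, countable D /\ forall x e, 0 < e -> exists2 y, D y & d x y < e.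

Definition standard_borel (T : Type) (S : set (set T)) :=
  exists d : T -> T -> R, [/\ is_metric d, metric_complete d, metric_separable d &
    S = <<s [set U | metric_open d U] >>].

Definition borel_map (X Y : Type) (SX : set (set X)) (SY : set (set Y)) (f : X -> Y) :=
  forall B, SY B -> SX (f @^-1` B).

Definition analytic (X : Type) (SX : set (set X)) (A : set X) :=
  exists (Z : Type) (SZ : set (set Z)), standard_borel SZ /\
    exists g : Z -> X, borel_map SZ SX g /\ g @` setT = A.

Definition sigma11_complete (X : Type) (SX : set (set X)) (A : set X) :=
  analytic SX A /\
  forall (Y : Type) (SY : set (set Y)), standard_borel SY ->
    forall B : set Y, analytic SY B ->
      exists f : Y -> X, borel_map SY SX f /\ f @^-1` A = B.

(* elements of C(Δ) are the continuous functions cantor_space -> R *)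
Definition fn := cantor_space -> R.

Definition cont (f : fn) := continuous (f : cantor_space -> R^o).

Definition CD_open (U : set fn) :=
  U `<=` cont /\
  forall f, U f -> exists2 e, 0 < e &
    forall g, cont g -> (forall t, `|f t - g t| <= e) -> U g.

Definition unif_cvg (u : nat -> fn) (g : fn) :=
  forall e, 0 < e -> exists N, forall n, (N <= n)%N -> forall t, `|u n t - g t| <= e.

Definition closed_subspace (F : set fn) :=
  [/\ F `<=` cont, F (fun _ => 0),
      (forall f g, F f -> F g -> F (fun t => f t + g t)),
      (forall a f, F f -> F (fun t => a * f t)) &
      (forall u g, (forall n, F (u n)) -> unif_cvg u g -> F g)].

Definition SB := {F : set fn | closed_subspace F}.

Definition Effros : set (set SB) :=
  <<s [set [set X : SB | exists2 f, proj1_sig X f & U f] | U in CD_open] >>.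

Definition series_cvg (a : nat -> R) (x : nat -> fn) (y : fn) :=
  unif_cvg (fun n t => \sum_(i < n) a i * x i t) y.

Definition clspan (x : nat -> fn) : set fn :=
  [set y | forall F, closed_subspace F -> (forall n, F (x n)) -> F y].

Definition basic_seq (x : nat -> fn) :=
  forall y, clspan x y -> exists! a : nat -> R, series_cvg a x y.

Definition unconditional_basic_seq (x : nat -> fn) :=
  basic_seq x /\
  forall y, clspan x y -> forall a, series_cvg a x y ->
    forall s : nat -> nat, bijective s -> series_cvg (a \o s) (x \o s) y.

Definition C_UB : set SB :=
  [set X : SB | exists x : nat -> fn,
     (forall n, proj1_sig X (x n)) /\ unconditional_basic_seq x].

End Defs.

(* Main.v *)
Require Import Defs.
From HB Require Import structures.
From mathcomp Require Import all_boot all_order all_algebra.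
From mathcomp Require Import all_classical all_reals all_analysis.
From mathcomp Require Import zify ring lra.
Set Implicit Arguments. Unset Strict Implicit. Unset Printing Implicit Defensive.
Import Order.TTheory GRing.Theory Num.Theory.
Local Open Scope classical_set_scope.
Local Open Scope ring_scope.

(** Analyticity: an unconditional basic sequence has a finite unconditional constant (an
    open mapping argument), and the pairs (sequence, constant) such that the even-indexed
    terms are unconditional with that constant form a closed subset of a Polish space,
    which is mapped in a Borel way onto C_UB by taking closed spans.

    Hardness: an analytic set is { y | T y has an infinite branch } for trees T y depending
    on y in a Borel way.  On the finitely supported vectors over the nonempty finite
    sequences of integers one constructs a norm with two properties.  Along each branch the
    unit vectors span c_0.  At each node, the subspaces spanned by the vectors below the
    various children are put together by a Gowers--Maurey norm (weights [1 / m j], lengths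
    [len j], and a coding of special functionals at odd [j]), so that no sequence of
    successive blocks is unconditional.  By gliding humps, an unconditional sequence in the
    span of a tree yields one in the span of the part of the tree below some child of the
    root, and iterating this produces an infinite branch. *)

(** * Unconditional sequences of functions *)

(** The norm is defined on all nonempty finite sequences at once and does not depend on the tree: a
    tree only selects which unit vectors enter the span. The reduction is therefore Borel, as an
    open set meets a closed span exactly when it contains a finite combination of selected vectors.
    The norm is a supremum over the countable set of [valid] terms; a vector is handled as the
    function of its values on terms, and bounds [nle] replace norms. All weights are powers of 2 and
    successive functionals have disjoint ranges, so a functional takes on a unit vector only the
    values 0 and 2^-k. Hence the functionals can be written as points of the Cantor set, on which
    the unit vectors become continuous functions. In the analytic half the obstacle is that
    unconditionality quantifies over all permutations and all expansions; a finite constant for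
    masked finite sums turns it into a closed condition. Moreover the space has to be generated, not
    only to contain the sequence: this is the role of the odd-indexed terms, which run through
    multiples of a dense sequence of the space. *)

Lemma dependent_choice_nat (S : Type) (Q : nat -> S -> S -> Prop) (s0 : S) :
  (forall n s, exists s', Q n s s') ->
  exists f : nat -> S, f 0%N = s0 /\ forall n, Q n (f n) (f n.+1).
Proof.
move=> H; have /choice[g gP] : forall p : nat * S, exists s', Q p.1 p.2 s'.
  by move=> [n s]; exact: H.
pose f := fix f n := if n is m.+1 then g (m, f m) else s0.
by exists f; split=> // n; exact: gP (n, f n).
Qed.

Lemma sum_geometric2 (R : realFieldType) n :
  \sum_(0 <= i < n) (2 ^- i : R) <= 2.
Proof.
suff -> : \sum_(0 <= i < n) (2 ^- i : R) = 2 - 2 * 2 ^- n.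
  have : 0 <= 2 ^- n :> R by rewrite invr_ge0 exprn_ge0. lra.
elim: n => [|n IH]; first by rewrite big_nil expr0; field.
by rewrite big_nat_recr //= IH exprS; field; rewrite expf_neq0 ?pnatr_eq0.
Qed.

Lemma pow2_gt (R : realType) (x : R) : exists n, x < 2 ^+ n.
Proof.
exists (Num.bound `|x|); apply: lt_le_trans (_ : (Num.bound `|x|)%:R <= _).
  exact: le_lt_trans (ler_norm _) (archi_boundP (normr_ge0 x)).
rewrite -natrX ler_nat; exact/ltnW/ltn_expl.
Qed.

Lemma pow2_small (R : realType) (e : R) : 0 < e -> exists n, 2 ^- n < e.
Proof.
move=> e0; have [n nP] := pow2_gt e^-1; exists n.
by rewrite -[e]invrK ltf_pV2 ?posrE ?invr_gt0 ?exprn_gt0.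
Qed.

Section sup_bounds.
Context {R : realType} {T : Type} (D : set T).

Definition nle (x : T -> R) (c : R) := forall t, D t -> `|x t| <= c.

Definition nonzero (x : T -> R) := exists2 t, D t & x t != 0.

(** As [c] ranges over all bounds, this is a suppression constant for the supremum norm over [D].
    Masks can replace signs, since a signed sum is a difference of two masked sums. *)
Definition uncond (K : R) (x : nat -> T -> R) :=
  forall (b : nat -> bool) n (a : nat -> R) c,
    nle (fun t => \sum_(0 <= i < n) a i * x i t) c ->
    nle (fun t => \sum_(0 <= i < n | b i) a i * x i t) (K * c).

Lemma nleW x c d : c <= d -> nle x c -> nle x d.
Proof. by move=> cd xc t /xc /le_trans; apply. Qed.

Lemma nleD x y c d : nle x c -> nle y d -> nle (fun t => x t + y t) (c + d).
Proof. by move=> xc yd t Dt; rewrite (le_trans (ler_normD _ _)) ?lerD ?xc ?yd. Qed.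

Lemma nleB x y c d : nle x c -> nle y d -> nle (fun t => x t - y t) (c + d).
Proof. by move=> xc yd t Dt; rewrite (le_trans (ler_normB _ _)) ?lerD ?xc ?yd. Qed.

Lemma nleZ x c k : nle x c -> nle (fun t => k * x t) (`|k| * c).
Proof. by move=> xc t Dt; rewrite normrM ler_wpM2l ?xc. Qed.

Lemma nle_sum (b : pred nat) n (x : nat -> T -> R) (c : nat -> R) :
  (forall i, (i < n)%N -> b i -> nle (x i) (c i)) ->
  nle (fun t => \sum_(0 <= i < n | b i) x i t) (\sum_(0 <= i < n | b i) c i).
Proof.
move=> H t Dt; rewrite (le_trans (ler_norm_sum _ _ _))// big_nat_cond.
rewrite [leRHS]big_nat_cond ler_sum// => i /andP[/andP[_ ilt] bi].
exact: H ilt bi _ Dt.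
Qed.

Lemma nle_ext x y c : (forall t, D t -> x t = y t) -> nle x c -> nle y c.
Proof. by move=> xy xc t Dt; rewrite -xy ?xc. Qed.

(** The supremum need not be attained, hence the lower bound 1/2 instead of 1. *)
Lemma normalize x M : nle x M -> nonzero x ->
  exists l : R, [/\ 0 < l, nle (fun t => l * x t) 1 &
    exists2 t, D t & 2^-1 <= `|l * x t|].
Proof.
move=> xM [t0 Dt0 xt0].
pose A := [set `|x t| | t in D].
have hsA : has_sup A.
  split; first by exists `|x t0|, t0.
  by exists M => _ [t Dt <-]; exact: xM.
have s0 : 0 < sup A.
  apply: lt_le_trans (_ : `|x t0| <= _); first by rewrite normr_gt0.
  by apply: ub_le_sup; [exact: hsA.2 | exists t0].
have [_ [t Dt <-] tP] : exists2 y, A y & sup A - sup A / 2 < y.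
  by apply: sup_adherent => //; rewrite divr_gt0.
exists (sup A)^-1; split; first by rewrite invr_gt0.
  move=> u Du; rewrite normrM gtr0_norm ?invr_gt0// ler_pdivrMl// mulr1.
  by apply: ub_le_sup; [exact: hsA.2 | exists u].
exists t => //; rewrite normrM gtr0_norm ?invr_gt0// ler_pdivlMl//.
by apply: ltW; move: tP; rewrite {1}[sup A]splitr addrK.
Qed.

Section unconditional.
Variables (K : R) (x : nat -> T -> R).
Hypothesis ux : uncond K x.

Lemma uncond_scale (l : nat -> R) : uncond K (fun i t => l i * x i t).
Proof.
move=> b n a c H.
have /(ux b) : nle (fun t => \sum_(0 <= i < n) (a i * l i) * x i t) c.
  by apply: nle_ext H => t _; apply: eq_bigr => i _; rewrite mulrA.
by apply: nle_ext => t _; apply: eq_bigr => i _; rewrite mulrA.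
Qed.

Lemma uncond_coef n (a : nat -> R) c i : (i < n)%N ->
  nle (fun t => \sum_(0 <= i < n) a i * x i t) c ->
  nle (fun t => a i * x i t) (K * c).
Proof.
move=> ilt /(ux (pred1 i)); apply: nle_ext => t _.
by rewrite big_mkcond/= big_mkord (bigD1 (Ordinal ilt)) //= eqxx big1 ?addr0//
   => j; rewrite -val_eqE /= => /negbTE ->.
Qed.

Lemma uncond_block (p : nat -> nat) (al : nat -> nat -> R) :
  (forall i, (p i <= p i.+1)%N) ->
  uncond K (fun i t => \sum_(p i <= k < p i.+1) al i k * x k t).
Proof.
move=> pm b n a c H.
(* Mask and coefficients are copied from a block to its indices: [b' k = b i] and
   [a' k = a i * al i k] for [k] in block [i]. *)
suff [a' [b' [E1 E2]]] : exists (a' : nat -> R) (b' : nat -> bool),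
    (forall t, \sum_(0 <= i < n) a i * (\sum_(p i <= k < p i.+1) al i k * x k t) =
      \sum_(p 0%N <= k < p n) a' k * x k t) /\
    (forall t, \sum_(0 <= i < n | b i)
        a i * (\sum_(p i <= k < p i.+1) al i k * x k t) =
      \sum_(p 0%N <= k < p n | b' k) a' k * x k t).
  pose a0 k := if (k < p 0%N)%N then 0 else a' k.
  have p0n : (p 0%N <= p n)%N by elim: n {H E1 E2} => // n /leq_trans; apply.
  have ext (B : pred nat) t : \sum_(0 <= k < p n | B k) a0 k * x k t =
      \sum_(p 0%N <= k < p n | B k) a' k * x k t.
    rewrite (big_cat_nat (n := p 0%N)) //= big_nat_cond big1 ?add0r; last first.
      by move=> i /andP[/andP[_ ip] _]; rewrite /a0 ip mul0r.
    rewrite big_nat_cond [RHS]big_nat_cond; apply: eq_bigr => i /andP[/andP[ip _] _].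
    by rewrite /a0 ltnNge ip.
  have := ux b' (n := p n) (a := a0) (c := c).
  move=> /(_ _) H'; apply: nle_ext (H' _) => [t _|]; first by rewrite ext E2.
  by apply: nle_ext H => t _; rewrite ext E1.
elim: n {H} => [|n [a' [b' [E1 E2]]]].
  by exists (fun=> 0), (fun=> false); split=> t; rewrite !big_geq.
have p0n : (p 0%N <= p n)%N by elim: n {E1 E2} => // n /leq_trans; apply.
exists (fun k => if (k < p n)%N then a' k else a n * al n k),
  (fun k => if (k < p n)%N then b' k else b n); split=> t.
  rewrite big_nat_recr //= E1 [RHS](big_cat_nat (n := p n)) //=; congr (_ + _).
    by apply: eq_big_nat => i /andP[_ ->].
  rewrite big_distrr/=; apply: eq_big_nat => i /andP[ip _].
  by rewrite ltnNge ip /= mulrA.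
rewrite big_mkcond big_nat_recr //= -big_mkcond E2 [RHS](big_cat_nat (n := p n)) //=.
congr (_ + _).
  rewrite big_nat_cond [RHS]big_nat_cond; apply: eq_big => [i|i /andP[/andP[_ ->]]] //.
  by case: (ltnP i (p n)); rewrite ?andbF ?andFb.
rewrite [RHS]big_nat_cond.
case: ifP => bn; last first.
  by rewrite big1// => i /andP[/andP[ip _]]; rewrite ltnNge ip.
rewrite big_distrr/= big_nat_cond; apply: eq_big => [i|i /andP[/andP[ip _] _]].
  by case: (leqP (p n) i) => ip; rewrite ?andbF ?andbT.
by rewrite ltnNge ip /= mulrA.
Qed.

(** Let [M] be the largest [|a i|]. The errors are summable and cost at most [2 * d * M]. As each
    [x i] reaches the absolute value 1, [M <= K * (c + 2 * d * M)], which [4 * d * K <= 1] turns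
    into [M <= 2 * K * c]; hence the constant [2 * K + 1]. *)
Lemma uncond_perturb (d : R) (w : nat -> T -> R) :
  0 <= K -> 0 <= d -> 4 * d * K <= 1 ->
  (forall i, exists2 t, D t & 1 <= `|x i t|) ->
  (forall i, nle (fun t => x i t - w i t) (d * 2 ^- i)) ->
  uncond (2 * K + 1) w.
Proof.
move=> K0 d0 dK x1 xw b n a c H t Dt.
have [M [M0 aM Mc]] : exists M, [/\ 0 <= M, forall i, (i < n)%N -> `|a i| <= M &
    M <= 0 \/ exists2 i, (i < n)%N & M = `|a i|].
  elim: n {H} => [|n [M [M0 aM Mc]]]; first by exists 0; split=> //; left.
  have [h|h] := leP `|a n| M.
    exists M; split=> //.
      by move=> i; rewrite ltnS leq_eqVlt => /predU1P[->//|]; exact: aM.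
    by case: Mc => [?|[i ? ?]]; [left|right; exists i => //; exact: ltnW].
  exists `|a n|; split=> //; last by right; exists n.
  move=> i; rewrite ltnS leq_eqVlt => /predU1P[->//|/aM ?].
  exact: le_trans (ltW h).
have xwb (B : pred nat) :
    nle (fun t => \sum_(0 <= i < n | B i) a i * (x i t - w i t)) (2 * d * M).
  apply: (@nleW _ (\sum_(0 <= i < n | B i) M * (d * 2 ^- i))); last first.
    apply: nle_sum => i /aM ai _ u Du.
    by rewrite normrM ler_pM ?normr_ge0 ?xw.
  apply: (@le_trans _ _ (\sum_(0 <= i < n) M * (d * 2 ^- i))).
    rewrite big_mkcond ler_sum// => i _; case: ifP => // _.
    by rewrite !mulr_ge0 // invr_ge0 exprn_ge0.
  rewrite -mulr_sumr -mulr_sumr mulrC [2 * d]mulrC.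
  by rewrite ler_wpM2r// ler_wpM2l// sum_geometric2.
have Hx : nle (fun t => \sum_(0 <= i < n) a i * x i t) (c + 2 * d * M).
  apply: nle_ext (nleD H (xwb xpredT)) => u Du.
  by rewrite -big_split/=; apply: eq_bigr => i _; ring.
have c0 : 0 <= c by exact: le_trans (normr_ge0 _) (H _ Dt).
have MK : M <= 2 * (K * c).
  case: Mc => [|[i ilt Mi]].
    by move=> /le_trans; apply; rewrite !mulr_ge0.
  have [u Du xu] := x1 i.
  have := uncond_coef ilt Hx Du; rewrite normrM -Mi => h.
  have h1 : M <= K * (c + 2 * d * M).
    by apply: le_trans h; rewrite -{1}[M]mulr1 ler_wpM2l.
  have : 4 * d * K * M <= 1 * M by rewrite ler_wpM2r.
  nra.
have := nleB (ux b Hx) (xwb b) Dt; rewrite -sumrB /=.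
under eq_bigr => i _ do rewrite -mulrBr opprB addrC subrK.
move=> /le_trans; apply.
have : 2 * d * M <= 2 * d * (2 * (K * c)) by rewrite ler_wpM2l// mulr_ge0.
have : 4 * d * K * c <= 1 * c by rewrite ler_wpM2r.
have : 4 * d * K * (K * c) <= 1 * (K * c) by rewrite ler_wpM2r// mulr_ge0.
have : 2 * d * M * K <= 2 * d * (2 * (K * c)) * K.
  by rewrite ler_wpM2r// ler_wpM2l// mulr_ge0.
nra.
Qed.

End unconditional.
End sup_bounds.

(** * Functionals of Gowers--Maurey type *)

(** Base 2 logarithms of [m j] and [len j]. A weight is twice the previous length times the square
    of the previous weight, so that it absorbs one error per child; a length is a large power of the
    previous one, so that it absorbs the constants of [tree_bound]. *)
Fixpoint weight_exponents (j : nat) : nat * nat :=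
  if j is j'.+1 then
    let p := weight_exponents j' in
    let mu := (p.2 + 2 * p.1).+1 in (mu, (p.2 + 10) * (10 * mu))%N
  else (1, 10)%N.
Definition mu j := (weight_exponents j).1.
Definition nu j := (weight_exponents j).2.
Definition len j := (2 ^ nu j)%N.

Lemma muS j : mu j.+1 = (nu j + 2 * mu j).+1. Proof. by []. Qed.
Lemma nuS j : nu j.+1 = ((nu j + 10) * (10 * mu j.+1))%N. Proof. by []. Qed.

Lemma mu_gt0 j : (0 < mu j)%N. Proof. by case: j. Qed.

Lemma mu_mono : {homo mu : i j / (i <= j)%N}.
Proof. by apply: homo_leq => //; [exact: leq_trans|move=> j; rewrite muS; lia]. Qed.

Lemma nu_mono : {homo nu : i j / (i <= j)%N}.
Proof.
apply: homo_leq => //; [exact: leq_trans|move=> j; rewrite nuS].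
have := mu_gt0 j.+1; nia.
Qed.

Lemma len_mono : {homo len : i j / (i <= j)%N}.
Proof. by move=> i j /nu_mono ij; rewrite /len leq_exp2l. Qed.

Lemma leq_mu j : (j <= mu j)%N.
Proof. by elim: j => // j IH; rewrite muS; lia. Qed.

(* Norming functionals, evaluated by [ev] below: a coordinate at level 1, a functional
   moved below the child [n] of the root, and [1 / m j] times the sum of a list, restricted
   to the vectors below the children in [a, b). *)
Inductive term :=
  | At of nat
  | Sh of nat & term
  | Nd of nat & nat & nat & seq term.

Section term_induction.
Variable P : term -> Prop.
Hypotheses (PAt : forall n, P (At n)) (PSh : forall n g, P g -> P (Sh n g)).
Hypothesis PNd : forall a b j l, List.Forall P l -> P (Nd a b j l).

Fixpoint term_nested_ind t : P t :=
  match t with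
  | At n => PAt n
  | Sh n g => PSh n (term_nested_ind g)
  | Nd a b j l => PNd a b j
      ((fix all_ind l : List.Forall P l :=
          if l is g :: l' then List.Forall_cons g (term_nested_ind g) (all_ind l')
          else List.Forall_nil P) l)
  end.
End term_induction.

(** Countability of terms provides [pickle], the injective coding of lists of functionals on which
    special lists rest. *)
Fixpoint term_encode (t : term) : GenTree.tree (nat + nat * nat * nat) :=
  match t with
  | At n => GenTree.Leaf (inl n)
  | Sh n g => GenTree.Node 1 [:: GenTree.Leaf (inl n); term_encode g]
  | Nd a b j l => GenTree.Node 0 (GenTree.Leaf (inr (a, b, j)) :: map term_encode l)
  end.

Fixpoint term_decode (t : GenTree.tree (nat + nat * nat * nat)) : term :=
  match t with
  | GenTree.Leaf (inl n) => At n
  | GenTree.Node 1 [:: GenTree.Leaf (inl n); g] => Sh n (term_decode g)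
  | GenTree.Node 0 (GenTree.Leaf (inr (a, b, j)) :: l) => Nd a b j (map term_decode l)
  | _ => At 0
  end.

Lemma term_encodeK : cancel term_encode term_decode.
Proof.
elim/term_nested_ind => //= [n g ->//|a b j l IH].
by congr Nd; elim: IH => //= g l' -> _ ->.
Qed.

HB.instance Definition _ := Countable.copy term (can_type term_encodeK).

Lemma term_ind_in (P : term -> Prop) :
  (forall n, P (At n)) -> (forall n g, P g -> P (Sh n g)) ->
  (forall a b j (l : seq term), (forall g, g \in l -> P g) -> P (Nd a b j l)) ->
  forall t, P t.
Proof.
move=> PA PS PN; elim/term_nested_ind => // a b j l H; apply: PN.
by elim: H => [//|g l' Pg _ IH h]; rewrite inE => /predU1P[->//|/IH].
Qed.

(** Outside the children in [[lo t, hi t)] the functional vanishes ([ev_out]). *)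
Definition lo t := match t with At n | Sh n _ => n | Nd a _ _ _ => a end.
Definition hi t := match t with At n | Sh n _ => n.+1 | Nd _ b _ _ => b end.
Definition successive : rel term := fun g h => (hi g <= lo h)%N.

(** An atom outside [[a, b)] becomes an empty sum, whose ends are chosen such that [lo_trunc] and
    [hi_trunc] hold in all cases. A truncated sum keeps its list and therefore stays valid. *)
Definition trunc a b t :=
  match t with
  | Nd a' b' j l => Nd (maxn a a') (minn b b') j l
  | At n | Sh n _ =>
    if (a <= n < b)%N then t else Nd (maxn a n) (minn b n.+1) 0 [::]
  end.

(** Injective in [l], larger than [j], and even: a member of a special list has itself a list under
    no specialness constraint. *)
Definition coding j (l : seq term) := (2 * (j + pickle l).+1)%N.

Definition has_weight i t := if t is Nd _ _ j _ then j == i else false.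

Definition special j (l : seq term) :=
  all (fun q => has_weight (coding j (take q l)) (nth (At 0) l q)) (iota 0 (size l)).

Fixpoint valid t :=
  match t with
  | At _ => true
  | Sh _ g => valid g
  | Nd _ _ j l => [&& all valid l, pairwise successive l, (size l <= len j)%N &
                    odd j ==> special j l]
  end.

Lemma lo_trunc a b t : lo (trunc a b t) = maxn a (lo t).
Proof. by case: t => //= *; case: ifP => //=; lia. Qed.

Lemma hi_trunc a b t : hi (trunc a b t) = minn b (hi t).
Proof. by case: t => //= *; case: ifP => //=; lia. Qed.

Lemma valid_trunc a b t : valid t -> valid (trunc a b t).
Proof. by case: t => //= *; case: ifP. Qed.

Lemma pairwise_trunc a b l :
  pairwise successive l -> pairwise successive (map (trunc a b) l).
Proof.
rewrite pairwise_map; apply: sub_pairwise => g h.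
by rewrite /= /successive hi_trunc lo_trunc; lia.
Qed.

Lemma validNd a b j l : valid (Nd a b j l) ->
  [/\ forall g, g \in l -> valid g, pairwise successive l & (size l <= len j)%N].
Proof. by move=> /= /and4P[/allP]. Qed.

(** * Values of functionals on unit vectors and on finitely supported vectors *)

Section evaluation.
Variable R : realType.
Implicit Types (x : term -> R) (t : term) (s : seq nat).

Definition m j : R := 2 ^+ mu j.

Lemma m_gt0 j : 0 < m j. Proof. by rewrite exprn_gt0. Qed.
Hint Resolve m_gt0 : core.
Lemma m_ge2 j : 2 <= m j.
Proof. by rewrite -[leLHS]expr1 ler_eXn2l ?mu_gt0 // ltr1n. Qed.
Lemma m_mono i j : (i <= j)%N -> m i <= m j.
Proof. by move=> /mu_mono; rewrite ler_eXn2l // ltr1n. Qed.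
Lemma m_unbounded (M : R) : exists i, M <= m i.
Proof.
have [n nM] := pow2_gt M; exists n; apply: (le_trans (ltW nM)).
by rewrite ler_eXn2l ?leq_mu // ltr1n.
Qed.

Fixpoint ev t s : R :=
  match t with
  | At n => (s == [:: n])%:R
  | Sh n g => if s is k :: s' then (k == n)%:R * ev g s' else 0
  | Nd a b j l =>
    (a <= head 0%N s < b)%N%:R * (m j)^-1 * (\sum_(r <- map (ev^~ s) l) r)
  end.

Lemma evNd a b j l s : ev (Nd a b j l) s =
  (a <= head 0%N s < b)%N%:R * (m j)^-1 * \sum_(g <- l) ev g s.
Proof. by rewrite /= big_map. Qed.

(** The root carries no vector: only nonempty sequences index unit vectors. *)
Lemma ev_nil t : ev t [::] = 0.
Proof.
elim/term_ind_in: t => // a b j l IH.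
by rewrite evNd big_seq big1 ?mulr0.
Qed.

Lemma ev_trunc a b t s : ev (trunc a b t) s = (a <= head 0%N s < b)%N%:R * ev t s.
Proof.
case: s => [|k s]; first by rewrite !ev_nil mulr0.
case: t => [n|n g|a' b' j l].
- rewrite /trunc; case: ifP => h.
    by rewrite /= eqseq_cons; case: eqP => [->|]; rewrite ?h ?mul1r // mulr0.
  rewrite evNd big_nil mulr0 /= eqseq_cons.
  by case: eqP => [->|]; rewrite ?h ?mul0r // mulr0.
- rewrite /trunc; case: ifP => h.
    by rewrite /=; case: eqP => [->|]; rewrite ?h ?mul1r // mul0r mulr0.
  rewrite evNd big_nil mulr0 /=.
  by case: eqP => [->|]; rewrite ?h ?mul0r // mulr0.
- rewrite !evNd !mulrA; congr (_ * _ * _); rewrite -natrM mulnb; congr (_%:R).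
  by congr nat_of_bool => /=; lia.
Qed.

Lemma ev_out t s : s != [::] -> ~~ (lo t <= head 0%N s < hi t)%N -> ev t s = 0.
Proof.
case: s => // k s _; case: t => [n|n g|a b j l] h.
- rewrite /= eqseq_cons; case: eqP h => //= ->; lia.
- rewrite /=; case: eqP h => //= [->|]; [lia|by rewrite mul0r].
- by rewrite evNd (negbTE h) !mul0r.
Qed.

Lemma ev_sum_children (l : seq term) s : pairwise successive l ->
  \sum_(g <- l) ev g s = 0 \/ exists2 g, g \in l & \sum_(g <- l) ev g s = ev g s.
Proof.
have [->|s0] := eqVneq s [::].
  by left; rewrite big1// => g _; rewrite ev_nil.
elim: l => [|g l IH]; first by left; rewrite big_nil.
rewrite pairwise_cons big_cons => /andP[/allP gl /IH {}IH].
have [/andP[h1 h2]|h] := boolP (lo g <= head 0%N s < hi g)%N.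
  right; exists g; rewrite ?mem_head // big_seq big1 ?addr0// => h hl.
  by apply: ev_out => //; have := gl _ hl; rewrite /successive; lia.
rewrite (ev_out s0 h) add0r.
case: IH => [->|[h' hl ->]]; first by left.
by right; exists h' => //; rewrite inE hl orbT.
Qed.

(** A unit vector is seen along a single path of nested sums, so its value is 0 or a product of
    inverse weights. *)
Lemma ev_dyadic t s : valid t -> ev t s = 0 \/ exists k, ev t s = 2 ^- k.
Proof.
elim/term_ind_in: t s => [n|n g IH|a b j l IH] s.
- move=> _ /=; case: eqP => _; [right; exists 0%N|by left].
  by rewrite expr0 invr1.
- case: s => [|k s] /= vg; first by left.
  have [->|[k' ->]] := IH s vg; first by left; rewrite mulr0.
  by case: eqP => _; [right; exists k'; rewrite mul1r|left; rewrite mul0r].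
- move=> /validNd[vl pl _]; rewrite evNd.
  case: (_ <= _ < _)%N; last by left; rewrite !mul0r.
  rewrite mul1r; have [->|[g gl ->]] := ev_sum_children s pl.
    by left; rewrite mulr0.
  have [->|[k ->]] := IH _ gl s (vl _ gl); first by left; rewrite mulr0.
  by right; exists (mu j + k)%N; rewrite exprD invfM.
Qed.

Lemma ev_le1 t s : valid t -> 0 <= ev t s <= 1.
Proof.
move=> /(ev_dyadic s)[->|[k ->]]; first by rewrite lexx ler01.
by rewrite invr_ge0 exprn_ge0 //= invf_le1 ?exprn_gt0 // exprn_ege1 // ler1n.
Qed.

Lemma ev_le_weight a b j l s : valid (Nd a b j l) -> `|ev (Nd a b j l) s| <= (m j)^-1.
Proof.
move=> /validNd[vl pl _]; rewrite evNd !normrM normfV (gtr0_norm (m_gt0 j)).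
rewrite -[leRHS]mul1r -[leRHS]mulr1 ler_pM ?mulr_ge0 ?invr_ge0 ?(ltW (m_gt0 j)) //.
  by rewrite ler_wpM2r ?invr_ge0 ?(ltW (m_gt0 j)) //; case: (_ <= _ < _)%N;
     rewrite ?normr1 ?normr0.
have [->|[g gl ->]] := ev_sum_children s pl; first by rewrite normr0.
by have /andP[? ?] := ev_le1 s (vl _ gl); rewrite ger0_norm.
Qed.

Definition comb (I T : Type) (E : I -> T -> R) (l : seq (R * I)) : T -> R :=
  fun u => \sum_(p <- l) p.1 * E p.2 u.

(** Vectors are functions on terms, so that two combinations are equal as soon as all functionals
    agree on them. *)
Definition spanned (S : set (seq nat)) x :=
  exists l : seq (R * seq nat), (forall p, p \in l -> S p.2) /\
    forall t, x t = comb (fun s => ev^~ s) l t.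

Lemma spanned_le S S' x : S `<=` S' -> spanned S x -> spanned S' x.
Proof. by move=> SS' [l [lS xl]]; exists l; split=> // p /lS /SS'. Qed.

Lemma spanned0 S : spanned S (fun=> 0).
Proof. by exists [::]; split=> // t; rewrite /comb big_nil. Qed.

Lemma spanned_ev (S : set (seq nat)) s : S s -> spanned S (ev^~ s).
Proof.
move=> Ss; exists [:: (1, s)]; split=> [p|t].
  by rewrite inE => /eqP ->.
by rewrite /comb big_seq1 mul1r.
Qed.

Lemma spanned_ext S x y : (forall t, x t = y t) -> spanned S x -> spanned S y.
Proof. by move=> xy [l [lS xl]]; exists l; split=> // t; rewrite -xy. Qed.

Lemma spannedD S x y : spanned S x -> spanned S y -> spanned S (fun t => x t + y t).
Proof.
move=> [l [lS xl]] [k [kS yk]]; exists (l ++ k); split=> [p|t].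
  by rewrite mem_cat => /orP[/lS|/kS].
by rewrite /comb big_cat /= xl yk.
Qed.

Lemma spannedZ S c x : spanned S x -> spanned S (fun t => c * x t).
Proof.
move=> [l [lS xl]]; exists [seq (c * p.1, p.2) | p <- l]; split=> [p|t].
  by move=> /mapP[q ql ->]; exact: (lS _ ql).
rewrite /comb big_map xl /comb mulr_sumr; apply: eq_bigr => i _.
by rewrite /= mulrA.
Qed.

Lemma spannedB S x y : spanned S x -> spanned S y -> spanned S (fun t => x t - y t).
Proof.
move=> Sx /(spannedZ (-1)) /(spannedD Sx); apply: spanned_ext => t.
by rewrite mulN1r.
Qed.

Lemma spanned_sum S (I : Type) (r : seq I) (P : pred I) (x : I -> term -> R) :
  (forall i, P i -> spanned S (x i)) -> spanned S (fun t => \sum_(i <- r | P i) x i t).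
Proof.
move=> Sx; elim: r => [|i r IH].
  by apply: spanned_ext (spanned0 S) => t; rewrite big_nil.
have [Pi|nPi] := boolP (P i).
  by apply: spanned_ext (spannedD (Sx _ Pi) IH) => t; rewrite big_cons Pi.
by apply: spanned_ext IH => t; rewrite big_cons (negbTE nPi).
Qed.

Lemma spanned_ind (S : set (seq nat)) (P : (term -> R) -> Prop) :
  (forall x y, (forall t, x t = y t) -> P x -> P y) -> P (fun=> 0) ->
  (forall c s x, S s -> P x -> P (fun t => c * ev t s + x t)) ->
  forall x, spanned S x -> P x.
Proof.
move=> Pext P0 PD x [l [lS xl]]; apply: (Pext _ _ (fun t => esym (xl t))).
elim: l lS {xl} => [|p l IH] lS.
  by apply: (Pext _ _ _ P0) => t; rewrite /comb big_nil.
apply: (Pext _ _ _ (PD p.1 p.2 _ (lS p (mem_head _ _)) (IH _))) => [t|q ql].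
  by rewrite /comb big_cons.
by apply: lS; rewrite inE ql orbT.
Qed.

Lemma spanned_support S x t : spanned S x -> (forall s, S s -> ev t s = 0) -> x t = 0.
Proof.
move=> Sx evS; elim/spanned_ind: Sx => [y z <-//|//|c s y Ss ->].
by rewrite evS // mulr0 addr0.
Qed.

Notation vec := (spanned setT).

Lemma vecNd x a b j l : vec x ->
  x (Nd a b j l) = (m j)^-1 * \sum_(g <- l) x (trunc a b g).
Proof.
elim/spanned_ind => [y z yz|/=|c s y _ IH].
- by rewrite yz; under eq_bigr do rewrite yz.
- by rewrite big1 ?mulr0.
- rewrite IH evNd big_split /= mulrDr; congr (_ + _).
  rewrite -mulr_sumr; under [in RHS]eq_bigr do rewrite ev_trunc.
  rewrite -mulr_sumr.
  move: (\sum_(g <- l) _) ((_ <= _ < _)%N%:R : R) (m j)^-1 => w1 w2 w3; ring.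
Qed.

Lemma vec_trunc_trunc x a b a' b' t : vec x ->
  x (trunc a b (trunc a' b' t)) = x (trunc (maxn a a') (minn b b') t).
Proof.
elim/spanned_ind => [y z yz|//|c s y _ IH]; first by rewrite !yz.
rewrite IH !ev_trunc; congr (_ + _); congr (_ * _); rewrite mulrA -natrM mulnb.
have -> : ((a <= head 0 s < b) && (a' <= head 0 s < b') =
  (maxn a a' <= head 0 s < minn b b'))%N by lia.
by [].
Qed.

Lemma vec_trunc_self x t : vec x -> x (trunc (lo t) (hi t) t) = x t.
Proof.
elim/spanned_ind => [y z yz|//|c s y _ IH]; first by rewrite !yz.
rewrite IH !ev_trunc; congr (_ * _ + _).
have [->|s0] := eqVneq s [::]; first by rewrite ev_nil mulr0.
have [h|h] := boolP (lo t <= head 0%N s < hi t)%N; first by rewrite mul1r.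
by rewrite ev_out // mulr0.
Qed.

Lemma vec_trunc_empty x a b t : vec x -> (b <= a)%N -> x (trunc a b t) = 0.
Proof.
move=> vx ba; elim/spanned_ind: vx => [y z yz|//|c s y _ IH]; first by rewrite -yz.
rewrite IH ev_trunc; have -> : (a <= head 0 s < b)%N = false by lia.
by rewrite mul0r mulr0 addr0.
Qed.

(** The sum of the absolute values of the coefficients serves for both bounds. The second bound
    makes a fixed vector negligible for functionals of large weight. *)
Lemma vec_bounded x : vec x -> exists M, [/\ 0 <= M, nle valid x M &
  forall a b i l, valid (Nd a b i l) -> `|x (Nd a b i l)| <= M / m i].
Proof.
elim/spanned_ind => [y z yz [M [? yM ?]]|/=|c s y _ [M [M0 yM yMi]]].
- exists M; split=> //; first by move=> t /yM; rewrite yz.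
  by move=> a b i l; rewrite -yz; auto.
- by exists 0; split=> // [t _|a b i l _]; rewrite normr0 // mul0r.
- exists (`|c| + M); split=> [|t vt|a b i l vt]; first by rewrite addr_ge0.
    rewrite (le_trans (ler_normD _ _)) // lerD ?yM // normrM.
    rewrite -[leRHS]mulr1 ler_wpM2l //.
    by have /andP[? ?] := ev_le1 s vt; rewrite ger0_norm.
  rewrite (le_trans (ler_normD _ _)) // mulrDl lerD ?yMi // normrM.
  by rewrite ler_wpM2l // ev_le_weight.
Qed.

(** Invariance under truncation expresses that the support lies below the children in [[a, b)]. *)
Definition lives a b x := forall t, x (trunc a b t) = x t.

Lemma lives_out a b x t : vec x -> lives a b x ->
  (hi t <= a)%N || (b <= lo t)%N -> x t = 0.
Proof.
move=> vx xab h; rewrite -vec_trunc_self // -xab vec_trunc_trunc //.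
by rewrite vec_trunc_empty //; lia.
Qed.

Lemma lives_le a b a' b' x : vec x -> lives a b x -> (a' <= a)%N -> (b <= b')%N ->
  lives a' b' x.
Proof.
move=> vx xab aa bb t; rewrite -xab vec_trunc_trunc //.
by have /maxn_idPl -> := aa; have /minn_idPl -> := bb; exact: xab.
Qed.

Lemma vec_lives x : vec x -> exists N, lives 0 N x.
Proof.
move=> vx; suff : vec x /\ exists N, lives 0 N x by case.
elim/spanned_ind: vx => [y z yz [vy [N yN]]|/=|c s y _ [vy [N yN]]].
- by split; [exact: spanned_ext vy|exists N => t; rewrite -!yz].
- by split; [exact: spanned0|exists 0%N].
- split; first exact/spannedD/vy/spannedZ/spanned_ev.
  exists (maxn (head 0%N s).+1 N) => t; rewrite ev_trunc.
  rewrite (_ : (_ <= _ < _)%N = true) ?mul1r; last by lia.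
  by congr (_ + _); apply: (lives_le vy yN) => //; lia.
Qed.

End evaluation.

Arguments spanned0 {R} S.
Arguments spanned_ev {R S} s Ss.

Notation vec := (spanned setT).

Lemma sum_one_exception (R : realType) (f : nat -> R) u v l0 be C :
  0 <= be -> 0 <= C -> (u <= v)%N -> `|f l0| <= C ->
  (forall l, (u <= l < v)%N -> l != l0 -> `|f l| <= be) ->
  `|\sum_(u <= l < v) f l| <= C + be * (v - u)%:R.
Proof.
move=> be0 C0 uv fl0 fl; apply: le_trans (ler_norm_sum _ _ _) _.
apply: (@le_trans _ _ (\sum_(u <= l < v) ((if l == l0 then C else 0) + be))).
  rewrite big_nat_cond [leRHS]big_nat_cond ler_sum // => l /andP[ul _].
  case: eqVneq => [->|ne]; first by rewrite (le_trans fl0) // lerDl.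
  by rewrite add0r fl.
rewrite big_split /= -big_mkcond big_nat1_eq sumr_const_nat mulr_natr lerD2r.
by case: ifP.
Qed.

(** * Sums of vectors supported on successive intervals of children *)

Section families.
Context {R : realType}.
Variables (x : nat -> term -> R) (c : nat -> nat).
Hypotheses (cm : forall l, (c l <= c l.+1)%N) (vx : forall l, vec (x l)).
Hypothesis lx : forall l, lives (c l) (c l.+1) (x l).

Lemma cuts_mono : {homo c : i j / (i <= j)%N}.
Proof. by apply: homo_leq => //; exact: leq_trans. Qed.

Lemma vec_sum_nat u v : vec (fun t => \sum_(u <= l < v) x l t).
Proof. by apply: spanned_sum. Qed.

(* Cut the family at the first index not entirely to the left of [hi g] for the
   head [g] of [L]; the remaining functionals only see the second part. *)
Lemma children_sum L u v al be C : 0 <= al -> 0 <= be -> 0 <= C -> (u <= v)%N ->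
  pairwise successive L ->
  (forall g, g \in L -> forall u' v', (u <= u')%N -> (u' <= v')%N -> (v' <= v)%N ->
    `|\sum_(u' <= l < v') x l g| <= al + be * (v' - u')%:R) ->
  (forall g, g \in L -> forall l, (u <= l < v)%N -> `|x l g| <= C) ->
  \sum_(g <- L) `|\sum_(u <= l < v) x l g| <=
    (size L)%:R * (al + C) + be * (v - u)%:R.
Proof.
move=> al0 be0 C0; elim: L u => [|g L IH] u uv.
  by rewrite big_nil mul0r add0r mulr_ge0.
rewrite pairwise_cons => /andP[/allP gL pL] Hs Hc.
have exw : exists w, (u <= w)%N && ((v <= w)%N || (hi g < c w.+1)%N).
  by exists v; rewrite uv leqnn.
case: (ex_minnP exw) => w /andP[uw wP] wmin {exw}.
have wv : (w <= v)%N by apply: wmin; rewrite uv leqnn.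
have before l : (u <= l < w)%N -> (c l.+1 <= hi g)%N.
  move=> /andP[ul lw]; rewrite leqNgt; apply/negP => h.
  by have := wmin l; rewrite ul h orbT leqNgt lw => /(_ isT).
have after l : (w < v)%N -> (w < l)%N -> x l g = 0.
  move=> wv' wl; apply: lives_out (lx l) _ => //.
  move: wP; rewrite leqNgt wv' /= => h.
  by rewrite (leq_trans (ltnW h)) // cuts_mono.
have tail h : h \in L -> \sum_(u <= l < v) x l h = \sum_(w <= l < v) x l h.
  move=> hL; rewrite (big_cat_nat (n := w)) //= big_nat big1 ?add0r // => l lw.
  apply: lives_out (lx l) _ => //; have := gL _ hL; have := before _ lw.
  by rewrite /successive => /leq_trans h1 /h1 ->; rewrite orbT.
rewrite big_cons [X in _ + X](eq_big_seq (fun h => `|\sum_(w <= l < v) x l h|));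
  last by move=> h hL; rewrite tail.
have hgL : g \in g :: L by rewrite mem_head.
have H1 : `|\sum_(u <= l < v) x l g| <= al + be * (w - u)%:R + C.
  rewrite (big_cat_nat (n := w)) //=.
  rewrite (le_trans (ler_normD _ _)) // lerD ?Hs //.
  have [wv'|vw] := ltnP w v; last by rewrite big_geq // normr0.
  rewrite big_ltn // big_nat big1 ?addr0 ?Hc ?uw // => l /andP[wl _].
  exact: after.
have {IH} H2 : \sum_(h <- L) `|\sum_(w <= l < v) x l h| <=
    (size L)%:R * (al + C) + be * (v - w)%:R.
  apply: IH => // [h hL u' v' wu' u'v' v'v|h hL l /andP[wl lv]].
    by apply: Hs => //; rewrite ?inE ?hL ?orbT // (leq_trans uw).
  by apply: Hc; rewrite ?inE ?hL ?orbT // (leq_trans uw wl).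
apply: le_trans (lerD H1 H2) _.
have -> : (v - u)%:R = (w - u)%:R + (v - w)%:R :> R by rewrite -natrD; congr (_%:R); lia.
rewrite /= -[(size L).+1]addn1 natrD; lra.
Qed.

Lemma sum_within g l u v : (c l <= lo g)%N -> (hi g <= c l.+1)%N ->
  \sum_(u <= l' < v) x l' g = if (u <= l < v)%N then x l g else 0.
Proof.
move=> gl gh; rewrite -(big_nat1_eq +%R (fun=> x l g)) [RHS]big_mkcond /=.
apply: eq_bigr => l' _; case: eqVneq => [->//|].
rewrite neq_ltn => ll'; apply: lives_out (lx l') _ => //.
by apply/orP; case/orP: ll' => /cuts_mono h; [right|left]; lia.
Qed.

(** A functional confined to one child meets at most one member of the family. *)
Lemma sum_single_level t u v C : (hi t <= (lo t).+1)%N -> (u <= v)%N -> 0 <= C ->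
  (forall l, `|x l t| <= C) -> `|\sum_(u <= l < v) x l t| <= C.
Proof.
move=> tlev uv C0 xC.
have [[l0 xl0]|none] := pselect (exists l0, x l0 t != 0); last first.
  rewrite big1 ?normr0 // => l _.
  by apply: contra_notP none => /eqP ?; exists l.
have : `|\sum_(u <= l < v) x l t| <= C + 0 * (v - u)%:R.
  apply: (@sum_one_exception _ (x^~ t) u v l0) => // l _ ne.
  have : ~~ ((hi t <= c l0)%N || (c l0.+1 <= lo t)%N).
    by apply: contra xl0 => h; apply/eqP; apply: lives_out (lx l0) h.
  rewrite negb_or -!ltnNge => /andP[h1 h2].
  rewrite (lives_out _ (lx l)) ?normr0 //.
  move: ne; rewrite neq_ltn => /orP[/cuts_mono|/cuts_mono] h.
    by apply/orP; right; lia.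
  by apply/orP; left; lia.
by rewrite mul0r addr0.
Qed.

Lemma tree_bound (N j K : nat) (C : R) : 0 <= C -> (0 < N)%N ->
  (forall i, (i < j)%N -> (len i <= N)%N) ->
  (forall l, nle valid (x l) C) ->
  (forall a b i L, valid (Nd a b i L) -> (j <= i)%N -> forall u v, (u <= v)%N ->
    `|\sum_(u <= l < v) x l (Nd a b i L)| <= C * (1 + (v - u)%:R / 2 ^+ K)) ->
  forall k, (k <= K)%N -> forall t, valid t -> forall u v, (u <= v)%N ->
    `|\sum_(u <= l < v) x l t| <= C * ((2 * N%:R) ^+ k + (v - u)%:R / 2 ^+ k).
Proof.
move=> C0 N0 lenN xC Hj; elim=> [_ t vt u v uv|k IH kK t vt u v uv].
  rewrite expr0 divr1 mulrDr mulr1.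
  by apply: (@sum_one_exception _ (x^~ t) u v 0) => // *; exact: xC.
have N1 : 1 <= N%:R :> R by rewrite ler1n.
have P1 : 1 <= (2 * N%:R) ^+ k.+1 :> R by rewrite exprn_ege1 //; lra.
have vu0 : 0 <= (v - u)%:R :> R by [].
have small : `|\sum_(u <= l < v) x l t| <= C -> `|\sum_(u <= l < v) x l t| <=
    C * ((2 * N%:R) ^+ k.+1 + (v - u)%:R / 2 ^+ k.+1).
  move=> /le_trans; apply; rewrite -[leLHS]mulr1 ler_wpM2l //.
  by rewrite -[leLHS]addr0 lerD // divr_ge0 // exprn_ge0.
case: t vt small => [n vt|n g vt|a b i L vt _].
- by apply; apply: sum_single_level => // l; exact: xC.
- by apply; apply: sum_single_level => // l; exact: xC.
have [ij|ji] := ltnP i j; last first.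
  apply: le_trans (Hj _ _ _ _ vt ji _ _ uv) _.
  rewrite ler_wpM2l // lerD // ler_wpM2l // lef_pV2 ?posrE ?exprn_gt0 //.
  by rewrite ler_eXn2l // ltr1n.
rewrite (vecNd _ _ _ _ (vec_sum_nat u v)) normrM normfV (gtr0_norm (m_gt0 R i)).
have [vL pL sL] := validNd vt.
have vL' g : g \in map (trunc a b) L -> valid g.
  by move=> /mapP[h hL ->]; apply/valid_trunc/vL.
have := @children_sum (map (trunc a b) L) u v (C * (2 * N%:R) ^+ k)
  (C / 2 ^+ k) C.
rewrite size_map big_map => /(_ _ _ _ uv (pairwise_trunc a b pL)) H.
have {}H : `|\sum_(g <- L) \sum_(u <= l < v) x l (trunc a b g)| <=
    N%:R * (C * (2 * N%:R) ^+ k + C) + C / 2 ^+ k * (v - u)%:R.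
  apply: le_trans (ler_norm_sum _ _ _) _.
  apply: le_trans (H _ _ _ _ _) _ => //.
  - by rewrite mulr_ge0 // exprn_ge0 // mulr_ge0.
  - by rewrite divr_ge0 // exprn_ge0.
  - move=> g /vL' vg u' v' _ uv' _.
    apply: le_trans (IH (ltnW kK) _ vg _ _ uv') _.
    by rewrite mulrDr mulrA mulrAC.
  - by move=> g /vL' vg l _; exact: xC.
  rewrite lerD2r ler_wpM2r //.
    by rewrite addr_ge0 // mulr_ge0 // exprn_ge0 // mulr_ge0.
  by rewrite ler_nat (leq_trans sL) // lenN.
apply: (@le_trans _ _ (2^-1 * (N%:R * (C * (2 * N%:R) ^+ k + C) +
    C / 2 ^+ k * (v - u)%:R))).
  apply: ler_pM => //; first by rewrite invr_ge0 (ltW (m_gt0 _ _)).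
  by rewrite lef_pV2 ?posrE ?m_gt0 // m_ge2.
have Pk : 1 <= (2 * N%:R) ^+ k :> R by rewrite exprn_ege1 //; lra.
rewrite !exprS invfM.
set P := (2 * N%:R) ^+ k in Pk *; set Q := (2 ^+ k)^-1.
have h1 : C * N%:R * 1 <= C * N%:R * P by rewrite ler_wpM2l // mulr_ge0.
have h2 : 0 <= C * N%:R by rewrite mulr_ge0.
move: (N%:R : R) (v - u)%:R P Q h1 h2 {Pk vu0 H N1 P1} => N' w P Q h1 h2.
have -> : C * (2 * N' * P + w * (2^-1 * Q)) =
  2^-1 * (N' * (C * P + C) + C * Q * w) + 2^-1 * (3 * (C * N' * P) - C * N').
  by field.
rewrite lerDl; lra.
Qed.

End families.

(** * Blocks of a sequence, and averages of them *)

Section block_sequences.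
Context {R : realType}.
Variables (y : nat -> term -> R) (t : nat -> nat).
Hypotheses (tm : forall k, (t k <= t k.+1)%N) (vy : forall k, vec (y k)).
Hypotheses (ly : forall k, lives (t k) (t k.+1) (y k)).
Hypothesis ny : forall k, nonzero valid (y k).

Definition blk p q (x : term -> R) :=
  exists a : nat -> R, forall u, x u = \sum_(p <= k < q) a k * y k u.

Lemma blk_vec p q x : blk p q x -> vec x.
Proof.
move=> [a xa]; apply: spanned_ext (fun u => esym (xa u)) _.
by apply: spanned_sum => k _; exact: spannedZ.
Qed.

Lemma blk_lives p q x : blk p q x -> lives (t p) (t q) x.
Proof.
move=> [a xa] u; rewrite !xa; apply: eq_big_nat => k /andP[pk kq].
by rewrite (lives_le _ (ly k)) // ?cuts_mono.
Qed.

Lemma blk_le p q p' q' x : (p' <= p)%N -> (p <= q)%N -> (q <= q')%N ->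
  blk p q x -> blk p' q' x.
Proof.
move=> pp pq qq [a xa]; exists (fun k => if (p <= k < q)%N then a k else 0) => u.
rewrite (big_cat_nat (n := p)) //=; last by lia.
rewrite big_nat big1 ?add0r; last by move=> k kp; rewrite ifF ?mul0r //; lia.
rewrite (big_cat_nat (n := q)) //= [X in _ + X]big_nat [X in _ + X]big1 ?addr0.
  by rewrite xa; apply: eq_big_nat => k ->.
by move=> k kp; rewrite ifF ?mul0r //; lia.
Qed.

Lemma blkZ p q c x : blk p q x -> blk p q (fun u => c * x u).
Proof.
move=> [a xa]; exists (fun k => c * a k) => u.
by rewrite xa mulr_sumr; apply: eq_bigr => k _; rewrite mulrA.
Qed.

Lemma blkD p q x z : blk p q x -> blk p q z -> blk p q (fun u => x u + z u).
Proof.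
move=> [a xa] [b zb]; exists (fun k => a k + b k) => u.
by rewrite xa zb -big_split /=; apply: eq_bigr => k _; rewrite mulrDl.
Qed.

Section successive_blocks.
Variables (P : nat -> nat) (X : nat -> term -> R).
Hypotheses (Pm : forall l, (P l <= P l.+1)%N) (PX : forall l, blk (P l) (P l.+1) (X l)).

Let Pmono : {homo P : i j / (i <= j)%N}.
Proof. by apply: homo_leq => //; exact: leq_trans. Qed.

Lemma blk_sum u v : (u <= v)%N ->
  blk (P u) (P v) (fun w => \sum_(u <= l < v) X l w).
Proof.
move=> /subnK <-; elim: (v - u)%N => [|n IH].
  by exists (fun=> 0) => w; rewrite add0n !big_geq.
have [a h] := blkD (blk_le (leqnn _) (Pmono (leq_addl n u)) (Pm _) IH)
  (blk_le (Pmono (leq_addl n u)) (Pm _) (leqnn _) (PX _)).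
by exists a => w; rewrite -h addSn big_nat_recr //= leq_addl.
Qed.

Lemma blocks_lives l : lives (t (P l)) (t (P l.+1)) (X l).
Proof. exact: blk_lives. Qed.

Lemma blocks_cuts l : (t (P l) <= t (P l.+1))%N.
Proof. exact: cuts_mono. Qed.

Lemma blocks_vec l : vec (X l).
Proof. exact: blk_vec (PX l). Qed.

End successive_blocks.

Definition witnesses (L : seq term) a b N :=
  [/\ forall g, g \in L -> [/\ valid g, (a <= lo g)%N & (hi g <= b)%N],
     pairwise successive L & size L = N].

Lemma witnesses_cat L L' a b c N N' : (a <= b)%N -> (b <= c)%N ->
  witnesses L a b N -> witnesses L' b c N' -> witnesses (L ++ L') a c (N + N').
Proof.
move=> ab bc [h1 p1 s1] [h2 p2 s2]; split=> [g||].
- rewrite mem_cat => /orP[/h1[? ? ?]|/h2[? ? ?]]; split=> //; lia.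
- rewrite pairwise_cat p1 p2 !andbT; apply/allrelP => g h /h1[_ _ hg] /h2[_ gh _].
  exact: leq_trans hg gh.
- by rewrite size_cat s1 s2.
Qed.

Lemma block_normalized p : exists x L,
  [/\ blk p p.+1 x, nle valid x 1, witnesses L (t p) (t p.+1) 1 &
      2^-1 <= \sum_(g <- L) x g].
Proof.
have [M [_ yM _]] := vec_bounded (vy p).
have [l [l0 yl [g vg gl]]] := normalize yM (ny p).
have blky : blk p p.+1 (y p).
  by exists (fun=> 1) => u; rewrite big_nat1 mul1r.
pose e : R := if 0 <= l * y p g then 1 else -1.
exists (fun u => e * (l * y p u)), [:: trunc (t p) (t p.+1) g]; split.
- exact/blkZ/blkZ.
- have e1 : `|e| = 1 by rewrite /e; case: ifP; rewrite ?normrN normr1.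
  by apply: nleW (nleZ e yl); rewrite e1 mulr1.
- split=> // h; rewrite inE => /eqP ->; rewrite lo_trunc hi_trunc.
  by split; [exact: valid_trunc|lia|lia].
- rewrite big_seq1 ly /e; case: ifP gl => h; first by rewrite ger0_norm ?mul1r.
  by rewrite ltr0_norm ?mulN1r // ltNge h.
Qed.

Section averages.
Variables (n p : nat).
Hypothesis n0 : (0 < n)%N.
Hypothesis small : forall P X, (p <= P 0%N)%N -> (forall l, (P l <= P l.+1)%N) ->
  (forall l, blk (P l) (P l.+1) (X l)) -> (forall l, nle valid (X l) 1) ->
  nle valid (fun w => \sum_(0 <= l < n) X l w) (n%:R / 2).

(* If all sums of [n] successive blocks are small, blocks with [n ^ s] separate
   norming functionals can be rescaled by a factor [2 / n] at each stage. *)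
Lemma iterated_blocks s p' : (p <= p')%N -> exists q x L,
  [/\ (p' <= q)%N, blk p' q x, nle valid x 1, witnesses L (t p') (t q) (n ^ s) &
      2 ^+ s / 2 <= \sum_(g <- L) x g].
Proof.
elim: s p' => [|s IH] p' pp'.
  have [x [L [bx x1 wL xL]]] := block_normalized p'.
  by exists p'.+1, x, L; split=> //; rewrite expr0 mul1r.
pose Q (_ : nat) (a b : nat * (term -> R) * seq term) := (p <= a.1.1)%N ->
  [/\ (a.1.1 <= b.1.1)%N, blk a.1.1 b.1.1 b.1.2, nle valid b.1.2 1,
      witnesses b.2 (t a.1.1) (t b.1.1) (n ^ s) &
      2 ^+ s / 2 <= \sum_(g <- b.2) b.1.2 g].
have [f [f0 fS]] : exists f : nat -> (nat * (term -> R) * seq term)%type, 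
    f 0%N = (p', (fun=> 0), [::]) /\ forall k, Q k (f k) (f k.+1).
  apply: dependent_choice_nat => k [[a xa] La].
  have [pa|np] := boolP (p <= a)%N; last by exists (a, xa, La) => /= pa; rewrite pa in np.
  have [q [x [L H]]] := IH _ pa.
  by exists (q, x, L).
pose P l := (f l).1.1; pose X l := (f l.+1).1.2; pose W l := (f l.+1).2.
have pP l : (p <= P l)%N.
  elim: l => [|l IHl]; first by rewrite /P f0.
  by have [h _ _ _ _] := fS l IHl; exact: leq_trans h.
have Pm l : (P l <= P l.+1)%N by have [] := fS l (pP l).
have PX l : blk (P l) (P l.+1) (X l) by have [] := fS l (pP l).
have X1 l : nle valid (X l) 1 by have [] := fS l (pP l).
have WW l : witnesses (W l) (t (P l)) (t (P l.+1)) (n ^ s) by have [] := fS l (pP l).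
have XW l : 2 ^+ s / 2 <= \sum_(g <- W l) X l g by have [] := fS l (pP l).
have Pmono : {homo P : i j / (i <= j)%N} by apply: homo_leq => //; exact: leq_trans.
have P0 : P 0%N = p' by rewrite /P f0.
have flattenS k : flatten [seq W l | l <- iota 0 k.+1] =
    flatten [seq W l | l <- iota 0 k] ++ W k.
  by rewrite -addn1 iotaD map_cat flatten_cat /= cats0.
have wits k : witnesses (flatten [seq W l | l <- iota 0 k]) (t (P 0%N)) (t (P k))
    (k * n ^ s).
  elim: k => [|k IHk]; first by split.
  rewrite flattenS mulSn addnC; apply: witnesses_cat IHk (WW k).
    by apply: cuts_mono => //; exact: Pmono.
  by apply: cuts_mono => //; exact: Pm.
have sums k : (k <= n)%N -> k%:R * (2 ^+ s / 2) <=
    \sum_(g <- flatten [seq W l | l <- iota 0 k]) \sum_(0 <= l < n) X l g.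
  elim: k => [|k IHk] kn; first by rewrite big_nil mul0r.
  rewrite flattenS big_cat /= -natr1 mulrDl mul1r lerD ?IHk //; first exact: ltnW.
  apply: le_trans (XW k) _; rewrite big_seq [leRHS]big_seq ler_sum // => g gW.
  have [/(_ _ gW)[_ gl gh] _ _] := WW k.
  rewrite (sum_within (c := t \o P) (l := k) (blocks_cuts Pm) (blocks_vec PX)
    (blocks_lives PX)) //=.
  by rewrite kn.
exists (P n), (fun w => 2 / n%:R * \sum_(0 <= l < n) X l w),
  (flatten [seq W l | l <- iota 0 n]); split.
- by rewrite -P0; exact: Pmono.
- by rewrite -P0; apply: blkZ; exact: blk_sum.
- apply: nleW (nleZ _ (small (pP 0%N) Pm PX X1)).
  rewrite ger0_norm ?divr_ge0 //.
  suff -> : 2 / n%:R * (n%:R / 2) = 1 :> R by [].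
  by field; rewrite pnatr_eq0 -lt0n n0.
- by rewrite -P0 expnS.
- rewrite -mulr_sumr exprS; have := sums n (leqnn n).
  have nz : n%:R != 0 :> R by rewrite pnatr_eq0 -lt0n.
  move=> /(ler_wpM2l (_ : 0 <= 2 / n%:R)) => /(_ _) h.
  apply: le_trans (h _); last by rewrite divr_ge0.
  by rewrite [leRHS](_ : _ = 2 * 2 ^+ s / 2) //; field.
Qed.

End averages.

Lemma len_gt_iterates i j : (i < j)%N -> (len i ^ (mu j + 2) <= len j)%N.
Proof.
case: j => // j /= ij; rewrite /len -expnM leq_exp2l // nuS.
have : (nu i <= nu j)%N by exact: nu_mono.
by have := mu_gt0 j.+1; nia.
Qed.

(** These vectors are averages of [len i] successive blocks in the unit ball. If all such averages
    had norm below 1/2, [iterated_blocks] would produce a vector in the unit ball with too many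
    separate norming functionals. *)
Lemma exists_average i p : exists q x,
  [/\ (p <= q)%N, blk p q x, nle valid x 1, exists2 g, valid g & 2^-1 <= x g &
    forall a b i' L, valid (Nd a b i' L) -> (i' <= i)%N ->
      `|x (Nd a b i' L)| <= 2 / m R i'].
Proof.
apply: contrapT => none.
have n0 : (0 < len i)%N by rewrite expn_gt0.
have nz : (len i)%:R != 0 :> R by rewrite pnatr_eq0 -lt0n.
have npos : 0 < (len i)%:R :> R by rewrite ltr0n.
have small P X : (p <= P 0%N)%N -> (forall l, (P l <= P l.+1)%N) ->
    (forall l, blk (P l) (P l.+1) (X l)) -> (forall l, nle valid (X l) 1) ->
    nle valid (fun w => \sum_(0 <= l < len i) X l w) ((len i)%:R / 2).
  move=> pP Pm PX X1 g vg; rewrite leNgt; apply/negP => gbig; apply: none.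
  have Pmono : {homo P : i j / (i <= j)%N} by apply: homo_leq => //; exact: leq_trans.
  pose s : R := if 0 <= \sum_(0 <= l < len i) X l g then 1 else -1.
  have s1 : `|s| = 1 by rewrite /s; case: ifP; rewrite ?normrN normr1.
  exists (P (len i)), (fun w => s / (len i)%:R * \sum_(0 <= l < len i) X l w).
  split.
  - exact: leq_trans pP (Pmono _ _ (leq0n _)).
  - apply: (@blk_le (P 0%N) (P (len i))) => //; first exact: Pmono.
    by apply: blkZ; exact: blk_sum.
  - have H := nle_sum (b := xpredT) (fun l (_ : (l < len i)%N) _ => X1 l).
    apply: nleW (nleZ (s / (len i)%:R) H).
    rewrite normrM s1 mul1r normfV gtr0_norm // sumr_const_nat subn0.
    by rewrite mulVf.
  - exists g => //; rewrite mulrAC.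
    have -> : s * \sum_(0 <= l < len i) X l g = `|\sum_(0 <= l < len i) X l g|.
      rewrite /s; case: ifP => h; first by rewrite ger0_norm ?mul1r.
      by rewrite ltr0_norm ?mulN1r // ltNge h.
    by rewrite ler_pdivlMr // mulrC ltW.
  (* At most [len i] children cut the [len i] blocks, so the values of the children sum up to at
     most [2 * len i] before averaging. *)
  - move=> a b i' L vN ii'.
    rewrite (vecNd _ _ _ _ (vec_sum_nat (blocks_vec PX) _ _)).
    have [vL pL sL] := validNd vN.
    have := @children_sum _ X (t \o P) (blocks_cuts Pm) (blocks_vec PX)
      (blocks_lives PX) (map (trunc a b) L) 0 (len i) 0 1 1.
    rewrite size_map big_map add0r !mul1r mulr1 subn0.
    move=> /(_ (lexx _) ler01 ler01 (leq0n _) (pairwise_trunc a b pL)) H.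
    have {}H : \sum_(g0 <- L) `|\sum_(0 <= l < len i) X l (trunc a b g0)| <=
        2 * (len i)%:R.
      apply: le_trans (H _ _) _.
      + move=> h /mapP[g' g'L ->] u v _ uv _; rewrite add0r mul1r.
        apply: le_trans (ler_norm_sum _ _ _) _.
        apply: (@le_trans _ _ (\sum_(u <= l < v) 1)).
          by apply: ler_sum => l _; apply: X1; exact/valid_trunc/vL.
        by rewrite sumr_const_nat.
      + by move=> h /mapP[g' g'L ->] l _; apply: X1; exact/valid_trunc/vL.
      + by rewrite mulr_natl mulr2n lerD2r ler_nat (leq_trans sL) // len_mono.
    have m0 := m_gt0 R i'.
    rewrite !normrM s1 mul1r !normfV (gtr0_norm npos) (gtr0_norm m0).
    rewrite mulrCA [2 / _]mulrC ler_wpM2l ?invr_ge0 ?(ltW m0) // ler_pdivrMl //.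
    by rewrite mulrC; apply: le_trans (ler_norm_sum _ _ _) H.
(* At an even index the list of witnesses need not be special. *)
have [j [ij ej]] : exists j, (i < j)%N /\ ~~ odd j.
  by case: (boolP (odd i)) => h; [exists i.+1|exists i.+2]; rewrite /= ?h.
(* With [mu j + 2] stages the witnesses sum up to at least [2 * m j], and by [len_gt_iterates] there
   are at most [len j] of them. The functional of weight [m j] built from them takes a value of at
   least 2 on a vector of the unit ball. *)
have [q [x [L [pq bx x1 [wL pL sL] xL]]]] := iterated_blocks n0 small (mu j + 2) (leqnn p).
have vN : valid (Nd (t p) (t q) j L).
  apply/and4P; split=> //; first by apply/allP => g /wL[].
    by rewrite sL len_gt_iterates.
  by rewrite (negbTE ej).
have := x1 _ vN; rewrite (vecNd _ _ _ _ (blk_vec bx)).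
under eq_bigr do rewrite (blk_lives bx).
apply/negP; rewrite -ltNge (lt_le_trans _ (ler_norm _)) //.
rewrite -ltr_pdivrMl ?invr_gt0 ?m_gt0 // invrK mulr1.
apply: lt_le_trans xL; rewrite exprD /m.
have := exprn_gt0 (mu j) (ltr0n R 2); lra.
Qed.

End block_sequences.

(** * Growth of the weights and lengths *)

Section growth.
Variable R : realType.

Lemma len_gt0 j : 0 < (len j)%:R :> R.
Proof. by rewrite ltr0n expn_gt0. Qed.

Lemma len_ge1 j : 1 <= (len j)%:R :> R.
Proof. by rewrite ler1n expn_gt0. Qed.

(** Makes the constant of [tree_bound], for [N = len j] and up to [2 * mu j.+1] halvings, negligible
    against [len j.+1]. *)
Lemma len_large j : 4 * m R j.+1 ^+ 2 * (len j)%:R *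
  (2 * (len j)%:R) ^+ (2 * mu j.+1) <= (len j.+1)%:R.
Proof.
rewrite /m /len !natrX -exprS -!exprM -[4]/((2 * 2)%:R) natrM -expr2 -!exprD.
rewrite ler_eXn2l ?ltr1n // nuS; have := mu_gt0 j.+1; nia.
Qed.

(** Up to [len j] errors of size [1 / m j.+1] add up to at most [1 / m j ^ 2]. *)
Lemma m_large j : (len j)%:R * m R j ^+ 2 <= m R j.+1.
Proof.
rewrite /m /len natrX -exprM -exprD ler_eXn2l ?ltr1n // muS; lia.
Qed.

Lemma m_sqr j : m R j ^+ 2 <= m R j.+1.
Proof.
apply: le_trans (m_large j); rewrite -[leLHS]mul1r ler_wpM2r ?len_ge1 //.
by rewrite exprn_ge0 // ltW // m_gt0.
Qed.

End growth.

Lemma witnesses_iota (G : nat -> term) (T : nat -> nat) n :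
  (forall l, (T l <= T l.+1)%N) ->
  (forall l, [/\ valid (G l), (T l <= lo (G l))%N & (hi (G l) <= T l.+1)%N]) ->
  witnesses [seq G l | l <- iota 0 n] (T 0%N) (T n) n.
Proof.
move=> TS GT; have Tmono : {homo T : i j / (i <= j)%N}.
  by apply: homo_leq => //; exact: leq_trans.
elim: n => [|n IH]; first by split.
have -> : iota 0 n.+1 = iota 0 n ++ [:: n] by rewrite -addn1 iotaD.
have W1 : witnesses [:: G n] (T n) (T n.+1) 1.
  by split=> // g; rewrite inE => /eqP ->.
by rewrite map_cat -[X in witnesses _ _ _ X]addn1;
   exact: witnesses_cat (Tmono _ _ (leq0n n)) (TS n) IH W1.
Qed.

(** * Rapidly increasing sequences and exact pairs *)

Section exact.
Context {R : realType}.
Variables (y : nat -> term -> R) (t : nat -> nat).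
Hypotheses (tm : forall k, (t k <= t k.+1)%N) (vy : forall k, vec (y k)).
Hypotheses (ly : forall k, lives (t k) (t k.+1) (y k)).
Hypothesis ny : forall k, nonzero valid (y k).
Notation blk := (blk y).

(** Each block is chosen with two thresholds. It is controlled for indices up to the lower one
    because it is an average, and from the upper one on because it is a fixed bounded vector. The
    upper threshold of a block is the lower one of the next block, so a given index is uncontrolled
    for at most one block, the exception [l0]. *)
Lemma rapidly_increasing j p : exists (P : nat -> nat) (X : nat -> term -> R)
    (G : nat -> term),
  [/\ P 0%N = p, forall l, (P l <= P l.+1)%N, forall l, blk (P l) (P l.+1) (X l),
    forall l, nle valid (X l) 1 &
    [/\ forall l, valid (G l) && (2^-1 <= X l (G l)) &
      forall a b i L, valid (Nd a b i L) -> exists l0, forall l, l != l0 ->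
        `|X l (Nd a b i L)| <= 2 / m R (minn i j)]].
Proof.
pose Q (_ : nat) (a b : nat * (term -> R) * nat) :=
  [/\ (a.1.1 <= b.1.1)%N /\ (a.2 <= b.2)%N, blk a.1.1 b.1.1 b.1.2,
      nle valid b.1.2 1, exists2 g, valid g & 2^-1 <= b.1.2 g &
      forall u v i L, valid (Nd u v i L) -> (i <= a.2)%N || (b.2 <= i)%N ->
        `|b.1.2 (Nd u v i L)| <= 2 / m R (minn i j)].
have [f [f0 fS]] : exists f : nat -> (nat * (term -> R) * nat)%type,
    f 0%N = (p, (fun=> 0), j) /\ forall k, Q k (f k) (f k.+1).
  apply: dependent_choice_nat => n0 [[a xa] i].
  have [q [x [aq bx x1 gx xw]]] := exists_average tm vy ly ny i a.
  have [M [M0 _ xM]] := vec_bounded (blk_vec vy bx).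
  have [i' i'M] := m_unbounded (M * m R j).
  exists (q, x, maxn i i'); split=> //=; first by split=> //; exact: leq_maxl.
  move=> u v k L vN /orP[ki|ik].
    apply: le_trans (xw _ _ _ _ vN ki) _; rewrite ler_wpM2l //.
    by rewrite lef_pV2 ?posrE ?m_gt0 // m_mono // geq_minl.
  apply: le_trans (xM _ _ _ _ vN) _.
  have mk : M * m R j <= m R k.
    by apply: le_trans i'M _; rewrite m_mono // (leq_trans (leq_maxr _ _) ik).
  have mj : M * m R (minn k j) <= m R k.
    by apply: le_trans mk; rewrite ler_wpM2l // m_mono // geq_minr.
  rewrite ler_pdivrMr ?m_gt0 // mulrAC ler_pdivlMr ?m_gt0 //.
  have := m_gt0 R k; lra.
have Qf l : Q l (f l) (f l.+1) by exact: fS.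
pose i l := (f l).2.
have iS l : (i l <= i l.+1)%N by have [[_ ?]] := Qf l.
have imono : {homo i : k l / (k <= l)%N} by apply: homo_leq => //; exact: leq_trans.
have /choice[G GP] : forall l, exists g, valid g && (2^-1 <= (f l.+1).1.2 g).
  by move=> l; have [_ _ _ [g vg xg] _] := Qf l; exists g; rewrite vg.
exists (fun l => (f l).1.1), (fun l => (f l.+1).1.2), G; split; last split=> //.
- by rewrite f0.
- by move=> l; have [[]] := Qf l.
- by move=> l; have [] := Qf l.
- by move=> l; have [] := Qf l.
- move=> a b k L vN.
  have [[l0 /andP[h1 h2]]|none] := pselect (exists l0, (i l0 < k < i l0.+1)%N).
    exists l0 => l ll0; have [_ _ _ _ H] := Qf l; apply: H => //.
    case: (leqP k (f l).2) => //= kl; case: (leqP (f l.+1).2 k) => // kl'.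
    move: ll0; rewrite neq_ltn => /orP[/imono|/imono] h.
      by move: h; rewrite leqNgt (leq_trans h1 _) // ltnW.
    by move: h; rewrite leqNgt (leq_trans kl _) // ltnW.
  exists 0%N => l _; have [_ _ _ _ H] := Qf l; apply: H => //.
  case: (leqP k (f l).2) => //= kl; case: (leqP (f l.+1).2 k) => // kl'.
  by exfalso; apply: none; exists l; rewrite kl kl'.
Qed.

(** [z] is a rescaled sum of [len j] rapidly increasing blocks. Functionals of smaller weight are
    estimated by [tree_bound] applied to their children, those of larger weight directly by the
    rapid increase. As [j] is even, norming functionals of the blocks may be collected into one of
    weight [m j] without being special. *)
Lemma exact_pair j p : (0 < j)%N -> ~~ odd j -> exists q z L,
  [/\ (p <= q)%N, blk p q z, valid (Nd (t p) (t q) j L), z (Nd (t p) (t q) j L) = 1 &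
    nle valid z 6 /\ forall a b i L', valid (Nd a b i L') -> i != j ->
      `|z (Nd a b i L')| <= 6 / m R (minn i j)].
Proof.
case: j => // j _ ej.
(* The parameter is [J.+1], one above the index [J] of the pair, so that the error [2 / m J.+1] is
   at most [2 / m J ^ 2] by [m_sqr]. *)
have [P [X [G [P0 Pm PX X1 [GX Xw]]]]] := rapidly_increasing j.+2 p.
have Pmono : {homo P : i j / (i <= j)%N} by apply: homo_leq => //; exact: leq_trans.
have cm := blocks_cuts tm Pm; have bv := blocks_vec vy PX.
have bl := blocks_lives tm vy ly PX.
set J := j.+1 in ej *; set n := len J; set N := (len j)%:R : R.
set mJ := m R J; set S := (2 * N) ^+ mu J.
have mJ0 : 0 < mJ by exact: m_gt0.
have n0 : 0 < n%:R :> R by exact: len_gt0.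
have N1 : 1 <= N by exact: len_ge1.
have S1 : 1 <= S by rewrite exprn_ege1 //; lra.
have mJ2 : 2 <= mJ by exact: m_ge2.
have big : 4 * mJ ^+ 2 * N * S <= n%:R.
  have S2 : S <= (2 * N) ^+ (2 * mu J) by rewrite ler_weXn2l //; [lra|lia].
  apply: le_trans (len_large R j); apply: ler_wpM2l S2.
  by rewrite !mulr_ge0 ?sqr_ge0 //; lra.
have wsum a b i L : valid (Nd a b i L) -> forall u v, (u <= v)%N ->
    `|\sum_(u <= l < v) X l (Nd a b i L)| <= 1 + 2 / m R (minn i J.+1) * (v - u)%:R.
  move=> vN u v uv; have [l0 l0P] := Xw _ _ _ _ vN.
  apply: (@sum_one_exception _ (fun l => X l (Nd a b i L)) u v l0) => //.
  - by rewrite divr_ge0 // ltW ?m_gt0.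
  - exact: X1.
  - by move=> l _; exact: l0P.
have {}tree u v : (u <= v)%N -> forall g, valid g ->
    `|\sum_(u <= l < v) X l g| <= 2 * (S + (v - u)%:R / mJ).
  move=> uv g vg; have := @tree_bound _ X (t \o P) cm bv bl (len j) J (mu J) 2.
  apply=> //.
  - by rewrite expn_gt0.
  - by move=> i; rewrite ltnS; exact: len_mono.
  - by move=> l; apply: nleW (X1 l); rewrite ler1n.
  - move=> a b i L vN Ji u' v' uv'; apply: le_trans (wsum _ _ _ _ vN _ _ uv') _.
    rewrite mulrDr mulr1 lerD ?ler1n // -mulrA ler_wpM2l // mulrC ler_wpM2l //.
    rewrite lef_pV2 ?posrE ?m_gt0 //; by apply: m_mono; rewrite leq_min Ji leqnSn.
have nE : (n - 0)%N = n by rewrite subn0.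
have n_ne0 : n%:R != 0 :> R by rewrite lt0r_neq0.
have mJ_ne0 : mJ != 0 by rewrite lt0r_neq0.
(* On [n] functionals with values at least 1/2 the sum of weight [mJ] gives at least [n / (2 * mJ)];
   this factor rescales it to 1/2. *)
pose z0 g := mJ / n%:R * \sum_(0 <= l < n) X l g.
have c0 : 0 < mJ / n%:R by rewrite divr_gt0.
have bz0 : blk p (P n) z0 by rewrite -P0; apply: blkZ; exact: blk_sum.
have NS : 1 <= N * S by rewrite -[leLHS]mulr1 ler_pM.
have big' : 4 * (mJ * mJ * (N * S)) <= n%:R by apply: le_trans big; rewrite expr2; lra.
have big1 : 4 * mJ * (N * S) <= n%:R.
  apply: le_trans big'; rewrite -!mulrA ler_wpM2l // mulrA.
  by rewrite ler_peMl ?mulr_ge0 ?ltW //; lra.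
have big2 : mJ * mJ <= n%:R.
  apply: le_trans big'; have h : mJ * mJ * 1 <= mJ * mJ * (N * S).
    by rewrite ler_wpM2l // mulr_ge0 // ltW.
  by have : 0 <= mJ * mJ by [rewrite mulr_ge0 // ltW]; lra.
have z0le : nle valid z0 3.
  move=> g vg; rewrite normrM (gtr0_norm c0) mulrAC ler_pdivrMr //.
  apply: le_trans (ler_wpM2l (ltW mJ0) (tree _ _ (leq0n n) _ vg)) _.
  rewrite nE; have -> : mJ * (2 * (S + n%:R / mJ)) = 2 * mJ * S + 2 * n%:R by field.
  have : S <= N * S by rewrite ler_peMl //; lra.
  move=> /(ler_wpM2l (ltW mJ0)); nra.
have z0w a b i L : valid (Nd a b i L) -> i != J ->
    `|z0 (Nd a b i L)| <= 3 / m R (minn i J).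
  move=> vN; rewrite neq_ltn => /orP[iJ|Ji].
    rewrite (minn_idPl (ltnW iJ)) /z0 (vecNd _ _ _ _ (vec_sum_nat bv _ _)).
    have [vL pL sL] := validNd vN; have mi := m_gt0 R i.
    have := @children_sum _ X (t \o P) cm bv bl (map (trunc a b) L) 0 n
      (2 * S) (2 / mJ) 1.
    rewrite size_map big_map nE.
    move=> /(_ _ _ ler01 (leq0n _) (pairwise_trunc a b pL)) H.
    have {}H : \sum_(g0 <- L) `|\sum_(0 <= l < n) X l (trunc a b g0)| <=
        N * (2 * S + 1) + 2 / mJ * n%:R.
      apply: le_trans (H _ _ _ _) _; first by lra.
      + by rewrite divr_ge0 // ltW.
      + move=> h /mapP[g' g'L ->] u v _ uv _.
        rewrite mulrAC -mulrA -mulrDr; apply: tree => //; exact/valid_trunc/vL.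
      + by move=> h /mapP[g' g'L ->] l _; apply: X1; exact/valid_trunc/vL.
      rewrite lerD2r ler_wpM2r //; first lra.
      by rewrite ler_nat (leq_trans sL) // len_mono // -ltnS.
    rewrite normrM (gtr0_norm c0) normrM normfV (gtr0_norm mi) mulrCA mulrC.
    rewrite ler_wpM2r ?invr_ge0 ?(ltW mi) //.
    apply: le_trans (ler_wpM2l (ltW c0) (le_trans (ler_norm_sum _ _ _) H)) _.
    rewrite mulrAC ler_pdivrMr //.
    have -> : mJ * (N * (2 * S + 1) + 2 / mJ * n%:R) =
      2 * (mJ * (N * S)) + mJ * N + 2 * n%:R by field.
    have : N <= N * S by rewrite ler_peMr //; lra.
    move=> /(ler_wpM2l (ltW mJ0)); nra.
  rewrite (minn_idPr (ltnW Ji)) normrM (gtr0_norm c0).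
  have := wsum _ _ _ _ vN _ _ (leq0n n); rewrite nE (minn_idPr Ji) => H.
  apply: le_trans (ler_wpM2l (ltW c0) H) _.
  have mJS := m_gt0 R J.+1; have := m_sqr R J; rewrite -/mJ expr2 => sq.
  have -> : mJ / n%:R * (1 + 2 / m R J.+1 * n%:R) = mJ / n%:R + 2 * mJ / m R J.+1.
    by field; rewrite n_ne0 lt0r_neq0.
  have h1 : mJ / n%:R <= mJ^-1.
    by rewrite ler_pdivrMr // mulrC ler_pdivlMr.
  have h2 : mJ / m R J.+1 <= mJ^-1.
    by rewrite ler_pdivrMr // mulrC ler_pdivlMr.
  rewrite -mulrA; lra.
pose G' l := trunc (t (P l)) (t (P l.+1)) (G l).
pose L := [seq G' l | l <- iota 0 n].
have [wL pL sL] : witnesses L (t p) (t (P n)) n.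
  rewrite -P0; apply: (@witnesses_iota _ (t \o P)) => // l.
  by rewrite lo_trunc hi_trunc; have /andP[vG _] := GX l; split;
     [exact: valid_trunc|exact: leq_maxl|exact: geq_minl].
have vf : valid (Nd (t p) (t (P n)) J L).
  apply/and4P; split=> //; first by apply/allP => g /wL[].
    by rewrite sL.
  by rewrite (negbTE ej).
have zf : 2^-1 <= z0 (Nd (t p) (t (P n)) J L).
  rewrite (vecNd _ _ _ _ (blk_vec vy bz0)).
  under eq_bigr do rewrite (blk_lives tm vy ly bz0).
  have -> : L = [seq G' l | l <- index_iota 0 n] by rewrite /index_iota subn0.
  rewrite -mulr_sumr big_map mulrA.
  have -> : (m R J)^-1 * (mJ / n%:R) = n%:R^-1 by rewrite -/mJ; field; rewrite n_ne0.
  rewrite mulrC ler_pdivlMr //.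
  have -> : 2^-1 * n%:R = \sum_(0 <= l < n) 2^-1 :> R.
    by rewrite sumr_const_nat nE mulr_natr.
  apply: ler_sum_nat => l /andP[_ ln].
  rewrite (sum_within (c := t \o P) (l := l) cm bv bl) //=; last 2 first.
  - by rewrite lo_trunc leq_maxl.
  - by rewrite hi_trunc geq_minl.
  by rewrite ln bl; have /andP[] := GX l.
set f := Nd _ _ _ _ in vf zf.
have zf0 : 0 < z0 f by apply: lt_le_trans zf; rewrite invr_gt0.
have zf2 : (z0 f)^-1 <= 2 by rewrite invf_ple ?posrE.
(* Dividing by [z0 f] makes the value at [f] exactly 1 and at most doubles the bounds 3. *)
exists (P n), (fun g => (z0 f)^-1 * z0 g), L; split=> //.
- by rewrite -P0; exact: Pmono.
- exact: blkZ.
- by rewrite -/f mulVf // lt0r_neq0.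
- have sc a b : 0 <= b -> `|z0 a| <= 3 * b -> `|(z0 f)^-1 * z0 a| <= 6 * b.
    move=> b0 h; rewrite normrM gtr0_norm ?invr_gt0 //.
    have -> : 6 * b = 2 * (3 * b) by ring.
    by apply: ler_pM; rewrite ?invr_ge0 ?(ltW zf0).
  split=> [g vg|a b i L' vN iJ].
    by rewrite -[6]mulr1; apply: sc => //; rewrite mulr1; exact: z0le.
  by apply: sc; [rewrite invr_ge0 ltW // m_gt0|exact: z0w].
Qed.

End exact.

Lemma alternating_sum_le1 (R : realType) u v :
  `|\sum_(u <= q < v) (-1) ^+ q : R| <= 1.
Proof.
have [uv|vu] := leqP u v; last by rewrite big_geq ?normr0 // ltnW.
suff -> : \sum_(u <= q < v) (-1) ^+ q = ((-1) ^+ u - (-1) ^+ v) / 2 :> R.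
  rewrite normrM normfV normr_nat ler_pdivrMr // mul1r.
  by rewrite (le_trans (ler_normB _ _)) // !normrX !normrN1 !expr1n.
rewrite -(subnK uv); elim: (v - u)%N => [|k IH]; first by rewrite add0n big_geq // subrr mul0r.
by rewrite addSn big_nat_recr ?leq_addl //= IH exprS; field.
Qed.

(* An interval [a, b) of levels truncates at most two of the pairs. *)
Lemma alternating_window (R : realType) (c : nat -> R) (T : nat -> nat) a b u v :
  {homo T : i j / (i <= j)%N} -> (u <= v)%N ->
  (forall q, `|c q| <= 6) ->
  (forall q, (b <= T q)%N || (T q.+1 <= a)%N -> c q = 0) ->
  (forall q, (a <= T q)%N -> (T q.+1 <= b)%N -> c q = 1) ->
  `|\sum_(u <= q < v) (-1) ^+ q * c q| <= 13.
Proof.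
move=> Tm uv c6 c0 c1.
have ends u' v' l0 : (u' <= v')%N ->
    (forall l, (u' <= l < v')%N -> l != l0 -> c l = 0) ->
    `|\sum_(u' <= q < v') (-1) ^+ q * c q| <= 6.
  move=> uv' H; have := @sum_one_exception R (fun q => (-1) ^+ q * c q) u' v' l0 0 6.
  rewrite mul0r addr0; apply=> //.
    by rewrite normrM normrX normrN1 expr1n mul1r.
  by move=> l ll ne; rewrite H ?mulr0 ?normr0.
have first_ge (P : pred nat) w : (w <= v)%N -> exists w', [/\ (w <= w')%N, (w' <= v)%N,
    forall q, (w <= q < w')%N -> ~~ P q & (w' < v)%N -> P w'].
  move=> wv; have ex : exists q, (w <= q)%N && ((v <= q)%N || P q).
    by exists v; rewrite wv leqnn.
  case: (ex_minnP ex) => w' /andP[h1 h2] h3; exists w'; split=> //.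
  - by apply: h3; rewrite wv leqnn.
  - move=> q /andP[wq qw]; apply/negP => Pq; have := h3 q.
    by rewrite wq Pq orbT leqNgt qw => /(_ isT).
  - by move=> h; move: h2; rewrite leqNgt h.
have [al [ual alv lal Pal]] := first_ge (fun q => a <= T q)%N u uv.
have [be [albe bev lbe Pbe]] := first_ge (fun q => b < T q.+1)%N al alv.
rewrite (big_cat_nat (n := al)) //= (big_cat_nat (m := al) (n := be)) //=.
have H1 : `|\sum_(u <= q < al) (-1) ^+ q * c q| <= 6.
  apply: (ends _ _ al.-1) => // l /andP[ul lal'] ne; apply: c0.
  have := lal l.+1; rewrite -ltnNge; lia.
have H2 : `|\sum_(al <= q < be) (-1) ^+ q * c q| <= 1.
  rewrite (eq_big_nat _ _ (F2 := fun q => (-1) ^+ q)) ?alternating_sum_le1 //.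
  move=> q /andP[aq qb]; rewrite c1 ?mulr1 //.
    by rewrite (leq_trans (Pal _)) ?Tm //; lia.
  by rewrite leqNgt lbe // aq.
have H3 : `|\sum_(be <= q < v) (-1) ^+ q * c q| <= 6.
  apply: (ends _ _ be) => // l /andP[bl lv] ne; apply: c0.
  have := Pbe; have := Tm be.+1 l; lia.
apply: le_trans (ler_normD _ _) _.
have := ler_normD (\sum_(al <= q < be) (-1) ^+ q * c q)
  (\sum_(be <= q < v) (-1) ^+ q * c q).
lra.
Qed.

Lemma sum_window (V : nmodType) (F : nat -> V) r u v :
  \sum_(0 <= q < r | (u <= q < v)%N) F q = \sum_(u <= q < maxn u (minn r v)) F q.
Proof.
rewrite (big_nat_widen _ _ (r + u + v)); last by lia.
rewrite [RHS](big_nat_widenl _ 0) // [RHS](big_nat_widen _ _ (r + u + v)); last by lia.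
by apply: eq_bigl => q /=; lia.
Qed.

Lemma coding_inj j : injective (coding j).
Proof.
move=> k l /eqP; rewrite /coding eqn_mul2l /= eqSS eqn_add2l => /eqP.
exact: (pcan_inj pickleK).
Qed.

Lemma coding_gt j l : (j < coding j l)%N.
Proof. by rewrite /coding; lia. Qed.

Lemma coding_even j l : ~~ odd (coding j l).
Proof. by rewrite /coding mul2n odd_double. Qed.

Lemma specialP j L q : special j L -> (q < size L)%N ->
  exists a b l, nth (At 0) L q = Nd a b (coding j (take q L)) l.
Proof.
move=> /allP/(_ q); rewrite mem_iota /= => H qL; move: (H qL).
by case: nth => //= a b i l /eqP ->; exists a, b, l.
Qed.

(** * Dependent sequences and the failure of unconditionality *)

Section gowers_maurey.
Context {R : realType}.
Variables (y : nat -> term -> R) (t : nat -> nat).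
Hypotheses (tm : forall k, (t k <= t k.+1)%N) (vy : forall k, vec (y k)).
Hypotheses (ly : forall k, lives (t k) (t k.+1) (y k)).
Hypothesis ny : forall k, nonzero valid (y k).
Notation blk := (blk y).

(** The weight of each functional encodes all earlier ones, which makes every initial segment of
    [fs] special at [J]. *)
Lemma dependent_sequence J : exists (P : nat -> nat) (z : nat -> term -> R)
    (fs : nat -> term),
  let F l := [seq fs i | i <- iota 0 l] in
  [/\ forall l, (P l <= P l.+1)%N, forall l, blk (P l) (P l.+1) (z l),
    forall l, exists L, fs l = Nd (t (P l)) (t (P l.+1)) (coding J (F l)) L,
    forall l, valid (fs l) /\ z l (fs l) = 1 &
    forall l, nle valid (z l) 6 /\
      forall a b i L, valid (Nd a b i L) -> i != coding J (F l) ->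
      `|z l (Nd a b i L)| <= 6 / m R (minn i (coding J (F l)))].
Proof.
pose Q (_ : nat) (a b : nat * (term -> R) * seq term) := exists L,
  let f := Nd (t a.1.1) (t b.1.1) (coding J a.2) L in
  [/\ (a.1.1 <= b.1.1)%N, blk a.1.1 b.1.1 b.1.2, b.2 = rcons a.2 f,
     valid f /\ b.1.2 f = 1 &
    nle valid b.1.2 6 /\
      forall a' b' i L, valid (Nd a' b' i L) -> i != coding J a.2 ->
      `|b.1.2 (Nd a' b' i L)| <= 6 / m R (minn i (coding J a.2))].
have [f [f0 fS]] : exists f : nat -> (nat * (term -> R) * seq term)%type,
    f 0%N = (0%N, (fun=> 0), [::]) /\ forall k, Q k (f k) (f k.+1).
  apply: dependent_choice_nat => k [[p x] F].
  have [|q [z [L [pq bz vf zf zw]]]] := exact_pair tm vy ly ny p _ (coding_even J F).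
    by rewrite /coding; lia.
  by exists (q, z, rcons F (Nd (t p) (t q) (coding J F) L)), L.
have [L LP] := choice fS.
pose fs l := Nd (t (f l).1.1) (t (f l.+1).1.1) (coding J (f l).2) (L l).
have FE l : [seq fs i | i <- iota 0 l] = (f l).2.
  elim: l => [|l IH]; first by rewrite f0.
  rewrite -addn1 iotaD map_cat IH addn1 /=.
  by have [_ _ -> _ _] := LP l; rewrite cats1.
exists (fun l => (f l).1.1), (fun l => (f l.+1).1.2), fs => F.
have EF l : F l = (f l).2 by exact: FE.
split=> l; rewrite ?EF; have [] := LP l => //.
by move=> *; exists (L l).
Qed.

(** The sum of the first [len J] vectors [z l] has norm at least [len J / m J], as seen by one
    special functional. With alternating signs the norm is at most [40 * len J / m J ^ 2]: a special
    functional follows the dependent sequence up to a first deviation, where the signs cancel, and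
    sees almost nothing afterwards. The sum is a difference of two masked alternating sums, so the
    constant [K] would force [m J <= 80 * |K|]. *)
Theorem block_not_unconditional K : ~ uncond valid K y.
Proof.
move=> uy.
have [i0 Ki0] := m_unbounded (80 * `|K| + 1).
set J' := (2 * i0)%N; pose J := J'.+1.
have Jodd : odd J by rewrite /J /J' mul2n /= odd_double.
have [P [z [fs]]] := dependent_sequence J; set F := (fun l => _ : seq term).
move=> [Pm Pz fsE fsP zw].
have sF l : size (F l) = l by rewrite size_map size_iota.
have nthF l q : (q < l)%N -> nth (At 0) (F l) q = fs q.
  by move=> ql; rewrite (nth_map 0%N) ?size_iota // nth_iota.
have takeF l q : (q <= l)%N -> take q (F l) = F q.
  by move=> ql; rewrite /F -map_take take_iota (minn_idPl ql).
have codF l l' : coding J (F l) = coding J (F l') -> l = l'.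
  by move=> /coding_inj /(congr1 size); rewrite !sF.
have Pmono : {homo P : i j / (i <= j)%N} by apply: homo_leq => //; exact: leq_trans.
have tmono := cuts_mono tm.
have cm := blocks_cuts tm Pm; have bv := blocks_vec vy Pz.
have bl := blocks_lives tm vy ly Pz.
have mJ0 := m_gt0 R J; have mJS0 := m_gt0 R J.+1.
have zsmall l a b i L : valid (Nd a b i L) -> i != coding J (F l) -> (J < i)%N ->
    `|z l (Nd a b i L)| <= 6 / m R J.+1.
  move=> vN ne Ji; apply: le_trans ((zw l).2 _ _ _ _ vN ne) _.
  rewrite ler_wpM2l // lef_pV2 ?posrE ?m_gt0 // m_mono //.
  by rewrite leq_min Ji coding_gt.
set n := len J; have n0 : 0 < n%:R :> R by exact: len_gt0.
have nE : (n - 0)%N = n by rewrite subn0.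
pose x l g := (-1) ^+ l * z l g.
have xv l : vec (x l) by exact: spannedZ.
have xl l : lives (t (P l)) (t (P l.+1)) (x l) by move=> g; rewrite /x bl.
have sgn l g : `|x l g| = `|z l g| by rewrite normrM normrX normrN1 expr1n mul1r.
have x6 l : nle valid (x l) 6 by move=> g vg; rewrite sgn; exact: (zw l).1.
have mJ2 : m R J ^+ 2 <= m R J.+1 := m_sqr R J.
(* For [i = J] the 20 covers 13 from the alternating part and 6 from the member of the list at the
   deviation. *)
have treeH a b i L : valid (Nd a b i L) -> (J <= i)%N -> forall u v, (u <= v)%N ->
    `|\sum_(u <= l < v) x l (Nd a b i L)| <=
      20 * (1 + (v - u)%:R / 2 ^+ (2 * mu J)).
  rewrite mulnC exprM -/(m R J) => vN.
  rewrite leq_eqVlt => /predU1P[|] Ji u v uv; last first.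
    have [l0 l0P] : exists l0, forall l, l != l0 -> i != coding J (F l).
      have [[l0 El0]|none] := pselect (exists l0, i = coding J (F l0)).
        by exists l0 => l; apply: contra => /eqP; rewrite El0 => /codF ->.
      by exists 0%N => l _; apply/eqP => il; apply: none; exists l.
    apply: (@le_trans _ _ (6 + 6 / m R J.+1 * (v - u)%:R)).
      apply: (@sum_one_exception _ (fun l => x l (Nd a b i L)) u v l0) => //.
      - by rewrite divr_ge0 // ltW.
      - exact: x6.
      - by move=> l _ ne; rewrite sgn; apply: zsmall => //; exact: l0P.
    have h : (v - u)%:R * (m R J.+1)^-1 <= (v - u)%:R * (m R J ^+ 2)^-1.
      by rewrite ler_wpM2l // lef_pV2 ?posrE ?exprn_gt0.
    have : 0 <= (v - u)%:R * (m R J.+1)^-1 by rewrite mulr_ge0 // invr_ge0 ltW.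
    by lra.
  rewrite -Ji in vN *; rewrite (vecNd _ _ _ _ (vec_sum_nat xv u v)).
  have [vL pL sL] := validNd vN.
  have spL : special J L by move: vN => /and4P[_ _ _]; rewrite Jodd.
  pose g q := trunc a b (nth (At 0) L q).
  pose S q := \sum_(u <= l < v) x l (g q).
  rewrite (big_nth (At 0)) -/(index_iota 0 (size L)).
  (* [r] is the length of the longest common initial segment of [L] and the dependent sequence. *)
  have [r [rL takeL rne]] : exists r, [/\ (r <= size L)%N, take r L = F r &
      (r < size L)%N -> nth (At 0) L r != fs r].
    have ex : exists q, (size L <= q)%N || (nth (At 0) L q != fs q).
      by exists (size L); rewrite leqnn.
    case: (ex_minnP ex) => r h1 h2.
    have rs : (r <= size L)%N by apply: h2; rewrite leqnn.
    exists r; split=> //; last by move=> h; move: h1; rewrite leqNgt h.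
    apply: (@eq_from_nth _ (At 0)); first by rewrite size_takel // sF.
    move=> q; rewrite size_takel // => qr; rewrite nth_take // nthF //.
    by have := h2 q; case: eqP => // _; rewrite orbT leqNgt qr => /(_ isT).
  (* These members take the value 1 at their own vectors unless truncated, so the signs cancel. *)
  have S1 : `|\sum_(0 <= q < r) S q| <= 13.
    pose c q := z q (trunc a b (fs q)).
    have Sc q : (q < r)%N -> S q = if (u <= q < v)%N then (-1) ^+ q * c q else 0.
      move=> qr; have -> : S q = \sum_(u <= l < v) x l (trunc a b (fs q)).
        by rewrite /S /g -(nth_take (n0 := r)) // takeL nthF.
      have [L' EL'] := fsE q.
      apply: (sum_within (c := t \o P) (l := q) cm xv xl).
        by rewrite lo_trunc EL' leq_maxr.
      by rewrite hi_trunc EL' geq_minr.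
    have -> : \sum_(0 <= q < r) S q = \sum_(u <= q < maxn u (minn r v)) (-1) ^+ q * c q.
      rewrite (eq_big_nat _ _ (fun q (h : (0 <= q < r)%N) => Sc q h)).
      by rewrite -big_mkcond sum_window.
    apply: (@alternating_window _ c (t \o P) a b).
    - by move=> k l kl; exact/tmono/Pmono.
    - exact: leq_maxl.
    - by move=> q; apply: (zw q).1; apply: valid_trunc; exact: (fsP q).1.
    - move=> q h; have [L' EL'] := fsE q; rewrite /c.
      rewrite -vec_trunc_self; last exact: bv.
      apply: vec_trunc_empty; first exact: bv.
      rewrite lo_trunc hi_trunc EL' leq_max !geq_min.
      by case/orP: h => /= ->; rewrite ?orbT.
    - move=> q h1 h2; have [L' EL'] := fsE q; rewrite /c -[RHS](fsP q).2; congr (z q _).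
      by rewrite EL' /= (maxn_idPr h1) (minn_idPr h2).
  have S2 q : (r <= q < size L)%N ->
      `|S q| <= (if q == r then 6 else 0) + 6 / m R J.+1 * (v - u)%:R.
    move=> /andP[rq qL]; have [a' [b' [L' EL']]] := specialP spL qL.
    have vg : valid (g q) by apply/valid_trunc/vL/mem_nth.
    (* By injectivity of the coding, a member from [r] on shares its weight with some [fs l] only if
       both stand at position [r]; a later coincidence would make the lists agree beyond [r]. *)
    have wk l : (coding J (take q L) == coding J (F l)) -> q = r /\ l = r.
      move=> /eqP /coding_inj E.
      have ql : q = l by move: (congr1 size E); rewrite sF size_takel // ltnW.
      subst l; case: (eqVneq r q) => [-> //|ne].
      have {ne}rq' : (r < q)%N by rewrite ltn_neqAle ne.
      have := rne (ltn_trans rq' qL).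
      by rewrite -(nth_take (n0 := q)) // E nthF // eqxx.
    rewrite /S /g EL' /= in vg *.
    case: eqVneq => [_|qr].
      apply: (@sum_one_exception _ (fun l => x l _) u v r) => //.
      - by rewrite divr_ge0 // ltW.
      - exact: x6.
      - move=> l _ lr; rewrite sgn; apply: zsmall => //; last exact: coding_gt.
        by apply/negP => /wk[_ /eqP]; rewrite (negbTE lr).
    rewrite add0r; apply: le_trans (ler_norm_sum _ _ _) _.
    rewrite [_ * (v - u)%:R]mulr_natr -sumr_const_nat; apply: ler_sum => l _.
    rewrite sgn; apply: zsmall => //; last exact: coding_gt.
    by apply/negP => /wk[/eqP]; rewrite (negbTE qr).
  have {}S2 : `|\sum_(r <= q < size L) S q| <= 6 + 6 * (v - u)%:R / m R J ^+ 2.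
    apply: le_trans (ler_norm_sum _ _ _) _.
    apply: le_trans (ler_sum_nat S2) _.
    rewrite big_split /= -big_mkcond big_nat1_eq sumr_const_nat lerD //; first by case: ifP.
    rewrite -[_ *+ (size L - r)]mulr_natr.
    have -> : 6 / m R J.+1 * (v - u)%:R * (size L - r)%:R =
      6 * (v - u)%:R * ((size L - r)%:R / m R J.+1) by ring.
    apply: ler_wpM2l; first by rewrite mulr_ge0.
    rewrite ler_pdivrMr // mulrC ler_pdivlMr ?exprn_gt0 //.
    apply: le_trans (m_large R J); rewrite ler_wpM2r ?exprn_ge0 ?(ltW mJ0) // ler_nat.
    by rewrite (leq_trans (leq_subr _ _)).
  have SE : \sum_(0 <= q < size L) S q = \sum_(0 <= q < r) S q + \sum_(r <= q < size L) S q.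
    by rewrite (big_cat_nat (n := r)).
  rewrite SE normrM normfV (gtr0_norm mJ0) ler_pdivrMl //.
  apply: le_trans (ler_normD _ _) _.
  have w0 : 0 <= (v - u)%:R / m R J ^+ 2 by rewrite divr_ge0 // exprn_ge0 // ltW.
  have := m_ge2 R J.
  have : 0 <= (m R J - 1) * ((v - u)%:R / m R J ^+ 2).
    by rewrite mulr_ge0 //; have := m_ge2 R J; lra.
  lra.
set N := (len J')%:R : R.
have tree g : valid g -> `|\sum_(0 <= l < n) x l g| <= 40 * n%:R / m R J ^+ 2.
  (* [2 * mu J] halvings give the slope [1 / m J ^ 2], and [len_large] makes the constant term no
     larger than the linear one. *)
  move=> vg; have := @tree_bound _ x (t \o P) cm xv xl (len J') J (2 * mu J) 20.
  move=> /(_ _ _ _ _ treeH _ (leqnn _) g vg 0%N n (leq0n _)) H.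
  apply: le_trans (H _ _ _ _) _ => //.
  - by rewrite expn_gt0.
  - by move=> i; rewrite ltnS; exact: len_mono.
  - by move=> l; apply: nleW (x6 l); rewrite ler_nat.
  have -> : 40 * n%:R / m R J ^+ 2 = 20 * (n%:R / m R J ^+ 2 + n%:R / m R J ^+ 2).
    by field; rewrite lt0r_neq0.
  have E : 2 ^+ (2 * mu J) = m R J ^+ 2 by rewrite mulnC exprM.
  rewrite nE E ler_wpM2l // lerD2r ler_pdivlMr ?exprn_gt0 //.
  apply: le_trans (len_large R J'); rewrite -/J -/N mulrC.
  have N1 : 1 <= N by exact: len_ge1.
  rewrite ler_wpM2r ?exprn_ge0 ?mulr_ge0 //.
  have : 0 <= m R J ^+ 2 * (N - 1) by rewrite mulr_ge0 ?exprn_ge0 ?(ltW mJ0) // subr_ge0.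
  have : 0 <= m R J ^+ 2 by rewrite exprn_ge0 // ltW.
  lra.
pose f := Nd (t (P 0%N)) (t (P n)) J (F n).
have [wF pF _] : witnesses (F n) (t (P 0%N)) (t (P n)) n.
  apply: (@witnesses_iota fs (t \o P)) => // l.
  by have [L EL] := fsE l; have [vl _] := fsP l; rewrite EL in vl *.
have vf : valid f.
  apply/and4P; split=> //; first by apply/allP => g /wF[].
    by rewrite sF.
  apply/implyP => _; apply/allP => q; rewrite mem_iota sF add0n => qn.
  by rewrite nthF // takeF ?(ltnW qn) //; have [L ->] := fsE q; rewrite /= eqxx.
have zf : \sum_(0 <= l < n) z l f = n%:R / m R J.
  have bz := blk_sum Pm Pz (leq0n n).
  rewrite (vecNd _ _ _ _ (blk_vec vy bz)).
  under eq_bigr do rewrite (blk_lives tm vy ly bz).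
  rewrite mulrC; congr (_ / _).
  have -> : F n = [seq fs i | i <- index_iota 0 n] by rewrite /index_iota subn0.
  rewrite big_map (eq_big_nat _ _ (F2 := fun=> 1)).
    by rewrite sumr_const_nat nE.
  move=> q /andP[_ qn]; have [L EL] := fsE q.
  rewrite (sum_within (c := t \o P) (l := q) cm bv bl) ?EL //=.
  by rewrite -EL qn; exact: (fsP q).2.
have [al alE] := choice Pz.
have uz : uncond valid K z.
  rewrite (_ : z = fun i g => \sum_(P i <= k < P i.+1) al i k * y k g).
    exact: uncond_block.
  by apply/funext => i; apply/funext => g; rewrite alE.
have half (b : pred nat) :
    `|\sum_(0 <= l < n | b l) x l f| <= `|K| * (40 * n%:R / m R J ^+ 2).
  apply: le_trans (uz b n (fun l => (-1) ^+ l) _ tree _ vf) _.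
  by rewrite ler_wpM2r ?ler_norm // divr_ge0 ?mulr_ge0 // exprn_ge0 // ltW.
have split_z : n%:R / m R J = \sum_(0 <= l < n | ~~ odd l) x l f -
    \sum_(0 <= l < n | odd l) x l f.
  rewrite -zf (bigID odd) /= addrC -sumrN; congr (_ + _); apply: eq_bigr => l lo.
    by rewrite /x -signr_odd (negbTE lo) mul1r.
  by rewrite /x -signr_odd lo mulN1r opprK.
have := half odd; have := half (predC odd); rewrite /=.
set A := `|K| * _ => h1 h2.
have : n%:R / m R J <= A + A.
  rewrite split_z; apply: le_trans (ler_norm _) _.
  by rewrite (le_trans (ler_normB _ _)) // lerD.
have -> : A + A = n%:R / m R J * (80 * `|K| / m R J) by rewrite /A; field; rewrite lt0r_neq0.
rewrite -[leLHS]mulr1 ler_pM2l ?divr_gt0 // ler_pdivlMr // mul1r leNgt.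
suff -> : 80 * `|K| < m R J by [].
have : m R i0 <= m R J by apply: m_mono; rewrite leqW // leq_pmull.
lra.
Qed.

End gowers_maurey.

(** * Trees *)

Section trees.
Context {R : realType}.
Implicit Types (S T : set (seq nat)) (x : term -> R).

Lemma nle_ge0 x c : nle valid x c -> 0 <= c.
Proof. by move=> /(_ (At 0) isT); exact: le_trans. Qed.

Lemma uncond_abs K (v : nat -> term -> R) : uncond valid K v -> uncond valid `|K| v.
Proof.
move=> uv b n a c H; apply: nleW (uv b n a c H).
by rewrite ler_wpM2r ?ler_norm // (nle_ge0 H).
Qed.

Definition linear_op (P : (term -> R) -> term -> R) :=
  forall p q a (v : nat -> term -> R) u,
    P (fun t => \sum_(p <= k < q) a k * v k t) u = \sum_(p <= k < q) a k * P (v k) u.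

Definition contraction (P : (term -> R) -> term -> R) :=
  forall x c, nle valid x c -> nle valid (P x) c.

Lemma linear_opZ P c x u : linear_op P -> P (fun t => c * x t) u = c * P x u.
Proof.
move=> lP; have := lP 0%N 1%N (fun=> c) (fun=> x) u; rewrite big_nat1 => <-.
by congr (P _ u); apply/funext => t; rewrite big_nat1.
Qed.

(** * Gliding humps *)

Section gliding.
Variables (v : nat -> term -> R) (K : R).
Hypotheses (uv : uncond valid K v) (vv : forall k, vec (v k)).

(** [be u] is meant to bound the support of [u], and [N] is raised past it after each choice.
    [P (N i)] is so small on the chosen blocks that removing it is a perturbation covered by
    [uncond_perturb]. *)
Lemma gliding_hump (P : nat -> (term -> R) -> term -> R) (be : (term -> R) -> nat) :
  (forall N M e, 0 < e -> exists q u, [/\ (M <= q)%N, blk v M q u,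
     exists2 t, valid t & 1 <= `|u t| & nle valid (P N u) e]) ->
  exists (N : nat -> nat) (u : nat -> term -> R),
    [/\ forall i, N i.+1 = maxn (N i) (be (u i)),
      forall i, exists p q, blk v p q (u i),
      exists K', uncond valid K' (fun i t => u i t - P (N i) (u i) t) &
      forall i, nonzero valid (fun t => u i t - P (N i) (u i) t)].
Proof.
move=> H; pose d : R := (4 * (`|K| + 1))^-1.
have K1 : 0 < `|K| + 1 by rewrite ltr_pwDr.
have d0 : 0 < d by rewrite invr_gt0 mulr_gt0.
pose Q (i : nat) (a b : nat * (term -> R) * nat) :=
  [/\ (a.1.1 <= b.1.1)%N, blk v a.1.1 b.1.1 b.1.2,
    exists2 t, valid t & 1 <= `|b.1.2 t|,
    nle valid (P a.2 b.1.2) (d * 2 ^- i) & b.2 = maxn a.2 (be b.1.2)].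
have [f [f0 fS]] : exists f : nat -> (nat * (term -> R) * nat)%type,
    f 0%N = (0%N, (fun=> 0), 0%N) /\ forall k, Q k (f k) (f k.+1).
  apply: dependent_choice_nat => i [[p x] N].
  have [|q [u [pq bu u1 Pu]]] := H N p (d * 2 ^- i).
    by rewrite mulr_gt0 // invr_gt0 exprn_gt0.
  by exists (q, u, maxn N (be u)).
exists (fun i => (f i).2), (fun i => (f i.+1).1.2).
have b i : blk v (f i).1.1 (f i.+1).1.1 (f i.+1).1.2 by have [] := fS i.
have u1 i : exists2 t, valid t & 1 <= `|(f i.+1).1.2 t| by have [] := fS i.
have Pu i : nle valid (P (f i).2 (f i.+1).1.2) (d * 2 ^- i) by have [] := fS i.
have [al alE] := choice b.
split.
- by move=> i; have [] := fS i.
- by move=> i; exists (f i).1.1, (f i.+1).1.1.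
- exists (2 * `|K| + 1).
  apply: (@uncond_perturb _ _ _ _ (fun i => (f i.+1).1.2) _ d) => //.
  + rewrite (_ : (fun i => (f i.+1).1.2) =
      fun i g => \sum_((f i).1.1 <= k < (f i.+1).1.1) al i k * v k g).
      apply: (uncond_block (uncond_abs uv) (p := fun i => (f i).1.1)).
      by move=> i; have [] := fS i.
    by apply/funext => i; apply/funext => g; rewrite alE.
  + exact: ltW.
  + have : d * (4 * (`|K| + 1)) = 1 by rewrite mulVf // gt_eqF // mulr_gt0.
    by lra.
  + by move=> i t vt; rewrite opprB addrC subrK; exact: Pu.
- move=> i; have [t vt t1] := u1 i; exists t => //.
  apply/eqP => E; have := Pu i t vt.
  move/eqP: E; rewrite subr_eq0 => /eqP <-; apply/negP; rewrite -ltNge.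
  apply: lt_le_trans t1; apply: (@le_lt_trans _ _ d).
    by rewrite ler_piMr ?(ltW d0) // invf_le1 ?exprn_gt0 // exprn_ege1 // ler1n.
  rewrite /d invf_lt1 ?mulr_gt0 //; have := normr_ge0 K; lra.
Qed.

(** The alternative to the gliding hump: no normalized block beyond [M] is nearly killed by [P].
    Then [P] is an isomorphism on the span of this tail and carries unconditionality over, with
    constant [K / e]. *)
Lemma bounded_below (P : (term -> R) -> term -> R) M e :
  linear_op P -> contraction P -> 0 < e -> (forall k, nonzero valid (v k)) ->
  (forall q u, (M <= q)%N -> blk v M q u -> (exists2 t, valid t & 1 <= `|u t|) ->
    ~ nle valid (P u) e) ->
  (exists K', uncond valid K' (fun k => P (v (M + k)%N))) /\
  forall k, nonzero valid (P (v (M + k)%N)).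
Proof.
move=> lP cP e0 nv H.
have low q u c : (M <= q)%N -> blk v M q u -> nle valid (P u) c -> nle valid u (c / e).
  move=> Mq bu Puc t vt; rewrite leNgt; apply/negP => ut.
  have c0 := nle_ge0 Puc.
  have ut0 : 0 < `|u t| by apply: le_lt_trans ut; rewrite divr_ge0 // ltW.
  apply: (H q _ Mq (blkZ `|u t|^-1 bu)).
    by exists t => //; rewrite normrM normfV normr_id mulVf // gt_eqF.
  move=> g vg; rewrite linear_opZ // normrM normfV normr_id ler_pdivrMl //.
  apply: le_trans (Puc g vg) _; rewrite -ler_pdivrMr //; exact: ltW.
split.
  exists (K / e) => b n a c Hc.
  have uM : uncond valid K (fun k => v (M + k)%N).
    rewrite (_ : (fun k => v (M + k)%N) =
        fun i g => \sum_(M + i <= k < M + i.+1) 1 * v k g).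
      by apply: uncond_block => // i; rewrite leq_add2l.
    by apply/funext => i; apply/funext => g; rewrite addnS big_nat1 mul1r.
  have bu : blk v M (M + n) (fun t => \sum_(0 <= i < n) a i * v (M + i)%N t).
    exists (fun k => a (k - M)%N) => g.
    rewrite [RHS](big_addn 0 (M + n) M) addKn; apply: eq_bigr => i _.
    by rewrite addnK addnC.
  have uc := low _ _ c (leq_addr _ _) bu
    (nle_ext (fun g _ => esym (lP 0%N n a (fun i => v (M + i)%N) g)) Hc).
  have c0 := nle_ge0 Hc.
  pose a' i := if b i then a i else 0.
  have E (w : nat -> term -> R) g :
      \sum_(0 <= i < n) a' i * w i g = \sum_(0 <= i < n | b i) a i * w i g.
    by rewrite [RHS]big_mkcond; apply: eq_bigr => i _; rewrite /a'; case: ifP; rewrite ?mul0r.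
  have H1 := nle_ext (fun g _ => esym (E (fun i => v (M + i)%N) g)) (uM b n a _ uc).
  have := cP _ _ H1; rewrite -mulrA [e^-1 * c]mulrC; apply: nle_ext => g _.
  by rewrite lP; exact: (E (fun i => P (v (M + i)%N)) g).
move=> k; apply: contrapT => z; have [t vt vt0] := nv (M + k)%N.
apply: (H (M + k).+1 (fun g => `|v (M + k)%N t|^-1 * v (M + k)%N g)).
- by rewrite -addnS leq_addr.
- exists (fun i => if i == (M + k)%N then `|v (M + k)%N t|^-1 else 0) => g.
  rewrite big_nat_recr ?leq_addr //= eqxx big_nat big1 ?add0r // => i /andP[_ ik].
  by rewrite ltn_eqF ?mul0r.
- by exists t => //; rewrite normrM normfV normr_id mulVf // normr_eq0.
- move=> g vg; rewrite linear_opZ //; case: (eqVneq (P (v (M + k)%N) g) 0) => [->|h].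
    by rewrite mulr0 normr0 ltW.
  by case: z; exists g.
Qed.

End gliding.

Definition no_uncond S := forall (v : nat -> term -> R) K,
  (forall k, spanned S (v k)) -> (forall k, nonzero valid (v k)) -> ~ uncond valid K v.

Lemma blk_spanned S (v : nat -> term -> R) p q u :
  (forall k, spanned S (v k)) -> blk v p q u -> spanned S u.
Proof.
move=> Sv [a ua]; apply: spanned_ext (fun g => esym (ua g)) _.
by apply: spanned_sum => k _; exact: spannedZ.
Qed.

(** Either [P] nearly kills normalized blocks arbitrarily far out, and the remainders [u - P u] are
    unconditional in [B]; or [P] is bounded below on a tail, and the images are unconditional in
    [A]. *)
Lemma no_uncond_split (P : (term -> R) -> term -> R) S A B :
  linear_op P -> contraction P ->
  (forall x, spanned S x -> spanned A (P x)) ->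
  (forall x, spanned S x -> spanned B (fun t => x t - P x t)) ->
  no_uncond A -> no_uncond B -> no_uncond S.
Proof.
move=> lP cP SA SB nA nB v K vS nv uv.
have vv k : vec (v k) by exact: spanned_le (vS k).
have [H|/existsNP[M /existsNP[e /not_implyP[e0 H]]]] := pselect (forall M e, 0 < e ->
    exists q u, [/\ (M <= q)%N, blk v M q u, exists2 t, valid t & 1 <= `|u t| &
      nle valid (P u) e]).
  have [N [u [_ bu [K' uw] nw]]] := gliding_hump uv (P := fun=> P) (fun=> 0%N) (fun=> H).
  apply: (nB _ _ _ nw uw) => k; apply: SB.
  by have [p [q b]] := bu k; exact: blk_spanned vS b.
have [[K' uw] nw] := bounded_below uv lP cP e0 nv
  (fun q u Mq bu u1 Pu => H (ex_intro _ q (ex_intro _ u (And4 Mq bu u1 Pu)))).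
by apply: (nA _ _ _ nw uw) => k; exact/SA.
Qed.

(** * Reduction of a tree to its subtrees at the children of the root *)

Definition initial N x : term -> R := fun t => x (trunc 0 N t).

Lemma initial_linear N : linear_op (initial N).
Proof. by []. Qed.

Lemma initial_contraction N : contraction (initial N).
Proof. by move=> x c xc t vt; apply: xc; exact: valid_trunc. Qed.

Definition shifted n T := [set s | exists s', s' != [::] /\ s = n :: s' /\ T s].
Definition sub T n : set (seq nat) := [set s | T (n :: s)].

Lemma spanned_initial S N x : spanned S x ->
  spanned [set s | S s /\ (head 0 s < N)%N] (initial N x).
Proof.
elim/spanned_ind => [y z yz|/=|c s y Ss IH].
- by move=> h; apply: spanned_ext h => t; rewrite /initial yz.
- exact: spanned0.
- have [sN|sN] := boolP (head 0 s < N)%N.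
    apply: spanned_ext (spannedD (spannedZ c (spanned_ev _ _)) IH) => [t|].
      by rewrite /initial ev_trunc /= sN mul1r.
    by split.
  apply: spanned_ext IH => t; rewrite /initial ev_trunc /= (negbTE sN).
  by rewrite mul0r mulr0 add0r.
Qed.

Lemma spanned_final S N x : spanned S x ->
  spanned [set s | S s /\ (N <= head 0 s)%N] (fun t => x t - initial N x t).
Proof.
elim/spanned_ind => [y z yz|/=|c s y Ss IH].
- by move=> h; apply: spanned_ext h => t; rewrite /initial !yz.
- by apply: spanned_ext (spanned0 _) => t; rewrite subrr.
- have [sN|sN] := leqP N (head 0%N s).
    apply: spanned_ext (spannedD (spannedZ c (spanned_ev _ _)) IH) => [t|].
      by rewrite /initial ev_trunc /= ltnNge sN mul0r mulr0 add0r addrA.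
    by split.
  apply: spanned_ext IH => t; rewrite /initial ev_trunc /= sN mul1r.
  by rewrite opprD addrACA subrr add0r.
Qed.

Lemma vec_trunc_cat x a b t : vec x -> (a <= b)%N ->
  x (trunc 0 a t) + x (trunc a b t) = x (trunc 0 b t).
Proof.
move=> vx ab; elim/spanned_ind: vx => [y z yz|/=|c s y _ IH]; first by rewrite !yz.
  by rewrite addr0.
rewrite addrACA IH !ev_trunc -mulrDr -mulrDl -natrD /=; congr (_ * (_%:R * _) + _).
by case: (ltnP (head 0%N s) a) => h; rewrite ?(leq_trans h ab) ?add0n //;
   rewrite leqNgt h.
Qed.

Lemma single_level_sum (l : seq term) (f : term -> R) n c : 0 <= c ->
  pairwise successive l -> (forall g, g \in l -> `|f g| <= c) ->
  (forall g, g \in l -> f g != 0 -> (lo g <= n < hi g)%N) ->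
  `|\sum_(g <- l) f g| <= c.
Proof.
move=> c0; elim: l => [|g l IH]; first by rewrite big_nil normr0.
rewrite pairwise_cons big_cons => /andP[/allP gl pl] fc fn.
have [g0|g0] := eqVneq (f g) 0.
  rewrite g0 add0r; apply: IH => // h hl; first by apply: fc; rewrite inE hl orbT.
  by apply: fn; rewrite inE hl orbT.
rewrite big_seq big1 ?addr0 ?fc ?mem_head // => h hl.
apply/eqP; apply: contraT => h0.
have := fn _ (mem_head g l) g0; have := fn h; rewrite inE hl orbT => /(_ isT h0).
have := gl _ hl; rewrite /successive; lia.
Qed.

(** Of successive functionals at most one sees the child [n], and neither truncation nor the weight
    enlarges its value. *)
Lemma single_level_Nd n x a b j l c :
  spanned [set s | s != [::] /\ head 0 s = n] x -> valid (Nd a b j l) -> 0 <= c ->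
  (forall g, g \in l -> `|x g| <= c) -> `|x (Nd a b j l)| <= c.
Proof.
move=> Sx vN c0 xc; have vx : vec x by exact: spanned_le Sx.
have [vl pl _] := validNd vN.
have xtr g : x (trunc a b g) = (a <= n < b)%N%:R * x g.
  elim/spanned_ind: Sx {vx xc} => [y z yz|/=|d s y [_ <-] IH].
  - by rewrite !yz.
  - by rewrite mulr0.
  - by rewrite IH ev_trunc mulrDr mulrCA.
rewrite vecNd //; under eq_bigr do rewrite xtr.
rewrite -mulr_sumr !normrM normfV (gtr0_norm (m_gt0 R j)).
rewrite -[leRHS]mul1r ler_pM ?mulr_ge0 ?invr_ge0 ?(ltW (m_gt0 R j)) //.
  by rewrite invf_le1 ?m_gt0 //; have := m_ge2 R j; lra.
rewrite -[leRHS]mul1r ler_pM //; first by case: (_ <= _ < _)%N; rewrite ?normr1 ?normr0.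
apply: (single_level_sum (n := n)) => // g gl; apply: contraR => h; apply/eqP.
apply: spanned_support Sx _ => s [s0 sn]; apply: ev_out => //.
by rewrite sn.
Qed.

(** Vectors strictly below the child [n] are normed by the functionals [Sh n g], so the subtree
    carries a copy of the whole norm. *)
Lemma shifted_norm n T x c : spanned (shifted n T) x -> 0 <= c ->
  (forall g, valid g -> `|x (Sh n g)| <= c) -> nle valid x c.
Proof.
move=> Sx c0 xc; elim/term_ind_in => [k|k g _|a b j l IH] vt.
- rewrite (spanned_support Sx) ?normr0 // => _ [s [s0 [-> _]]] /=.
  by rewrite eqseq_cons (negbTE s0) andbF.
- have [<-|nk] := eqVneq n k; first exact: xc.
  rewrite (spanned_support Sx) ?normr0 // => _ [s [s0 [-> _]]] /=.
  by rewrite (negbTE nk) mul0r.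
- apply: (single_level_Nd (n := n) _ vt c0).
    by apply: spanned_le Sx => _ [s [s0 [-> _]]]; split.
  by move=> g gl; apply: IH => //; have [/(_ _ gl)] := validNd vt.
Qed.

Lemma no_uncond_shifted n T : no_uncond (sub T n) -> no_uncond (shifted n T).
Proof.
move=> nT v K vS nv uv; apply: (nT (fun k g => v k (Sh n g)) K).
- move=> k; elim/spanned_ind: (vS k) => [y z yz|/=|c _ y [s [s0 [-> Ts]]] IH].
  + by move=> h; apply: spanned_ext h => g; rewrite yz.
  + exact: spanned0.
  + apply: spanned_ext (spannedD (spannedZ c (spanned_ev _ Ts)) IH) => g /=.
    by rewrite eqxx mul1r.
- move=> k; apply: contrapT => z; have [t vt] := nv k; apply/negP; rewrite negbK.
  rewrite -normr_le0; apply: (shifted_norm (vS k)) => // g vg.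
  apply: contrapT => /negP; rewrite normr_le0 => h; apply: z; by exists g.
- move=> b n' a c Hc.
  have Sv (B : pred nat) : spanned (shifted n T)
      (fun t => \sum_(0 <= i < n' | B i) a i * v i t).
    by apply: spanned_sum => i _; exact: spannedZ.
  have := uv b n' a c (shifted_norm (Sv _) (nle_ge0 Hc) Hc).
  by move=> H g vg; exact: (H (Sh n g)).
Qed.

(** Two nonzero multiples of one vector have a vanishing combination, of which a mask keeps one
    nonzero term. *)
Lemma no_uncond_singleton (s : seq nat) : no_uncond [set s].
Proof.
move=> v K vS nv uv.
have /choice[c cE] : forall k, exists c, forall t, v k t = c * ev R t s.
  move=> k; elim/spanned_ind: (vS k) => [y z yz [c yc]|/=|c _ y -> [d yd]].
  - by exists c => t; rewrite -yz.
  - by exists 0 => t; rewrite mul0r.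
  - by exists (c + d) => t; rewrite yd mulrDl.
have [t0 vt0] := nv 0%N; have [t1 vt1] := nv 1%N; rewrite !cE !mulf_eq0 !negb_or.
move=> /andP[c1 _] /andP[c0 e0].
pose a k := if k == 0%N then c 1%N else - c 0%N.
have H : nle valid (fun t => \sum_(0 <= i < 2) a i * v i t) 0.
  move=> t _; rewrite !big_nat_recl // big_geq //= addr0 !cE /a /=.
  by rewrite mulNr mulrA mulrA [c 1%N * _]mulrC subrr normr0.
have := uv (pred1 0%N) 2%N a 0 H t0 vt0.
rewrite mulr0 big_mkcond !big_nat_recl // big_geq //= !addr0 /a /= cE.
by rewrite normr_le0 !mulf_eq0 (negbTE c0) (negbTE c1) (negbTE e0).
Qed.

(** The coordinate projection [P] splits off the unit vector at [[:: n]] itself; what remains lies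
    strictly below it. *)
Lemma no_uncond_level T n : no_uncond (sub T n) ->
  no_uncond [set s | T s /\ head 0 s = n].
Proof.
move=> nT; pose P x (t : term) := x (At n) * ev R t [:: n].
apply: (@no_uncond_split P _ [set [:: n]] (shifted n T)).
- move=> p q a v u; rewrite /P mulr_suml; apply: eq_bigr => k _.
  by rewrite mulrA.
- move=> x c xc t vt; rewrite normrM -[leRHS]mulr1 ler_pM ?xc //.
  by have /andP[h0 h1] := ev_le1 R [:: n] vt; rewrite ger0_norm.
- by move=> x _; apply: spannedZ; exact: spanned_ev.
- move=> x; elim/spanned_ind => [y z yz|/=|c s y [Ts hs] IH].
  + by move=> h; apply: spanned_ext h => t; rewrite /P !yz.
  + by apply: spanned_ext (spanned0 _) => t; rewrite /P mul0r subrr.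
  + case: s => [|k s] in Ts hs *.
      apply: spanned_ext IH => t; rewrite /P !ev_nil; ring.
    move: hs => /= hs; subst k.
    have [s0|s0] := eqVneq s [::].
      apply: spanned_ext IH => t; rewrite /P s0 /= eqxx /=; ring.
    apply: spanned_ext (spannedD (spannedZ c (spanned_ev (n :: s) _)) IH) => [t|].
      by rewrite /P /= eqseq_cons (negbTE s0) andbF /=; ring.
    by exists s; split.
- exact: no_uncond_singleton.
- exact: no_uncond_shifted.
Qed.

Lemma no_uncond_levels T N : (forall n, no_uncond (sub T n)) ->
  no_uncond [set s | T s /\ (head 0 s < N)%N].
Proof.
move=> nT; elim: N => [|N IH].
  move=> v K vS nv _; have [t _] := nv 0%N; rewrite (spanned_support (vS 0%N)) ?eqxx //.
  by move=> s [].
apply: (@no_uncond_split (initial N) _ [set s | T s /\ (head 0 s < N)%N]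
  [set s | T s /\ head 0 s = N]) => //.
- exact: initial_contraction.
- move=> x /spanned_initial h; apply: spanned_le (h N) => s [[Ts _] ?].
  by split.
- move=> x /spanned_final h; apply: spanned_le (h N) => s [[Ts h1] h2].
  by split=> //; apply/eqP; rewrite eqn_leq h2 andbT -ltnS.
- exact: no_uncond_level.
Qed.

(** If some [initial N] is bounded below on a tail, the problem moves to finitely many children.
    Otherwise the humps are unconditional and live on successive intervals of children, which
    [block_not_unconditional] excludes. *)
Lemma no_uncond_node T : (forall n, no_uncond (sub T n)) -> no_uncond T.
Proof.
move=> nT v K vS nv uv.
have vv k : vec (v k) by exact: spanned_le (vS k).
have [H|/existsNP[N /existsNP[M /existsNP[e /not_implyP[e0 H]]]]] := pselect (forall N M e,
    0 < e -> exists q u, [/\ (M <= q)%N, blk v M q u,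
      exists2 t, valid t & 1 <= `|u t| & nle valid (initial N u) e]); last first.
  have [[K' uw] nw] := bounded_below uv (initial_linear N) (@initial_contraction N) e0 nv
    (fun q u Mq bu u1 Pu => H (ex_intro _ q (ex_intro _ u (And4 Mq bu u1 Pu)))).
  apply: (no_uncond_levels (N := N) nT _ nw uw) => k.
  exact: spanned_initial.
have /choice[be beE] : forall x : term -> R, exists N, vec x -> lives 0 N x.
  move=> x; have [vx|nvx] := pselect (vec x); last by exists 0%N.
  by have [N] := vec_lives vx; exists N.
have [N [u [NS bu [K' uw] nw]]] := gliding_hump uv be H.
have vu i : vec (u i) by have [p [q b]] := bu i; exact: blk_vec b.
have Nm i : (N i <= N i.+1)%N by rewrite NS leq_maxl.
apply: (block_not_unconditional Nm _ _ nw uw) => i.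
  apply: spannedB => //; exact: spanned_le (spanned_initial _ (vu i)).
have lu : lives 0 (N i.+1) (u i).
  by apply: lives_le (beE _ (vu i)) _ _ => //; rewrite NS leq_maxr.
move=> t; rewrite /initial vec_trunc_trunc // [X in _ - X]vec_trunc_empty //; last by lia.
by rewrite subr0 -(lu t) -(vec_trunc_cat t (vu i) (Nm i)) addrAC subrr add0r.
Qed.

Lemma branch_of_uncond T : (forall s n, T (rcons s n) -> T s) ->
  ~ no_uncond T -> exists sg : nat -> nat, forall k, T (mkseq sg k).
Proof.
move=> Tp nT.
have step S : ~ no_uncond S -> exists n, ~ no_uncond (sub S n).
  move=> h; apply: contrapT => none; apply: h; apply: no_uncond_node => n.
  by apply: contrapT => h; apply: none; exists n.
pose Q (i : nat) (a b : set (seq nat) * nat) := ~ no_uncond a.1 ->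
  b.1 = sub a.1 b.2 /\ ~ no_uncond b.1.
have [f [f0 fS]] : exists f : nat -> (set (seq nat) * nat)%type,
    f 0%N = (T, 0%N) /\ forall k, Q k (f k) (f k.+1).
  apply: dependent_choice_nat => i [S k].
  have [h|h] := pselect (no_uncond S); first by exists (S, k) => /(_ h).
  by have [n nn] := step _ h; exists (sub S n, n).
have nf k : ~ no_uncond (f k).1.
  by elim: k => [|k /fS[]] //; rewrite f0.
pose sg k := (f k.+1).2; exists sg => k.
have fE : (f k).1 = [set s | T (mkseq sg k ++ s)].
  elim: k => [|k IH]; first by rewrite f0; apply/seteqP; split.
  have [-> _] := fS _ (nf k); rewrite IH; apply/funext => s.
  by rewrite /sub /mkset mkseqS cat_rcons.
(* The span of an empty set is zero, so a subtree with an unconditional sequence contains some [s];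
   prefixes of it then lead back to [mkseq sg k]. *)
have [s Ts] : exists s, T (mkseq sg k ++ s).
  apply: contrapT => none; apply: (nf k) => v K vS nv _.
  have [t _] := nv 0%N; rewrite (spanned_support (vS 0%N)) ?eqxx // => s.
  by rewrite fE => Ts; case: none; exists s.
elim/last_ind: s Ts => [|s n IH]; first by rewrite cats0.
by rewrite -rcons_cat => /Tp.
Qed.

End trees.

(** * The unit vectors along a branch *)

Section branches.
Context {R : realType}.

(** Biorthogonal functionals: each reads off one coefficient along the branch. *)
Fixpoint branch_term (sg : nat -> nat) k : term :=
  if k is k'.+1 then Sh (sg 0%N) (branch_term (sg \o S) k') else At (sg 0%N).

Lemma mkseq_shift (sg : nat -> nat) k :
  mkseq sg k.+1 = sg 0%N :: mkseq (sg \o S) k.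
Proof. by rewrite /mkseq /= (iotaDl 1 0) -map_comp. Qed.

Lemma ev_branch_term sg k l : ev R (branch_term sg k) (mkseq sg l.+1) = (k == l)%:R.
Proof.
elim: k sg l => [|k IH] sg l; rewrite mkseq_shift.
  by rewrite /= eqseq_cons eqxx; case: l => [|l] //; rewrite mkseq_shift.
rewrite [LHS]/= eqxx mul1r; case: l => [|l]; first exact: ev_nil.
by rewrite IH eqSS.
Qed.

Lemma valid_branch_term sg k : valid (branch_term sg k).
Proof. by elim: k sg => //=. Qed.

(** [At] sees one coefficient and [Sh] passes to the tail of the branch; sums add nothing by
    [single_level_Nd], since a branch lies below a single child. *)
Lemma branch_sup_le t (sg : nat -> nat) n (a : nat -> R) c : 0 <= c ->
  (forall i, `|a i| <= c) -> valid t ->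
  `|\sum_(0 <= i < n) a i * ev R t (mkseq sg i.+1)| <= c.
Proof.
move=> c0; elim/term_ind_in: t sg n a => [k|k g IH|x y j l IH] sg n a ac vt.
- case: n => [|n]; first by rewrite big_geq // normr0.
  rewrite big_nat_recl // big_nat big1 ?addr0.
    rewrite normrM -[leRHS]mulr1 ler_pM //.
    by rewrite /=; case: (_ == _); rewrite ?normr1 ?normr0.
  by move=> i _; rewrite !mkseq_shift /= eqseq_cons /= andbF mulr0.
- case: n => [|n]; first by rewrite big_geq // normr0.
  rewrite big_nat_recl // mkseq_shift [ev _ _ _]/= (ev_nil R g) !mulr0 add0r.
  have -> : \sum_(0 <= i < n) a i.+1 * ev R (Sh k g) (mkseq sg i.+2) =
      (sg 0%N == k)%:R * \sum_(0 <= i < n) a i.+1 * ev R g (mkseq (sg \o S) i.+1).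
    rewrite mulr_sumr; apply: eq_bigr => i _.
    by rewrite mkseq_shift [ev _ (Sh _ _) _]/= mulrCA.
  rewrite normrM -[leRHS]mul1r ler_pM //.
    by case: (_ == _); rewrite ?normr1 ?normr0.
  exact: IH (fun i => ac i.+1) vt.
- apply: (@single_level_Nd _ (sg 0%N)
    (fun u => \sum_(0 <= i < n) a i * ev R u (mkseq sg i.+1)) x y j l c) => //.
    apply: spanned_sum => i _; apply/spannedZ/spanned_ev.
    by rewrite mkseq_shift.
  by move=> g gl; apply: IH => //; have [/(_ _ gl)] := validNd vt.
Qed.

Lemma branch_uncond (sg : nat -> nat) :
  uncond valid 1 (fun k t => ev R t (mkseq sg k.+1)).
Proof.
move=> b n a c H; have c0 := nle_ge0 H; rewrite mul1r => t vt.
pose a' i := if b i && (i < n)%N then a i else 0.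
rewrite (_ : \sum_(0 <= i < n | b i) _ =
  \sum_(0 <= i < n) a' i * ev R t (mkseq sg i.+1)).
  apply: branch_sup_le => // i; rewrite /a'; case: ifP => [/andP[_ iltn]|_].
    have := H _ (valid_branch_term sg i).
    rewrite (eq_bigr (fun l => if l == i then a i else 0)).
      by rewrite -big_mkcond big_nat1_eq iltn.
    move=> l _; rewrite ev_branch_term eq_sym; case: eqP => [->|]; last by rewrite mulr0.
    by rewrite mulr1.
  by rewrite normr0.
rewrite big_mkcond; apply: eq_big_nat => i /andP[_ iltn].
by rewrite /a' iltn andbT; case: ifP; rewrite ?mul0r.
Qed.

Lemma branch_nonzero (sg : nat -> nat) k : nonzero valid (fun t => ev R t (mkseq sg k.+1)).
Proof.
exists (branch_term sg k); first exact: valid_branch_term.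
by rewrite ev_branch_term eqxx oner_neq0.
Qed.

End branches.

(** * Continuous functions on the Cantor set *)

Definition agree N (t u : nat -> bool) := forall i, (i < N)%N -> t i = u i.

Lemma agreeW M N t u : (M <= N)%N -> agree N t u -> agree M t u.
Proof. by move=> MN h i iM; apply: h; exact: leq_trans MN. Qed.

(** The product topology is the supremum of the topologies pulled back from the coordinates, so
    convergence of the filter of prefix neighbourhoods is checked one coordinate at a time. *)
Lemma nbhs_cantorP (t : cantor_space) (A : set cantor_space) :
  nbhs t A <-> exists N, forall u, agree N t u -> A u.
Proof.
split; last first.
  move=> [N NA]; have FT : Filter (nbhs t) by exact: nbhs_filter.
  suff : nbhs t [set u | agree N t u] by exact: (@filterS _ (nbhs t) FT _ _ NA).
  clear NA.
  elim: N => [|N IH]; first by apply: (@filterE _ (nbhs t) FT) => u i.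
  have H : nbhs t [set u : cantor_space | t N = u N].
    have := @proj_continuous nat (fun _ => bool) N t [set b | t N = b].
    apply; apply: open_nbhs_nbhs; split=> //; exact: discrete_open.
  apply: (@filterS _ (nbhs t) FT _ _ _ (@filterI _ (nbhs t) FT _ _ H IH)).
  move=> u [/= uN uA] i; rewrite ltnS leq_eqVlt => /predU1P[->//|]; exact: uA.
pose F : set_system cantor_space := [set B | exists N, forall u, agree N t u -> B u].
have FF : Filter F.
  split.
  - by exists 0%N.
  - move=> B C [N NB] [M MC]; exists (maxn N M) => u h; split.
      by apply: NB; apply: agreeW h; exact: leq_maxl.
    by apply: MC; apply: agreeW h; exact: leq_maxr.
  - by move=> B C BC [N NB]; exists N => u /NB /BC.
suff : F --> t by move=> h /h.
apply/cvg_sup => i B. rewrite nbhsE. move=> [C [[D oD DC] Ct] CB].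
exists i.+1 => u tu; apply: CB; rewrite -DC /=.
by move: Ct; rewrite -DC /= tu.
Qed.

Section continuity.
Variable R : realType.
Implicit Types f g : fn R.

Definition modulus f := forall t e, 0 < e -> exists N, forall u, agree N t u ->
  `|f t - f u| <= e.

Lemma contP f : cont f <-> modulus f.
Proof.
split=> [cf t e e0|mf t].
  have /cvgrPdist_le/(_ _ e0) := cf t.
  by move/nbhs_cantorP.
apply/cvgrPdist_le => e e0; apply/nbhs_cantorP; exact: mf.
Qed.
End continuity.

Section limits.
Variable R : realType.

Lemma le_pow2_lim (z A D : R) N : 0 <= D ->
  (forall k, (N <= k)%N -> z <= A + D * 2 ^- k) -> z <= A.
Proof.
move=> D0 H; rewrite leNgt; apply/negP => Az.
have D1 : 0 < D + 1 by rewrite ltr_pwDr.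
have zA : 0 < (z - A) / (D + 1) by rewrite divr_gt0 ?subr_gt0.
have [k0 k0P] := pow2_small zA.
have := H (maxn N k0) (leq_maxl _ _).
have h : 2 ^- maxn N k0 <= 2 ^- k0 :> R.
  by rewrite lef_pV2 ?posrE ?exprn_gt0 // ler_eXn2l ?leq_maxr // ltr1n.
have p0 : 0 < 2 ^- maxn N k0 :> R by rewrite invr_gt0 exprn_gt0.
have := le_lt_trans h k0P; rewrite ltr_pdivlMr //.
move: p0; set p := 2 ^- _ => p0 h1 h2; nra.
Qed.

Lemma cauchy_pow2 (u : nat -> R) C : 0 <= C ->
  (forall k l, `|u k - u l| <= C * (2 ^- k + 2 ^- l)) ->
  exists x, forall k, `|u k - x| <= C * 2 ^- k.
Proof.
move=> C0 H; pose A := [set u k - C * 2 ^- k | k in setT].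
have ub k l : u k - C * 2 ^- k <= u l + C * 2 ^- l.
  have := ler_norm (u k - u l); have := H k l; lra.
have hsA : has_sup A.
  split; first by exists (u 0%N - C * 2 ^- 0), 0%N.
  by exists (u 0%N + C * 2 ^- 0) => _ [k _ <-]; exact: ub.
exists (sup A) => k; rewrite ler_norml; apply/andP; split.
  rewrite lerBrDl -lerBrDr opprK.
  by apply: ge_sup; [exists (u 0%N - C * 2 ^- 0), 0%N|move=> _ [l _ <-]; exact: ub].
have : u k - C * 2 ^- k <= sup A by apply: ub_le_sup; [exact: hsA.2|exists k].
lra.
Qed.

Lemma uniform_limit_pow2 (T : Type) (u : nat -> T -> R) C : 0 <= C ->
  (forall k l t, `|u k t - u l t| <= C * (2 ^- k + 2 ^- l)) ->
  exists g, forall k t, `|u k t - g t| <= C * 2 ^- k.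
Proof.
move=> C0 H; have /choice[g gP] : forall t, exists x, forall k, `|u k t - x| <= C * 2 ^- k.
  by move=> t; exact: (cauchy_pow2 (u := fun k => u k t) C0).
by exists g => k t; exact: gP.
Qed.

Lemma pow2_eventually (C e : R) : 0 <= C -> 0 < e -> exists N, forall k, (N <= k)%N ->
  C * 2 ^- k <= e.
Proof.
move=> C0 e0; have C1 : 0 < C + 1 by rewrite ltr_pwDr.
have [N NP] := pow2_small (divr_gt0 e0 C1).
exists N => k Nk; have h : 2 ^- k <= 2 ^- N :> R.
  by rewrite lef_pV2 ?posrE ?exprn_gt0 // ler_eXn2l // ltr1n.
have := le_lt_trans h NP; rewrite ltr_pdivlMr //.
have : 0 < 2 ^- k :> R by rewrite invr_gt0 exprn_gt0.
set p := 2 ^- _ => p0 h1; nra.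
Qed.

End limits.

Section function_space.
Variable R : realType.
Implicit Types f g : fn R.
Notation nle := (nle [set: cantor_space]).

Lemma cont_unif (u : nat -> fn R) g : (forall n, cont (u n)) -> unif_cvg u g -> cont g.
Proof.
move=> cu ug; apply/contP => t e e0.
have e4 : 0 < e / 4 by rewrite divr_gt0.
have [N NP] := ug _ e4; have /contP/(_ t _ e4)[M MP] := cu N.
exists M => v tv; have := MP v tv; have := NP N (leqnn N) t; have := NP N (leqnn N) v.
rewrite !ler_norml => /andP[? ?] /andP[? ?] /andP[? ?]; apply/andP; split; lra.
Qed.

Lemma contD f g : cont f -> cont g -> cont (fun t => f t + g t).
Proof.
move=> /contP mf /contP mg; apply/contP => t e e0.
have e2 : 0 < e / 2 by rewrite divr_gt0.
have [N NP] := mf t _ e2; have [M MP] := mg t _ e2.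
exists (maxn N M) => v tv.
have := NP v (agreeW (leq_maxl _ _) tv); have := MP v (agreeW (leq_maxr _ _) tv).
rewrite !ler_norml => /andP[? ?] /andP[? ?]; apply/andP; split; lra.
Qed.

Lemma cont_cst (c : R) : cont (fun=> c).
Proof. by apply/contP => t e e0; exists 0%N => v _; rewrite subrr normr0 ltW. Qed.

Lemma contZ c f : cont f -> cont (fun t => c * f t).
Proof.
move=> /contP mf; apply/contP => t e e0.
have c1 : 0 < `|c| + 1 by rewrite ltr_pwDr.
have [N NP] := mf t _ (divr_gt0 e0 c1); exists N => v /NP h.
rewrite -mulrBr normrM; apply: le_trans (_ : (`|c| + 1) * (e / (`|c| + 1)) <= _).
  by rewrite ler_pM // lerDl.
by rewrite mulrCA mulfV ?mulr1 // gt_eqF.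
Qed.

Lemma cont_sum (I : Type) (r : seq I) (P : pred I) (F : I -> fn R) :
  (forall i, P i -> cont (F i)) -> cont (fun t => \sum_(i <- r | P i) F i t).
Proof.
move=> cF; elim: r => [|i r IH].
  by rewrite (_ : (fun t => _) = (fun=> 0)); [exact: cont_cst|apply/funext => t; rewrite big_nil].
have [Pi|nPi] := boolP (P i).
  rewrite (_ : (fun t => _) = (fun t => F i t + \sum_(i <- r | P i) F i t)).
    exact/contD/IH/cF.
  by apply/funext => t; rewrite big_cons Pi.
rewrite (_ : (fun t => _) = (fun t => \sum_(i <- r | P i) F i t)) //.
by apply/funext => t; rewrite big_cons (negbTE nPi).
Qed.

Definition prefix_ext (s : seq bool) : nat -> bool := fun i => nth false s i.

(* König's lemma: a failure of uniformity would propagate along a branch of prefixes. *)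
Lemma cont_uniform f e : cont f -> 0 < e ->
  exists N, forall t u, agree N t u -> `|f t - f u| <= e.
Proof.
move=> /contP mf e0; apply: contrapT => none.
pose good (s : seq bool) := exists N, forall t u,
  agree (size s) t (prefix_ext s) -> agree N t u -> `|f t - f u| <= e.
have split_good s : good (rcons s true) -> good (rcons s false) -> good s.
  move=> [N NP] [M MP]; exists (maxn (size s).+1 (maxn N M)) => t u ts tu.
  have tb b : t (size s) = b -> agree (size (rcons s b)) t (prefix_ext (rcons s b)).
    move=> tb i; rewrite size_rcons ltnS leq_eqVlt /prefix_ext nth_rcons.
    by move=> /predU1P[->|il]; rewrite ?ltnn ?eqxx // il; exact: ts.
  case E : (t (size s)).
    by apply: (NP _ _ (tb _ E)); apply: (agreeW _ tu); lia.
  by apply: (MP _ _ (tb _ E)); apply: (agreeW _ tu); lia.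
have bad0 : ~ good [::].
  by move=> [N NP]; apply: none; exists N => t u; apply: NP.
have [h [h0 hS]] : exists h : nat -> seq bool, h 0%N = [::] /\
    forall k, (~ good (h k) -> exists b, h k.+1 = rcons (h k) b /\ ~ good (h k.+1)).
  apply: (@dependent_choice_nat _ (fun _ s s' => ~ good s ->
    exists b, s' = rcons s b /\ ~ good s')) => k0 s.
  have [gs|ngs] := pselect (good s); first by exists s => /(_ gs).
  have [gt|?] := pselect (good (rcons s true)); last first.
    by exists (rcons s true) => _; exists true.
  by exists (rcons s false) => _; exists false; split=> // /(split_good _ gt).
have bad k : ~ good (h k) by elim: k => [|k /hS[b []]] //; rewrite h0.
have sh k : size (h k) = k.
  by elim: k => [|k IH]; [rewrite h0|have [b [-> _]] := hS _ (bad k); rewrite size_rcons IH].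
pose t0 k := nth false (h k.+1) k.
have hE k : agree k t0 (prefix_ext (h k)).
  elim: k => [//|k IH] i; have [b [E _]] := hS _ (bad k).
  rewrite ltnS leq_eqVlt => /predU1P[->//|ik].
  by rewrite IH // E /prefix_ext nth_rcons sh ik.
have [N NP] := mf t0 _ (divr_gt0 e0 (ltr0n R 2)).
apply: (bad N); exists N => t u tN tu.
have t0t : agree N t0 t by move=> i iN; rewrite (hE N) // -tN // sh.
have t0u : agree N t0 u by move=> i iN; rewrite t0t // tu.
have := NP _ t0t; have := NP _ t0u.
rewrite !ler_norml => /andP[? ?] /andP[? ?]; apply/andP; split; lra.
Qed.

Lemma cont_bounded f : cont f -> exists M, nle f M.
Proof.
move=> cf; have [N NP] := cont_uniform cf (ltr01 : 0 < 1).
pose F (s : N.-tuple bool) := `|f (prefix_ext s)|.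
exists (\sum_s F s + 1) => t _.
pose s := [tuple t i | i < N].
have ts : agree N t (prefix_ext s).
  by move=> i iN; rewrite /prefix_ext -[i]/(nat_of_ord (Ordinal iN)) -tnth_nth tnth_mktuple.
have h1 : F s <= \sum_s F s.
  rewrite (bigD1 s) //= lerDl sumr_ge0 // => ? _; exact: normr_ge0.
have h2 := NP _ _ ts; have := ler_normD (f t - f (prefix_ext s)) (f (prefix_ext s)).
rewrite subrK /F in h1 *; lra.
Qed.

(** * Closed spans *)

Section closed_span.
Variables (I : eqType) (E : I -> fn R) (S : set I).

Definition cspan : set (fn R) := [set f | cont f /\ forall e, 0 < e ->
  exists l : seq (R * I), (forall p, p \in l -> S p.2) /\
    nle (fun t => f t - comb E l t) e].

Lemma cspan_closed : closed_subspace cspan.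
Proof.
split.
- by move=> f [].
- split; first exact: cont_cst.
  move=> e e0; exists [::]; split=> // t _.
  by rewrite /comb big_nil subrr normr0 ltW.
- move=> f g [cf fP] [cg gP]; split; first exact: contD.
  move=> e e0; have e2 : 0 < e / 2 by rewrite divr_gt0.
  have [l [lS fl]] := fP _ e2; have [k [kS gk]] := gP _ e2.
  exists (l ++ k); split=> [p|].
    by rewrite mem_cat => /orP[/lS|/kS].
  rewrite [e]splitr; apply: nle_ext (nleD fl gk) => t _.
  by rewrite /comb big_cat /=; ring.
- move=> a f [cf fP]; split; first exact: contZ.
  move=> e e0; have c1 : 0 < `|a| + 1 by rewrite ltr_pwDr.
  have [l [lS fl]] := fP _ (divr_gt0 e0 c1).
  exists [seq (a * p.1, p.2) | p <- l]; split=> [p|].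
    by move=> /mapP[q ql ->]; exact: (lS _ ql).
  apply: nleW (nle_ext _ (nleZ a fl)).
    rewrite mulrA ler_pdivrMr // mulrDr mulr1 [e * _]mulrC lerDl; exact: ltW.
  move=> t _; rewrite mulrBr /comb big_map mulr_sumr; congr (_ - _).
  by apply: eq_bigr => i _; rewrite mulrA.
- move=> u g uP ug; split; first by apply: cont_unif ug => n; case: (uP n).
  move=> e e0; have e2 : 0 < e / 2 by rewrite divr_gt0.
  have [N NP] := ug _ e2; have [_ /(_ _ e2)[l [lS ul]]] := uP N.
  exists l; split=> //; rewrite [e]splitr.
  apply: nle_ext (nleB ul (fun t _ => NP N (leqnn N) t)) => t _; ring.
Qed.

Hypothesis cE : forall i, cont (E i).

Lemma cont_comb l : cont (comb E l).
Proof. by apply: cont_sum => p _; exact: contZ. Qed.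

Lemma comb_cspan l : (forall p, p \in l -> S p.2) -> cspan (comb E l).
Proof.
move=> lS; split; first exact: cont_comb.
by move=> e e0; exists l; split=> // t _; rewrite subrr normr0 ltW.
Qed.

Lemma cspan_mem i : S i -> cspan (E i).
Proof.
move=> Si; rewrite (_ : E i = comb E [:: (1, i)]).
  by apply: comb_cspan => p; rewrite inE => /eqP ->.
by apply/funext => t; rewrite /comb big_seq1 mul1r.
Qed.

(** Finite combinations are dense. This reduces Effros measurability of closed spans to conditions
    on finitely many generators. *)
Lemma cspan_meets U : CD_open U ->
  (exists2 f, cspan f & U f) <->
  exists l, (forall p, p \in l -> S p.2) /\ U (comb E l).
Proof.
move=> [Uc Uo]; split=> [[f [cf fP] /Uo[e e0 eP]]|[l [lS Ul]]].
  have [l [lS fl]] := fP e e0; exists l; split=> //.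
  by apply: eP => [|t]; [exact: cont_comb|exact: fl].
by exists (comb E l) => //; exact: comb_cspan.
Qed.

End closed_span.

Lemma comb_nat (E : nat -> fn R) l : exists n a, forall t,
  comb E l t = \sum_(0 <= i < n) a i * E i t.
Proof.
elim: l => [|[c j] l [n [a IH]]].
  by exists 0%N, (fun=> 0) => t; rewrite /comb big_nil big_geq.
exists (maxn n j.+1), (fun i => (if i == j then c else 0) + (if (i < n)%N then a i else 0)) => t.
rewrite /comb big_cons -/(comb E l t) IH.
under [RHS]eq_bigr do rewrite mulrDl.
rewrite big_split /=; congr (_ + _).
  rewrite (eq_bigr (fun i => if i == j then c * E i t else 0)).
    by rewrite -big_mkcond big_nat1_eq leq_maxr.
  by move=> i _; case: ifP; rewrite ?mul0r.
rewrite [RHS](big_cat_nat (n := n)) ?leq_maxl //= [X in _ + X]big_nat [X in _ + X]big1 ?addr0.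
  by apply: eq_big_nat => i /andP[_ ->].
by move=> i /andP[ni _]; rewrite ltnNge ni mul0r.
Qed.

Lemma clspan_approx (x : nat -> fn R) y : (forall n, cont (x n)) -> clspan x y ->
  forall e, 0 < e -> exists n a, nle (fun t => y t - \sum_(0 <= i < n) a i * x i t) e.
Proof.
move=> cx /(_ _ (cspan_closed x setT)) H e e0.
have [_ /(_ e e0)[l [_ yl]]] := H (fun n => cspan_mem (S := setT) cx (i := n) I).
have [n [a na]] := comb_nat x l.
by exists n, a; apply: nle_ext yl => t _; rewrite na.
Qed.

End function_space.

(** * Unconditional basic sequences *)

Section unconditional_basic.
Variable R : realType.
Notation nle := (nle [set: cantor_space]).
Notation uncond := (uncond [set: cantor_space]).
Notation nonzero := (nonzero [set: cantor_space]).
Implicit Types x : nat -> fn R.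

Lemma nle_nonneg (f : fn R) c : nle f c -> 0 <= c.
Proof. by move=> /(_ (fun=> false) I); exact: le_trans. Qed.

Lemma uncond_le K K' x : K <= K' -> uncond K x -> uncond K' x.
Proof.
move=> KK ux b n a c H; apply: nleW (ux b n a c H).
by rewrite ler_wpM2r // (nle_nonneg H).
Qed.

Lemma series_cvgE (a : nat -> R) x y : series_cvg a x y <->
  forall e, 0 < e -> exists N, forall n, (N <= n)%N ->
    nle (fun t => \sum_(0 <= i < n) a i * x i t - y t) e.
Proof.
split=> H e e0; have [N NP] := H e e0; exists N => n Nn.
  by move=> t _; rewrite big_mkord; exact: NP.
by move=> t; have := NP n Nn t I; rewrite big_mkord.
Qed.

(** * A finite constant yields an unconditional basic sequence *)

Section from_constant.
Variables (x : nat -> fn R) (K : R).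
Hypotheses (cx : forall n, cont (x n)) (nx : forall n, nonzero (x n)).
Hypotheses (K0 : 0 <= K) (ux : uncond K x).

Lemma coef_le n (a : nat -> R) c i t : (i < n)%N ->
  nle (fun t => \sum_(0 <= i < n) a i * x i t) c -> `|a i * x i t| <= K * c.
Proof. by move=> ilt H; exact: (uncond_coef ux ilt H). Qed.

(** Each term of a finite sum is bounded by [K] times the norm, so the coefficients of better and
    better approximations are Cauchy; their limits are the expansion. *)
Lemma expansion_exists y : clspan x y -> exists a, series_cvg a x y.
Proof.
move=> yx.
have /choice[na naP] : forall k, exists na : nat * (nat -> R),
    nle (fun t => y t - \sum_(0 <= i < na.1) na.2 i * x i t) (2 ^- k).
  move=> k; have [|n [a na]] := clspan_approx cx yx (e := 2 ^- k).
    by rewrite invr_gt0 exprn_gt0.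
  by exists (n, a).
pose N k := (na k).1; pose a k i := if (i < N k)%N then (na k).2 i else 0.
have aP k n : (N k <= n)%N -> nle (fun t => y t - \sum_(0 <= i < n) a k i * x i t) (2 ^- k).
  move=> Nn; apply: nle_ext (naP k) => t _; congr (_ - _).
  rewrite [RHS](big_cat_nat (n := N k)) //= [X in _ + X]big_nat [X in _ + X]big1 ?addr0.
    by apply: eq_big_nat => i /andP[_ ik]; rewrite /a ik.
  by move=> i /andP[ki _]; rewrite /a ltnNge ki mul0r.
have diff k l n : (N k <= n)%N -> (N l <= n)%N ->
    nle (fun t => \sum_(0 <= i < n) (a k i - a l i) * x i t) (2 ^- k + 2 ^- l).
  move=> kn ln; rewrite addrC; apply: nle_ext (nleB (aP l n ln) (aP k n kn)) => t _.
  under [RHS]eq_bigr do rewrite mulrBl.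
  rewrite sumrB; ring.
have /choice[tt ttP] : forall i, exists t, x i t != 0 by move=> i; have [t _ ?] := nx i; exists t.
pose C i := K / `|x i (tt i)|.
have C0 i : 0 <= C i by rewrite divr_ge0.
have /choice[al alP] : forall i, exists z, forall k, `|a k i - z| <= C i * 2 ^- k.
  move=> i; apply: (cauchy_pow2 (u := fun k => a k i)) => // k l.
  have := coef_le (tt i) (_ : (i < maxn i.+1 (maxn (N k) (N l)))%N)
    (diff k l (maxn i.+1 (maxn (N k) (N l))) _ _).
  rewrite !leq_max !leqnn !orbT => /(_ isT isT isT).
  by rewrite normrM /C mulrAC ler_pdivlMr ?normr_gt0.
exists al; apply/series_cvgE => e e0.
have tail k n : nle (fun t => \sum_(0 <= i < n) (a k i - al i) * x i t) (K * 2 ^- k).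
  move=> t _.
  pose D := \sum_(0 <= i < n) C i * `|x i t|.
  have D0 : 0 <= D by apply: sumr_ge0 => i _; rewrite mulr_ge0.
  apply: (@le_pow2_lim _ _ _ (K + D) 0%N) => [|l _]; first by rewrite addr_ge0.
  pose M := maxn n (maxn (N k) (N l)).
  (* The mask [i < n] cuts the first [n] terms out of a difference of two approximations, whose norm
     is at most [2 ^- k + 2 ^- l]. *)
  have h1 : `|\sum_(0 <= i < n) (a k i - a l i) * x i t| <= K * (2 ^- k + 2 ^- l).
    have := ux (fun i => (i < n)%N) (diff k l M _ _) I.
    rewrite /M !leq_max !leqnn !orbT => /(_ isT isT t); apply: le_trans.
    by rewrite (big_nat_widen 0 n M) ?leq_maxl.
  have h2 : `|\sum_(0 <= i < n) (a l i - al i) * x i t| <= D * 2 ^- l.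
    rewrite (le_trans (ler_norm_sum _ _ _)) // /D mulr_suml ler_sum // => i _.
    by rewrite normrM mulrAC ler_wpM2r.
  have -> : \sum_(0 <= i < n) (a k i - al i) * x i t =
      \sum_(0 <= i < n) (a k i - a l i) * x i t + \sum_(0 <= i < n) (a l i - al i) * x i t.
    by rewrite -big_split; apply: eq_bigr => i _ /=; ring.
  have := ler_normD (\sum_(0 <= i < n) (a k i - a l i) * x i t)
    (\sum_(0 <= i < n) (a l i - al i) * x i t); lra.
have K1 : 0 <= K + 1 by rewrite addr_ge0.
have [k kP] := pow2_eventually K1 e0.
exists (N k) => n Nn; apply: nleW (kP k (leqnn k)) _.
rewrite mulrDl mul1r addrC.
have := nleB (nleZ (-1) (aP k n Nn)) (tail k n); rewrite normrN1 mul1r.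
apply: nle_ext => t _; under [X in _ - X]eq_bigr do rewrite mulrBl.
rewrite sumrB; ring.
Qed.

Lemma expansion_unique y (a b : nat -> R) :
  series_cvg a x y -> series_cvg b x y -> a = b.
Proof.
move=> /series_cvgE ay /series_cvgE bY; apply/funext => i.
have [t _ xt] := nx i; apply/eqP; rewrite -subr_eq0; apply/negPn/negP => ab.
have : `|(a i - b i) * x i t| <= 0.
  apply: (@le_pow2_lim _ _ _ (2 * K) 0%N) => [|k _]; first by rewrite mulr_ge0.
  have e0 : 0 < 2 ^- k :> R by rewrite invr_gt0 exprn_gt0.
  have [N NP] := ay _ e0; have [M MP] := bY _ e0.
  pose n := maxn i.+1 (maxn N M).
  have nN : (N <= n)%N by rewrite !leq_max leqnn !orbT.
  have nM : (M <= n)%N by rewrite !leq_max leqnn !orbT.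
  have in_ : (i < n)%N by rewrite leq_max leqnn.
  have h : nle (fun t => \sum_(0 <= j < n) (a j - b j) * x j t) (2 ^- k + 2 ^- k).
    apply: nle_ext (nleB (NP n nN) (MP n nM)) => u _.
    under [RHS]eq_bigr do rewrite mulrBl.
    rewrite sumrB; ring.
  have := coef_le (a := fun j => a j - b j) t in_ h; lra.
by rewrite normr_le0 mulf_eq0 (negbTE ab) (negbTE xt).
Qed.

(** The first [n] rearranged terms form a masked sum over [[0, L)]. Once the mask contains [[0, N)],
    what remains is a masked sum of a small tail. *)
Lemma ubs_of_uncond : unconditional_basic_seq x.
Proof.
split=> [y /expansion_exists[a ay]|y _ a /series_cvgE ay s [s' ss' s's]].
  by exists a; split=> // b; exact: expansion_unique.
apply/series_cvgE => e e0.
have K21 : 0 < 2 * K + 1 by rewrite ltr_wpDl // mulr_ge0.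
have [N NP] := ay _ (divr_gt0 e0 K21).
pose M := (\max_(i < N) s' i).+1.
exists M => n Mn t _.
pose L := maxn N (\max_(i < n) s i).+1.
have NL : (N <= L)%N by rewrite leq_maxl.
pose b j := (s' j < n)%N.
have bN j : (j < N)%N -> b j.
  move=> jN; apply: leq_trans Mn; rewrite /M ltnS.
  exact: (leq_bigmax (Ordinal jN)).
have -> : \sum_(0 <= i < n) (a \o s) i * (x \o s) i t =
    \sum_(0 <= j < L | b j) a j * x j t.
  rewrite -(big_map s xpredT (fun j => a j * x j t)) -[RHS]big_filter.
  apply: perm_big; apply: uniq_perm.
  - by rewrite map_inj_uniq ?iota_uniq //; exact: can_inj ss'.
  - by rewrite filter_uniq // iota_uniq.
  move=> j; rewrite mem_filter mem_index_iota; apply/mapP/andP => [[i]|[bj _]].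
    rewrite mem_index_iota => /andP[_ iltn] ->; rewrite /b ss'; split=> //=.
    by rewrite leq_max; apply/orP; right; rewrite ltnS; exact: (leq_bigmax (Ordinal iltn)).
  by exists (s' j); rewrite ?s's // mem_index_iota.
pose a' j := if (j < N)%N then 0 else a j.
have H : nle (fun t => \sum_(0 <= j < L) a' j * x j t) (2 * (e / (2 * K + 1))).
  rewrite mulr_natl mulr2n.
  apply: nle_ext (nleB (NP L NL) (NP N (leqnn N))) => u _.
  rewrite opprB addrA subrK (big_cat_nat (n := N)) //= addrC addKr.
  rewrite [RHS](big_cat_nat (n := N)) //= [X in X + _]big_nat [X in X + _]big1 ?add0r.
    by apply: eq_big_nat => j /andP[Nj _]; rewrite /a' ltnNge Nj.
  by move=> j /andP[_ jN]; rewrite /a' jN mul0r.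
have Hb := ux b H I (t := t); have HN := NP N (leqnn N) t I.
have -> : \sum_(0 <= j < L | b j) a j * x j t - y t =
    \sum_(0 <= j < L | b j) a' j * x j t + (\sum_(0 <= j < N) a j * x j t - y t).
  rewrite addrA; congr (_ - _).
  rewrite (big_cat_nat (n := N)) //= addrC; congr (_ + _).
    rewrite [RHS](big_cat_nat (n := N)) //= [X in X + _]big_nat_cond [X in X + _]big1 ?add0r.
      rewrite big_nat_cond [RHS]big_nat_cond; apply: eq_bigr => j /andP[/andP[Nj _] _].
      by rewrite /a' ltnNge Nj.
    by move=> j /andP[/andP[_ jN] _]; rewrite /a' jN mul0r.
  rewrite big_nat_cond [RHS]big_nat; apply: eq_bigl => j.
  by rewrite leq0n /=; case: ltnP => // /bN.
apply: le_trans (ler_normD _ _) _; apply: le_trans (lerD Hb HN) _.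
have -> : K * (2 * (e / (2 * K + 1))) + e / (2 * K + 1) = e by field; rewrite gt_eqF.
by [].
Qed.

End from_constant.
End unconditional_basic.

(* Rearranges each interval [N k, N k.+1) so that the indices selected by [b k] come
   first. *)
Lemma block_permutation (V : zmodType) (N : nat -> nat) (b : nat -> pred nat) :
  N 0%N = 0%N -> (forall k, (N k < N k.+1)%N) ->
  exists s : nat -> nat, bijective s /\ forall k, exists c, forall F : nat -> V,
    \sum_(0 <= i < N k + c) F (s i) =
    \sum_(0 <= i < N k) F (s i) + \sum_(N k <= i < N k.+1 | b k i) F i.
Proof.
move=> N0 NS; have Nmono : {homo N : i j / (i <= j)%N}.
  by apply: homo_leq => // [? ? ?|i]; [exact: leq_trans|exact: ltnW].
have kN k : (k <= N k)%N by elim: k => // k IH; exact: leq_ltn_trans (NS k).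
have /choice[kk kkP] : forall i, exists k, (N k <= i < N k.+1)%N.
  move=> i; have ex : exists k, (i < N k.+1)%N by exists i; exact: kN.
  case: (ex_minnP ex) => k h1 h2; exists k; rewrite h1 andbT.
  by case: k h1 h2 => [|k] h1 h2; [rewrite N0|rewrite leqNgt; apply/negP => /h2; rewrite ltnn].
have kkU i k : (N k <= i < N k.+1)%N -> kk i = k.
  move=> /andP[h1 h2]; have /andP[h3 h4] := kkP i.
  apply/eqP; rewrite eqn_leq; apply/andP; split; rewrite leqNgt; apply/negP => /Nmono h.
    by move: (leq_trans h2 (leq_trans h h3)); rewrite ltnn.
  by move: (leq_trans h4 (leq_trans h h1)); rewrite ltnn.
pose blk k := index_iota (N k) (N k.+1).
pose L k := [seq i <- blk k | b k i] ++ [seq i <- blk k | ~~ b k i].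
have permL k : perm_eq (L k) (blk k) by apply/permPl/perm_filterC.
have sL k : size (L k) = (N k.+1 - N k)%N by rewrite (perm_size (permL k)) size_iota.
have uL k : uniq (L k) by rewrite (perm_uniq (permL k)) iota_uniq.
have memL k i : (i \in L k) = (N k <= i < N k.+1)%N.
  by rewrite (perm_mem (permL k)) mem_index_iota.
pose s i := nth 0%N (L (kk i)) (i - N (kk i)).
pose s' j := (N (kk j) + index j (L (kk j)))%N.
have szi i : (i - N (kk i) < size (L (kk i)))%N.
  by rewrite sL; have := kkP i; lia.
have ks i : kk (s i) = kk i by apply: kkU; rewrite -memL mem_nth.
have ks' j : kk (s' j) = kk j.
  apply: kkU; rewrite leq_addr /s'; have := memL (kk j) j; rewrite kkP -index_mem sL.
  by have := NS (kk j); lia.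
exists s; split.
  exists s' => [i|j]; rewrite /s' /s.
    by rewrite -/(s i) ks /s index_uniq // subnKC //; have /andP[] := kkP i.
  by rewrite -/(s' j) ks' /s' addKn nth_index // memL.
move=> k; exists (size [seq i <- blk k | b k i]) => F.
rewrite (big_cat_nat (n := N k)) ?leq_addr //=; congr (_ + _).
rewrite -[RHS]big_filter -/(blk k) [RHS](big_nth 0%N) /=.
rewrite [LHS](big_addn 0 _ (N k)) addKn.
apply: eq_big_nat => i /andP[_ ic].
have ik : (i < N k.+1 - N k)%N.
  by rewrite -sL size_cat (leq_trans ic) // leq_addr.
have -> : s (i + N k)%N = nth 0%N (L k) i.
  by rewrite /s (kkU (i + N k)%N k) ?addnK //; lia.
by rewrite nth_cat ic.
Qed.

Lemma geometric_tail (R : realType) m l : \sum_(m <= k < l) (2 ^- k : R) <= 2 * 2 ^- m.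
Proof.
have [ml|lm] := leqP m l; last by rewrite big_geq ?mulr_ge0 ?invr_ge0 ?exprn_ge0 // ltnW.
rewrite (big_addn 0 l m).
under eq_bigr do rewrite exprD invfM.
by rewrite -mulr_suml ler_wpM2r ?invr_ge0 ?exprn_ge0 // sum_geometric2.
Qed.

(** * An unconditional basic sequence has a finite constant *)

Section basis_constant.
Variable R : realType.
Notation nle := (nle [set: cantor_space]).
Notation uncond := (uncond [set: cantor_space]).
Notation nonzero := (nonzero [set: cantor_space]).
Variable x : nat -> fn R.
Hypothesis cx : forall n, cont (x n).

(** Otherwise masked sums over successive intervals would stay away from 0. The permutation of
    [block_permutation] makes them differences of partial sums of one rearrangement, which then
    diverges. *)
Lemma bounded_masks (a : nat -> R) y :
  (forall s : nat -> nat, bijective s -> series_cvg (a \o s) (x \o s) y) ->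
  exists M, forall (b : pred nat) n, nle (fun t => \sum_(0 <= i < n | b i) a i * x i t) M.
Proof.
move=> H.
have tails e : 0 < e -> exists N, forall (b : pred nat) n,
    nle (fun t => \sum_(N <= i < n | b i) a i * x i t) e.
  move=> e0; apply: contrapT => none.
  have /choice[g gP] : forall N, exists nb : nat * pred nat,
      ~ nle (fun t => \sum_(N <= i < nb.1 | nb.2 i) a i * x i t) e.
    move=> N; apply: contrapT => h; apply: none; exists N => b n.
    by apply: contrapT => h'; apply: h; exists (n, b).
  pose N := fix N k := if k is k'.+1 then (g (N k')).1 else 0%N.
  have NS k : (N k < N k.+1)%N.
    rewrite ltnNge; apply/negP => h; apply: (gP (N k)) => t _.
    by rewrite big_geq // normr0 ltW.
  have kN k : (k <= N k)%N by elim: k => // k IH; exact: leq_ltn_trans (NS k).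
  have [s [bs sP]] := @block_permutation R N (fun k => (g (N k)).2) erefl NS.
  have /series_cvgE/(_ _ (divr_gt0 e0 (ltr0n R 2)))[k kP] := H s bs.
  have [c cP] := sP k.
  apply: (gP (N k)) => t _.
  have h1 := kP _ (kN k) t I.
  have h2 := kP _ (leq_trans (kN k) (leq_addr c _)) t I.
  move: h2; rewrite (cP (fun i => a i * x i t)) => h2.
  move: h1 h2; rewrite /=; set A := \sum_(0 <= i < N k) _; set B := \sum_(_ <= i < _ | _) _.
  move=> h1 h2; have := ler_normB (A + B - y t) (A - y t).
  have -> : A + B - y t - (A - y t) = B by ring.
  rewrite /B /=; lra.
have [N NP] := tails 1 ltr01.
have /choice[B BP] : forall i, exists M, nle (x i) M by move=> i; exact: cont_bounded.
exists (\sum_(0 <= i < N) `|a i| * B i + 1) => b n.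
have c0 i : 0 <= `|a i| * B i by rewrite mulr_ge0 // (nle_nonneg (BP i)).
have H1 : nle (fun t => \sum_(0 <= i < n | b i && (i < N)%N) a i * x i t)
    (\sum_(0 <= i < N) `|a i| * B i).
  apply: nleW (nle_sum _); last by move=> i _ _; exact: nleZ (BP i).
  rewrite [leRHS](big_nat_widen 0 N (maxn n N)) ?leq_maxr //.
  rewrite [leLHS](big_nat_widen 0 n (maxn n N)) ?leq_maxl //.
  rewrite [leLHS]big_mkcond [leRHS]big_mkcond ler_sum // => i _ /=.
  by case: (i < N)%N; rewrite ?andbF //= andbT; case: ifP.
apply: nle_ext (nleD H1 (NP b n)) => t _.
rewrite [RHS](bigID (fun i => (i < N)%N)) /=; congr (_ + _).
by rewrite (big_nat_widenl N 0) //; apply: eq_bigl => i; rewrite -leqNgt.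
Qed.

(** The unconditional norm of [y], the supremum of all masked partial sums, is at most [M]. The
    balls of this norm are the sets of the category argument. *)
Definition absorbed M (y : fn R) := exists a, series_cvg a x y /\
  forall (b : pred nat) n, nle (fun t => \sum_(0 <= i < n | b i) a i * x i t) M.

Lemma series_cvgD (a b : nat -> R) (y z : fn R) : series_cvg a x y -> series_cvg b x z ->
  series_cvg (fun i => a i + b i) x (fun t => y t + z t).
Proof.
move=> /series_cvgE ay /series_cvgE bz; apply/series_cvgE => e e0.
have e2 : 0 < e / 2 by rewrite divr_gt0.
have [N NP] := ay _ e2; have [M MP] := bz _ e2.
exists (maxn N M) => n; rewrite geq_max => /andP[Nn Mn].
rewrite [e]splitr; apply: nle_ext (nleD (NP n Nn) (MP n Mn)) => t _.
by under [in RHS]eq_bigr do rewrite mulrDl; rewrite big_split /=; ring.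
Qed.

Lemma series_cvgZ c (a : nat -> R) (y : fn R) : series_cvg a x y ->
  series_cvg (fun i => c * a i) x (fun t => c * y t).
Proof.
move=> /series_cvgE ay; apply/series_cvgE => e e0.
have c1 : 0 < `|c| + 1 by rewrite ltr_pwDr.
have [N NP] := ay _ (divr_gt0 e0 c1); exists N => n /NP /(nleZ c) h.
apply: nleW (nle_ext _ h).
  rewrite mulrA ler_pdivrMr // mulrDr mulr1 [e * _]mulrC lerDl; exact: ltW.
by move=> t _; rewrite mulrBr mulr_sumr; under eq_bigr do rewrite mulrA.
Qed.

Lemma absorbedZ c M y : absorbed M y -> absorbed (`|c| * M) (fun t => c * y t).
Proof.
move=> [a [ay aM]]; exists (fun i => c * a i); split; first exact: series_cvgZ.
move=> b n; apply: nle_ext (nleZ c (aM b n)) => t _.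
by rewrite mulr_sumr; under eq_bigr do rewrite mulrA.
Qed.

Lemma absorbedD M N y z : absorbed M y -> absorbed N z ->
  absorbed (M + N) (fun t => y t + z t).
Proof.
move=> [a [ay aM]] [b [bz bN]]; exists (fun i => a i + b i); split; first exact: series_cvgD.
move=> B n; apply: nle_ext (nleD (aM B n) (bN B n)) => t _.
by under [in RHS]eq_bigr do rewrite mulrDl; rewrite big_split.
Qed.

Lemma absorbedB M N y z : absorbed M y -> absorbed N z ->
  absorbed (M + N) (fun t => y t - z t).
Proof.
move=> yM /(absorbedZ (-1)); rewrite normrN1 mul1r => /(absorbedD yM).
by under eq_fun do rewrite mulN1r.
Qed.

Lemma clspan_closed : closed_subspace (clspan x).
Proof.
split.
- move=> f /(_ _ (cspan_closed x setT)) H.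
  by have [] := H (fun n => cspan_mem (S := setT) cx (i := n) I).
- by move=> F [_ F0 _ _ _] _.
- move=> f g Ff Fg F cF Fx; have [_ _ FD _ _] := cF.
  by apply: FD; [exact: Ff|exact: Fg].
- by move=> a f Ff F cF Fx; have [_ _ _ FZ _] := cF; apply: FZ; exact: Ff.
- move=> u g uF ug F cF Fx; have [_ _ _ _ FC] := cF; apply: FC ug => n.
  exact: uF.
Qed.

Lemma clspanB y z : clspan x y -> clspan x z -> clspan x (fun t => y t - z t).
Proof.
have [_ _ FD FZ _] := clspan_closed.
move=> yx /(FZ (-1)) /(FD _ _ yx).
by under eq_fun do rewrite mulN1r.
Qed.

Lemma clspan_sum n (a : nat -> R) : clspan x (fun t => \sum_(i < n) a i * x i t).
Proof.
have [_ F0 FD FZ _] := clspan_closed; elim: n => [|n IH].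
  by under eq_fun do rewrite big_ord0.
under eq_fun do rewrite big_ord_recr.
by apply: FD => //; apply: FZ => F _; apply.
Qed.

Lemma clspan_absorbed M y : absorbed M y -> clspan x y.
Proof.
move=> [a [ay _]]; have [_ _ _ _ FC] := clspan_closed; apply: FC ay => n.
exact: clspan_sum.
Qed.

Hypothesis ux : unconditional_basic_seq x.

(** A zero term could take any coefficient in the expansion of 0. *)
Lemma ubs_nonzero i : nonzero (x i).
Proof.
apply: contrapT => z; have x0 t : x i t = 0.
  by apply/eqP; apply: contra_notT z => h; exists t.
have [_ F0 _ _ _] := clspan_closed.
have [a [_ aU]] := ux.1 _ F0.
have c0 : series_cvg (fun=> 0) x (fun=> 0).
  move=> e e0; exists 0%N => n _ t.
  by rewrite big1 ?subrr ?normr0 ?ltW // => j _; rewrite mul0r.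
have c1 : series_cvg (fun j => (j == i)%:R) x (fun=> 0).
  move=> e e0; exists 0%N => n _ t.
  rewrite big1 ?subrr ?normr0 ?ltW // => j _.
  by case: eqP => [->|]; rewrite ?x0 ?mulr0 ?mul0r.
have := aU _ c0; have := aU _ c1 => -> /(congr1 (fun f => f i)).
by rewrite eqxx => /eqP; rewrite oner_eq0.
Qed.

Lemma all_absorbed y : clspan x y -> exists M : nat, absorbed M%:R y.
Proof.
move=> yx; have [a [ay _]] := ux.1 y yx.
have [M MP] := bounded_masks (ux.2 y yx a ay).
exists (Num.bound `|M|), a; split=> // b n; apply: nleW (MP b n).
exact: le_trans (ler_norm _) (ltW (archi_boundP (normr_ge0 M))).
Qed.

(** Baire's argument: the [M]-absorbed vectors, for all [M], cover the span by [all_absorbed]. If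
    none of these sets were dense in a ball, nested balls could be chosen, the one of stage [M]
    avoiding the [M]-absorbed vectors; their common point would be absorbed by no [M]. *)
Lemma category_ball : exists (M : R) y0 r, [/\ clspan x y0, 0 < r &
  forall y, clspan x y -> nle (fun t => y t - y0 t) r -> forall d, 0 < d ->
    exists2 z, absorbed M z & nle (fun t => y t - z t) d].
Proof.
apply: contrapT => none.
pose Q (M : nat) (p q : fn R * R) := clspan x p.1 -> 0 < p.2 ->
  [/\ clspan x q.1, 0 < q.2, q.2 <= p.2 / 2, nle (fun t => q.1 t - p.1 t) (p.2 / 2) &
    forall z, absorbed M%:R z -> ~ nle (fun t => q.1 t - z t) q.2].
have [f [f0 fS]] : exists f : nat -> fn R * R,
    f 0%N = ((fun=> 0), 1) /\ forall k, Q k (f k) (f k.+1).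
  apply: dependent_choice_nat => M [y r].
  have [[yx r0]|h] := pselect (clspan x y /\ 0 < r); last first.
    by exists (y, r) => ? ?; case: h.
  have r2 : 0 < r / 2 by rewrite divr_gt0.
  have /existsNP[y' /not_implyP[y'x /not_implyP[y'y /existsNP[d /not_implyP[d0 dP]]]]] :
      ~ forall y', clspan x y' -> nle (fun t => y' t - y t) (r / 2) -> forall d, 0 < d ->
        exists2 z, absorbed M%:R z & nle (fun t => y' t - z t) d.
    by move=> h; apply: none; exists M%:R, y, (r / 2).
  exists (y', Num.min d (r / 2)) => _ _; split=> //=.
  - by rewrite lt_min d0.
  - by rewrite ge_min lexx orbT.
  - move=> z zM zd; apply: dP; exists z => //; apply: nleW zd.
    by rewrite ge_min lexx.
pose u k := (f k).1; pose r k := (f k).2.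
have fP k : clspan x (u k) /\ 0 < r k.
  elim: k => [|k [h1 h2]]; last by have [] := fS k h1 h2.
  by rewrite /u /r f0; split=> //=; have [] := clspan_closed.
have QP k := fS k (fP k).1 (fP k).2.
have rk k : r k <= 2 ^- k.
  elim: k => [|k IH]; first by rewrite /r f0 expr0 invr1.
  have [_ _ h _ _] := QP k; apply: le_trans h _.
  by rewrite exprS invfM mulrC ler_wpM2l ?invr_ge0.
have ur k j : nle (fun t => u (k + j)%N t - u k t) (r k - r (k + j)%N).
  elim: j => [|j IH]; first by move=> t _; rewrite addn0 !subrr normr0.
  have [_ _ h1 h2 _] := QP (k + j)%N.
  rewrite addnS; apply: nleW (nle_ext _ (nleD h2 IH)); last first.
    by move=> t _; rewrite addrA subrK.
  rewrite -/(r _) in h1 *; rewrite -/(r (k + j)%N); lra.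
have uk k l t : (k <= l)%N -> `|u l t - u k t| <= r k.
  move=> kl; have := ur k (l - k)%N t I; rewrite subnKC // => h.
  by apply: le_trans h _; rewrite gerBl ltW // (fP l).2.
have [||g gP] := @uniform_limit_pow2 R _ u 1.
- by [].
- move=> k l t; rewrite mul1r.
  have p0 n : 0 <= 2 ^- n :> R by rewrite invr_ge0 exprn_ge0.
  have [kl|lk] := leqP k l.
    rewrite distrC; apply: le_trans (uk k l t kl) _.
    by apply: le_trans (rk k) _; rewrite lerDl.
  apply: le_trans (uk l k t (ltnW lk)) _.
  by apply: le_trans (rk l) _; rewrite lerDr.
have gx : clspan x g.
  have [_ _ _ _ FC] := clspan_closed; apply: (FC u) => [n|e e0]; first exact: (fP n).1.
  have [N NP] := pow2_eventually ler01 e0.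
  by exists N => n Nn t; apply: le_trans (gP n t) (NP n Nn).
have [M gM] := all_absorbed gx.
have [_ _ _ _ /(_ _ gM)] := QP M; apply => t _.
apply: (@le_pow2_lim _ _ _ 1 M.+1) => // l Ml.
have := ler_normD (u M.+1 t - u l t) (u l t - g t); rewrite addrA subrK => /le_trans; apply.
by rewrite lerD // distrC; exact: uk.
Qed.

(** Differences move the ball to the origin, at the price of doubling [M]; homogeneity yields every
    scale. *)
Lemma dense_ball : exists M r, [/\ 0 <= M, 0 < r &
  forall k y, clspan x y -> nle y (r * 2 ^- k) -> forall d, 0 < d ->
    exists2 z, absorbed (M * 2 ^- k) z & nle (fun t => y t - z t) d].
Proof.
have [M [y0 [r [y0x r0 H]]]] := category_ball.
have [_ _ FD FZ _] := clspan_closed.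
have h0 y : clspan x y -> nle y r -> forall d, 0 < d ->
    exists2 z, absorbed (M + M) z & nle (fun t => y t - z t) d.
  move=> yx yr d d0; have d2 : 0 < d / 2 by rewrite divr_gt0.
  have [||z1 z1M z1d] := H (fun t => y t + y0 t) _ _ _ d2; first exact: FD.
    by apply: nle_ext yr => t _; rewrite addrK.
  have [|z2 z2M z2d] := H y0 y0x _ _ d2.
    by move=> t _; rewrite subrr normr0 ltW.
  exists (fun t => z1 t - z2 t); first exact: absorbedB.
  rewrite [d]splitr; apply: nle_ext (nleB z1d z2d) => t _; ring.
exists (M + M), r; split=> //.
  have [_ F0 _ _ _] := clspan_closed.
  have [|z [a [_ aM]] _] := h0 _ F0 _ 1 ltr01; first by move=> t _; rewrite normr0 ltW.
  exact: nle_nonneg (aM xpredT 0%N).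
move=> k y yx yr d d0.
have p0 : 0 < 2 ^+ k :> R by rewrite exprn_gt0.
have [|||z zM zd] := h0 (fun t => 2 ^+ k * y t) _ _ (2 ^+ k * d).
- exact: FZ.
- apply: nleW (nleZ _ yr); by rewrite gtr0_norm // mulrCA mulfV ?mulr1 // gt_eqF.
- by rewrite mulr_gt0.
exists (fun t => 2 ^- k * z t).
  have := absorbedZ (2 ^- k) zM; rewrite gtr0_norm ?invr_gt0 //.
  by rewrite mulrC.
apply: nleW (nle_ext _ (nleZ (2 ^- k) zd)).
  by rewrite gtr0_norm ?invr_gt0 // mulKf // gt_eqF.
by move=> t _; rewrite mulrBr mulKf // gt_eqF.
Qed.

(* The open mapping argument: successive approximation by elements of [dense_ball]. *)
Lemma ball_absorbed : exists M r, [/\ 0 <= M, 0 < r &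
  forall y, clspan x y -> nle y r -> absorbed M y].
Proof.
have [M [r [M0 r0 H]]] := dense_ball.
exists (2 * M), r; split=> //; first by rewrite mulr_ge0.
move=> y yx yr.
have [_ F0 FD FZ _] := clspan_closed.
have p0 k : 0 < 2 ^- k :> R by rewrite invr_gt0 exprn_gt0.
pose Q (k : nat) (v w : fn R) := clspan x v -> nle v (r * 2 ^- k) ->
  [/\ clspan x w, nle w (r * 2 ^- k.+1) & absorbed (M * 2 ^- k) (fun t => v t - w t)].
have [w [w0 wS]] : exists w : nat -> fn R, w 0%N = y /\ forall k, Q k (w k) (w k.+1).
  apply: dependent_choice_nat => k v.
  have [[vx vr]|h] := pselect (clspan x v /\ nle v (r * 2 ^- k)); last first.
    by exists v => ? ?; case: h.
  have [|z zM zd] := H k v vx vr (r * 2 ^- k.+1); first by rewrite mulr_gt0.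
  exists (fun t => v t - z t) => _ _; split=> //.
    exact: clspanB vx (clspan_absorbed zM).
  by under eq_fun do rewrite opprB addrC subrK.
have wP k : clspan x (w k) /\ nle (w k) (r * 2 ^- k).
  elim: k => [|k [h1 h2]]; last by have [] := wS k h1 h2.
  by rewrite w0 expr0 invr1 mulr1.
have /choice[al alP] : forall k, exists a, series_cvg a x (fun t => w k t - w k.+1 t) /\
    forall (b : pred nat) n, nle (fun t => \sum_(0 <= i < n | b i) a i * x i t) (M * 2 ^- k).
  by move=> k; have [h1 h2] := wP k; have [_ _ [a ?]] := wS k h1 h2; exists a.
pose s m i := \sum_(0 <= k < m) al k i.
have sdiff m l (b : pred nat) n : (m <= l)%N ->
    nle (fun t => \sum_(0 <= i < n | b i) (s l i - s m i) * x i t) (2 * M * 2 ^- m).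
  move=> ml t _.
  have -> : \sum_(0 <= i < n | b i) (s l i - s m i) * x i t =
      \sum_(m <= k < l) \sum_(0 <= i < n | b i) al k i * x i t.
    rewrite exchange_big; apply: eq_bigr => i _ /=.
    by rewrite /s (big_cat_nat (n := m)) //= addrAC subrr add0r mulr_suml.
  apply: le_trans (ler_norm_sum _ _ _) _.
  apply: (@le_trans _ _ (\sum_(m <= k < l) M * 2 ^- k)).
    by apply: ler_sum => k _; exact: (alP k).2.
  by rewrite -mulr_sumr [2 * M]mulrC -mulrA ler_wpM2l // geometric_tail.
have /choice[tt ttP] : forall i, exists t, x i t != 0.
  by move=> i; have [t _ ?] := ubs_nonzero i; exists t.
pose C i := 2 * M / `|x i (tt i)|.
have C0 i : 0 <= C i by rewrite divr_ge0 // mulr_ge0.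
have sC m l i : (m <= l)%N -> `|s l i - s m i| <= C i * 2 ^- m.
  move=> ml; have := sdiff m l (pred1 i) i.+1 ml (tt i) I.
  rewrite big_mkcond big_nat_recr //= eqxx big_nat big1 ?add0r.
    by rewrite normrM => h; rewrite /C [_ / _ * _]mulrAC ler_pdivlMr ?normr_gt0.
  by move=> j /andP[_ ji]; rewrite ltn_eqF.
have /choice[a aP] : forall i, exists z, forall m, `|s m i - z| <= C i * 2 ^- m.
  move=> i; apply: (cauchy_pow2 (u := fun m => s m i)) => // k l.
  have [kl|lk] := leqP k l.
    rewrite distrC; apply: le_trans (sC k l i kl) _.
    by rewrite ler_wpM2l // lerDl ltW.
  apply: le_trans (sC l k i (ltnW lk)) _.
  by rewrite ler_wpM2l // lerDr ltW.
have adiff m (b : pred nat) n :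
    nle (fun t => \sum_(0 <= i < n | b i) (a i - s m i) * x i t) (2 * M * 2 ^- m).
  move=> t _; pose D := \sum_(0 <= i < n | b i) C i * `|x i t|.
  have D0 : 0 <= D by apply: sumr_ge0 => i _; rewrite mulr_ge0.
  apply: (@le_pow2_lim _ _ _ D m) => // l ml.
  have -> : \sum_(0 <= i < n | b i) (a i - s m i) * x i t =
      \sum_(0 <= i < n | b i) (s l i - s m i) * x i t +
      \sum_(0 <= i < n | b i) (a i - s l i) * x i t.
    by rewrite -big_split; apply: eq_bigr => i _ /=; ring.
  apply: le_trans (ler_normD _ _) _; apply: lerD; first exact: sdiff.
  rewrite (le_trans (ler_norm_sum _ _ _)) // /D mulr_suml ler_sum // => i _.
  by rewrite normrM mulrAC ler_wpM2r // distrC.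
exists a; split; last first.
  move=> b n; have := adiff 0%N b n; rewrite expr0 invr1 mulr1.
  by apply: nle_ext => t _; apply: eq_bigr => i _; rewrite /s big_geq // subr0.
have scvg m : series_cvg (s m) x (fun t => y t - w m t).
  elim: m => [|m IH].
    move=> e e0; exists 0%N => n _ t; rewrite w0 subrr big1 ?subr0 ?normr0 ?ltW // => i _.
    by rewrite /s big_geq // mul0r.
  have := series_cvgD IH (alP m).1.
  have -> : (fun i => s m i + al m i) = s m.+1.
    by apply/funext => i; rewrite /s big_nat_recr.
  by under eq_fun do rewrite addrA subrK.
apply/series_cvgE => e e0; have e2 : 0 < e / 2 by rewrite divr_gt0.
have Mr : 0 <= 2 * M + r by rewrite addr_ge0 ?mulr_ge0 // ltW.
have [m mP] := pow2_eventually Mr e2.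
have /series_cvgE/(_ _ e2)[N NP] := scvg m.
exists N => n Nn; apply: nleW (nle_ext _ (nleB (nleD (adiff m xpredT n) (NP n Nn)) (wP m).2)).
  by have := mP m (leqnn m); lra.
move=> t _; have -> : \sum_(0 <= i < n) a i * x i t =
    \sum_(0 <= i < n) (a i - s m i) * x i t + \sum_(0 <= i < n) s m i * x i t.
  by rewrite -big_split; apply: eq_bigr => i _ /=; ring.
by ring.
Qed.

(** A finite sum scaled into the ball of [ball_absorbed] is absorbed, and by uniqueness its
    absorbing expansion is the finite sum itself. *)
Lemma uncond_of_ubs : exists K, uncond K x.
Proof.
have [M [r [M0 r0 H]]] := ball_absorbed.
exists (M / r) => b n a c ac t _.
have [_ F0 FD FZ _] := clspan_closed.
have c0 := nle_nonneg ac.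
(* Scaling by [c + 2 ^- k] in place of [c] covers the case [c = 0]. *)
apply: (@le_pow2_lim _ _ _ (M / r) 0%N) => [|k _]; first by rewrite divr_ge0 // ltW.
have p0 : 0 < 2 ^- k :> R by rewrite invr_gt0 exprn_gt0.
have ck : 0 < c + 2 ^- k by rewrite ltr_wpDl.
pose l := r / (c + 2 ^- k); have l0 : 0 < l by rewrite divr_gt0.
pose y t := l * \sum_(0 <= i < n) a i * x i t.
have yx : clspan x y.
  by apply: FZ; under eq_fun do rewrite big_mkord; exact: clspan_sum.
have yr : nle y r.
  apply: nleW (nleZ l ac); rewrite gtr0_norm // /l mulrAC ler_pdivrMr //.
  by rewrite ler_wpM2l ?(ltW r0) // lerDl ltW.
have [a' [a'y a'M]] := H y yx yr.
have E : (fun i => if (i < n)%N then l * a i else 0) = a'.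
  have [a0 [_ aU]] := ux.1 y yx; rewrite -(aU _ a'y); symmetry; apply: aU.
  apply/series_cvgE => e e0; exists n => m nm u _.
  have -> : \sum_(0 <= i < m) (if (i < n)%N then l * a i else 0) * x i u = y u.
    rewrite (big_cat_nat (n := n)) //= [X in _ + X]big_nat [X in _ + X]big1 ?addr0.
      by rewrite /y mulr_sumr; apply: eq_big_nat => i /andP[_ ->]; rewrite mulrA.
    by move=> i /andP[ni _]; rewrite ltnNge ni mul0r.
  by rewrite subrr normr0 ltW.
have := a'M b n t I; rewrite -E.
rewrite (_ : \sum_(0 <= i < n | b i) _ = l * \sum_(0 <= i < n | b i) a i * x i t).
  rewrite normrM gtr0_norm // -ler_pdivlMl // => /le_trans; apply.
  rewrite /l invf_div; set p := 2 ^- k; rewrite (_ : _ * M = M / r * c + M / r * p) //; ring.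
rewrite mulr_sumr big_nat_cond [RHS]big_nat_cond.
by apply: eq_bigr => i /andP[/andP[_ ->] _]; rewrite mulrA.
Qed.

End basis_constant.

(** * Embedding into C(Delta) *)

Section retraction.
Variables (C : set (nat -> bool)) (c0 : nat -> bool).
Hypothesis Cc0 : C c0.

Definition extendable (s : seq bool) := exists2 c, C c & agree (size s) c (prefix_ext s).

(** Every bit depends only on the bits of [t] up to it, which gives continuity, and a bit is flipped
    only when no point of [C] follows it, so points of [C] stay fixed. *)
Fixpoint retract_prefix (t : nat -> bool) n : seq bool :=
  if n is n'.+1 then
    let s := retract_prefix t n' in
    rcons s (if `[< extendable (rcons s (t n')) >] then t n' else ~~ t n')
  else [::].

(* The retraction of the Cantor space onto the closure of [C]. *)
Definition retract (t : nat -> bool) : nat -> bool :=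
  fun n => nth false (retract_prefix t n.+1) n.

Lemma size_retract_prefix t n : size (retract_prefix t n) = n.
Proof. by elim: n => //= n IH; rewrite size_rcons IH. Qed.

Lemma retract_prefixE t n : agree n (retract t) (prefix_ext (retract_prefix t n)).
Proof.
elim: n => [//|n IH] i; rewrite ltnS leq_eqVlt => /predU1P[->//|il].
rewrite IH // /prefix_ext [retract_prefix t n.+1]/= nth_rcons.
by rewrite size_retract_prefix il.
Qed.

Lemma extendable_retract t n : extendable (retract_prefix t n).
Proof.
elim: n => [|n IH] /=; first by exists c0.
case: asboolP => // nh; have [c Cc cE] := IH.
have ext b : c n = b -> extendable (rcons (retract_prefix t n) b).
  move=> cn; exists c => // i; rewrite size_rcons size_retract_prefix ltnS leq_eqVlt.
  rewrite /prefix_ext nth_rcons size_retract_prefix.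
  move=> /predU1P[->|il]; rewrite ?ltnn ?eqxx // il; apply: cE.
  by rewrite size_retract_prefix.
have cn : c n != t n by apply/eqP => /ext.
by apply: ext; case: (c n) (t n) cn => [] [].
Qed.

Lemma retract_approx t n : exists2 c, C c & agree n (retract t) c.
Proof.
have [c Cc cE] := extendable_retract t n; exists c => // i il.
by rewrite (retract_prefixE _ il) // -cE // size_retract_prefix.
Qed.

Lemma retract_agree n t u : agree n t u -> agree n (retract t) (retract u).
Proof.
move=> tu; have E k : (k <= n)%N -> retract_prefix t k = retract_prefix u k.
  by elim: k => //= k IH kn; rewrite IH ?tu // ltnW.
by move=> i il; rewrite /retract E.
Qed.

Lemma retract_id c : C c -> retract c = c.
Proof.
move=> Cc; have E n : retract_prefix c n = mkseq c n.
  elim: n => // n IH; rewrite [LHS]/= IH mkseqS; case: asboolP => // h; case: h.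
  exists c => // i; rewrite size_rcons size_mkseq ltnS => il.
  by rewrite /prefix_ext -mkseqS nth_mkseq.
by apply/funext => n; rewrite /retract E nth_mkseq.
Qed.

End retraction.

(** * Numbers coded by the position of the first set bit *)

Section dyadic_value.
Variable R : realType.

Definition dyadic (d : nat -> bool) : R :=
  match pselect (exists k, d k) with
  | left h => 2 ^- ex_minn h
  | right _ => 0
  end.

Lemma dyadic_ge0 d : 0 <= dyadic d.
Proof. by rewrite /dyadic; case: pselect => // h; rewrite invr_ge0 exprn_ge0. Qed.

Lemma dyadic_small (d : nat -> bool) N : (forall k, (k < N)%N -> ~~ d k) -> dyadic d <= 2 ^- N.
Proof.
move=> dN; rewrite /dyadic; case: pselect => [h|_]; last by rewrite invr_ge0 exprn_ge0.
case: ex_minnP => k dk _; rewrite lef_pV2 ?posrE ?exprn_gt0 // ler_eXn2l ?ltr1n //.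
by rewrite leqNgt; apply/negP => /dN; rewrite dk.
Qed.

Lemma dyadic_first (d : nat -> bool) k :
  d k -> (forall j, (j < k)%N -> ~~ d j) -> dyadic d = 2 ^- k.
Proof.
move=> dk dj; rewrite /dyadic; case: pselect => [h|]; last by case; exists k.
case: ex_minnP => l dl lmin; congr (2 ^- _); apply/eqP; rewrite eqn_leq lmin //=.
by rewrite leqNgt; apply/negP => /dj; rewrite dl.
Qed.

Lemma dyadic_agree N d e : agree N d e -> `|dyadic d - dyadic e| <= 2 ^- N.
Proof.
move=> de; have [[k /andP[kN dk]]|none] := pselect (exists k, (k < N)%N && d k).
  have ex : exists k, d k by exists k.
  case: (ex_minnP ex) => l dl lmin.
  have lN : (l < N)%N by exact: leq_ltn_trans (lmin _ dk) kN.
  have first j : (j < l)%N -> ~~ d j by rewrite ltnNge; apply: contra => /lmin.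
  rewrite (dyadic_first dl first) (dyadic_first (d := e) (k := l)) ?subrr ?normr0 //.
  - by rewrite -de.
  - by move=> j jl; rewrite -de ?first // (ltn_trans jl).
have dN k : (k < N)%N -> ~~ d k.
  by move=> kN; apply: contra_notN none => dk; exists k; rewrite kN.
have h1 := dyadic_small dN.
have h2 : dyadic e <= 2 ^- N by apply: dyadic_small => k kN; rewrite -de ?dN.
have := dyadic_ge0 d; have := dyadic_ge0 e.
by rewrite ler_norml => *; apply/andP; split; lra.
Qed.

End dyadic_value.

(** * The norming functionals as points of the Cantor set *)

Section embedding.
Variable R : realType.

Definition position (s : seq nat) (k : nat) : nat := pickle (s, k).

(** All values of [t] are recorded at once; [dyadic] recovers the value at [s] from the bits at the
    positions of [s]. *)
Definition code (t : term) : nat -> bool := fun i =>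
  if unpickle i is Some (s, k) then ev R t s == 2 ^- k else false.

Definition codes : set (nat -> bool) := [set code t | t in valid].

(* The isometric copy in C(Delta) of the vector [ev^~ s]. *)
Definition embed (s : seq nat) : fn R := fun tau =>
  dyadic R (fun k => retract codes tau (position s k)).

Lemma code_position t s k : code t (position s k) = (ev R t s == 2 ^- k).
Proof. by rewrite /code /position pickleK. Qed.

Lemma dyadic_code t s : valid t -> dyadic R (fun k => code t (position s k)) = ev R t s.
Proof.
have inj k l : ((2 ^- k : R) == 2 ^- l) = (k == l).
  by rewrite (inj_eq invr_inj); apply: (inj_eq (ieexprIn _ _)); rewrite // (eqr_nat R 2 1).
move=> /(ev_dyadic R s)[E|[k E]].
  rewrite E /dyadic; case: pselect => // h; exfalso; case: h => k.
  rewrite code_position E.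
  by rewrite eq_sym invr_eq0 expf_eq0 pnatr_eq0 andbF.
rewrite E; apply: dyadic_first; first by rewrite code_position E.
by move=> j jk; rewrite code_position E inj gtn_eqF.
Qed.

Lemma embed_code t s : valid t -> embed s (code t) = ev R t s.
Proof.
by move=> vt; rewrite /embed retract_id ?dyadic_code //; exists t.
Qed.

Lemma codes_At : codes (code (At 0)). Proof. by exists (At 0). Qed.

Lemma cont_embed s : cont (embed s).
Proof.
apply/contP => t e e0; have [M Me] := pow2_small e0.
exists (\max_(k < M) position s k).+1 => u tu.
apply: le_trans (ltW Me); apply: dyadic_agree => k kM.
apply: (@retract_agree codes _ _ _ tu); rewrite ltnS; exact: (leq_bigmax (Ordinal kM)).
Qed.

(** The retraction takes its values in the closure of the codes, so on finitely many unit vectors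
    the points that are not codes add nothing to a supremum. *)
Lemma embed_approx (ss : seq (seq nat)) tau k : exists2 t, valid t &
  forall s, s \in ss -> `|embed s tau - ev R t s| <= 2 ^- k.
Proof.
pose N := (\max_(s <- ss) \max_(j < k) position s j).+1.
have [_ [t vt <-] tE] := retract_approx codes_At tau N.
exists t => // s sss; rewrite -(dyadic_code s vt).
apply: dyadic_agree => j jk; apply: tE; rewrite ltnS.
apply: leq_trans (leq_bigmax_seq (F := fun s => \max_(j < k) position s j) s sss isT).
exact: (leq_bigmax (Ordinal jk)).
Qed.

Notation evs := (fun s => (ev R)^~ s).

Lemma nle_embed l c : nle [set: cantor_space] (comb embed l) c <->
  nle valid (comb evs l) c.
Proof.
split=> H t Dt.
  have := H (code t) I; rewrite /comb.
  by under eq_bigr do rewrite embed_code //.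
pose D := \sum_(p <- l) `|p.1|.
apply: (@le_pow2_lim _ _ _ D 0%N) => [|k _]; first exact: sumr_ge0.
have [g vg gP] := embed_approx [seq p.2 | p <- l] t k.
have h : `|comb embed l t - comb evs l g| <= D * 2 ^- k.
  rewrite /comb -sumrB (le_trans (ler_norm_sum _ _ _)) // /D mulr_suml.
  rewrite big_seq [leRHS]big_seq ler_sum // => p pl.
  by rewrite -mulrBr normrM ler_wpM2l // gP // map_f.
have := ler_normD (comb evs l g) (comb embed l t - comb evs l g).
have := H g vg; rewrite addrC subrK; lra.
Qed.

Definition lincomb (b : pred nat) n (a : nat -> R) (l : nat -> seq (R * seq nat)) :=
  flatten [seq [seq (a i * p.1, p.2) | p <- l i] | i <- index_iota 0 n & b i].

Lemma comb_lincomb T (E : seq nat -> T -> R) b n a l t :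
  \sum_(0 <= i < n | b i) a i * comb E (l i) t = comb E (lincomb b n a l) t.
Proof.
rewrite -big_filter /comb /lincomb; elim: [seq _ <- _ | _] => [|i r IH].
  by rewrite !big_nil.
rewrite big_cons IH /= big_cat big_map /=; congr (_ + _).
by rewrite mulr_sumr; apply: eq_bigr => p _; rewrite mulrA.
Qed.

Lemma uncond_embed K (l : nat -> seq (R * seq nat)) :
  uncond [set: cantor_space] K (fun i => comb embed (l i)) <->
  uncond valid K (fun i => comb evs (l i)).
Proof.
split=> H b n a c ac.
  apply: nle_ext (_ : nle valid (comb evs (lincomb b n a l)) _) => [t _|].
    by rewrite comb_lincomb.
  apply/nle_embed; apply: nle_ext (H b n a c _) => [t _|]; first by rewrite comb_lincomb.
  apply: nle_ext (_ : nle _ (comb embed (lincomb xpredT n a l)) _) => [t _|].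
    by rewrite comb_lincomb.
  by apply/nle_embed; apply: nle_ext ac => t _; rewrite comb_lincomb.
apply: nle_ext (_ : nle _ (comb embed (lincomb b n a l)) _) => [t _|].
  by rewrite comb_lincomb.
apply/nle_embed; apply: nle_ext (H b n a c _) => [t _|]; first by rewrite comb_lincomb.
apply: nle_ext (_ : nle _ (comb evs (lincomb xpredT n a l)) _) => [t _|].
  by rewrite comb_lincomb.
by apply/nle_embed; apply: nle_ext ac => t _; rewrite comb_lincomb.
Qed.

Definition tree_space (T : set (seq nat)) : SB R :=
  exist _ (cspan embed T) (cspan_closed embed T).

Lemma tree_space_branch (T : set (seq nat)) (sg : nat -> nat) :
  (forall k, T (mkseq sg k)) -> C_UB (tree_space T).
Proof.
move=> Tsg; exists (fun k => embed (mkseq sg k.+1)); split.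
  by move=> n; apply: cspan_mem => //; exact: cont_embed.
apply: (@ubs_of_uncond _ _ 1) => //.
- by move=> n; exact: cont_embed.
- move=> n; have [t vt tn] := @branch_nonzero R sg n.
  by exists (code t) => //; rewrite embed_code.
- pose l k : seq (R * seq nat) := [:: (1, mkseq sg k.+1)].
  have [_ H] := uncond_embed 1 l.
  rewrite (_ : (fun k => embed _) = fun i => comb embed (l i)).
    apply: H; rewrite (_ : (fun i => comb evs (l i)) = fun k t => ev R t (mkseq sg k.+1)).
      exact: branch_uncond.
    by apply/funext => i; apply/funext => t; rewrite /comb big_seq1 mul1r.
  by apply/funext => i; apply/funext => t; rewrite /comb big_seq1 mul1r.
Qed.

(** The sequence is first perturbed to finite combinations of unit vectors, since [uncond_embed]
    transports only these back to the norm on terms. *)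
Lemma branch_tree_space (T : set (seq nat)) : (forall s n, T (rcons s n) -> T s) ->
  C_UB (tree_space T) -> exists sg : nat -> nat, forall k, T (mkseq sg k).
Proof.
move=> Tp [x [xT ux]]; apply: (@branch_of_uncond R) => // nT.
have cx n : cont (x n) by case: (xT n).
have [K uK] := uncond_of_ubs cx ux.
have uK' : uncond [set: cantor_space] `|K| x by apply: uncond_le uK; exact: ler_norm.
have nx := ubs_nonzero cx ux.
have /choice[lam lamP] : forall n, exists lam : R,
    exists2 t, [set: cantor_space] t & 1 <= `|lam * x n t|.
  move=> n; have [t _ xt] := nx n; exists (x n t)^-1, t => //.
  by rewrite mulVf // normr1.
have u1 := uncond_scale (l := lam) uK'.
pose d : R := (4 * (`|K| + 1))^-1.
have K1 : 0 < `|K| + 1 by rewrite ltr_pwDr.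
have d0 : 0 < d by rewrite invr_gt0 mulr_gt0.
have dK : 4 * d * `|K| <= 1.
  have : d * (4 * (`|K| + 1)) = 1 by rewrite mulVf // gt_eqF // mulr_gt0.
  by lra.
have /choice[l lP] : forall n, exists l : seq (R * seq nat), (forall p, p \in l -> T p.2) /\
    nle [set: cantor_space] (fun t => lam n * x n t - comb embed l t) (d * 2 ^- n).
  move=> n; have [_ _ _ FZ _] := cspan_closed embed T.
  have [_ /(_ (d * 2 ^- n))] := FZ (lam n) _ (xT n); apply.
  by rewrite mulr_gt0 // invr_gt0 exprn_gt0.
have uw := uncond_perturb u1 (normr_ge0 K) (ltW d0) dK lamP (fun n => (lP n).2).
have /uncond_embed uv := uw.
apply: (nT _ _ _ _ uv) => n.
  by exists (l n); split=> //; exact: (lP n).1.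
apply: contrapT => z; have [t _ t1] := lamP n.
have w0 : nle valid (comb evs (l n)) 0.
  move=> g vg; rewrite normr_le0; apply: contrapT => h.
  by apply: z; exists g => //; apply/negP.
have := (lP n).2 t I; have /nle_embed/(_ t I) := w0.
rewrite normr_le0 => /eqP ->; rewrite subr0; apply/negP; rewrite -ltNge.
apply: lt_le_trans t1; apply: (@le_lt_trans _ _ d).
  by rewrite ler_piMr ?(ltW d0) // invf_le1 ?exprn_gt0 // exprn_ege1 // ler1n.
rewrite /d invf_lt1 ?mulr_gt0 //; have := normr_ge0 K; lra.
Qed.

End embedding.

(** * Analytic sets as sets of ill-founded trees *)

Section sigma_algebras.
Context {T : Type} (S : set (set T)).
Hypothesis sS : sigma_algebra setT S.

Lemma sigmaC A : S A -> S (~` A).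
Proof. by have [_ h _] := sS; rewrite -setTD; exact: h. Qed.

Lemma sigma_exists (A : nat -> set T) : (forall n, S (A n)) -> S [set x | exists n, A n x].
Proof.
move=> SA; have [_ _ /(_ _ SA)] := sS; congr S; apply/seteqP; split=> x.
  by move=> [n _ An]; exists n.
by move=> [n An]; exists n.
Qed.

Lemma sigma_forall (A : nat -> set T) : (forall n, S (A n)) -> S [set x | forall n, A n x].
Proof.
move=> SA; have := sigmaC (sigma_exists (fun n => sigmaC (SA n))).
congr S; apply/seteqP; split=> x /=.
  by move=> h n; apply: contrapT => nA; apply: h; exists n.
by move=> h [n]; apply.
Qed.

Lemma sigma_cst (P : Prop) : S [set _ | P].
Proof.
have [S0 _ _] := sS; have [p|np] := pselect P.
  have := sigmaC S0; rewrite setC0; congr S.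
  by apply/seteqP; split.
by move: S0; congr S; apply/seteqP; split.
Qed.

Lemma sigma_exists_count (I : countType) (A : I -> set T) : (forall i, S (A i)) ->
  S [set x | exists i, A i x].
Proof.
move=> SA; rewrite (_ : mkset _ = [set x | exists n : nat,
    (if unpickle n is Some i then A i else set0) x]).
  by apply: sigma_exists => n; case: unpickle => //; have [] := sS.
apply/seteqP; split=> x /=; first by move=> [i Ai]; exists (pickle i); rewrite pickleK.
by move=> [n]; case: unpickle => // i Ai; exists i.
Qed.

Lemma sigma_and A B : S A -> S B -> S [set x | A x /\ B x].
Proof.
move=> SA SB; rewrite (_ : mkset _ = [set x | forall n : nat,
    (if n == 0%N then A else B) x]).
  by apply: sigma_forall => -[|n].
apply/seteqP; split=> x /=; first by move=> [Ax Bx] [|n].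
by move=> h; split; [exact: (h 0%N)|exact: (h 1%N)].
Qed.

Lemma sigma_cst_imp (P : Prop) A : (P -> S A) -> S [set x | P -> A x].
Proof.
have [p SA|np _] := pselect P.
  by move: (SA p); congr S; apply/seteqP; split=> x /=; auto.
by move: (sigma_cst True); congr S; apply/seteqP; split=> // x _ p; case: (np p).
Qed.

Lemma sigma_imp A B : S A -> S B -> S [set x | A x -> B x].
Proof.
move=> SA SB; have := sigmaC (sigma_and SA (sigmaC SB)); congr S.
apply/seteqP; split=> x /=; last by move=> h [Ax]; apply; exact: h.
by move=> h Ax; apply: contrapT => nB; apply: h.
Qed.

End sigma_algebras.

Lemma borel_map_gen (X Y : Type) (SX : set (set X)) (G : set (set Y)) (f : X -> Y) :
  sigma_algebra setT SX -> (forall B, G B -> SX (f @^-1` B)) -> borel_map SX <<s G>> f.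
Proof.
move=> sX fG B; apply: (smallest_sub (X := [set B | SX (f @^-1` B)])) => //.
split=> /=.
- by rewrite preimage_set0; have [] := sX.
- by move=> A SA; rewrite setTD preimage_setC; exact: sigmaC.
- move=> A SA; rewrite preimage_bigcup; have [_ _] := sX; apply; exact: SA.
Qed.

(** * Borel sets as projections of closed sets *)

Section metric_spaces.
Context {R : realType} {Z : Type} (d : Z -> Z -> R).
Hypothesis md : is_metric d.

Lemma dist_nonneg x y : 0 <= d x y. Proof. by case: md. Qed.
Lemma dist_refl x : d x x = 0. Proof. by case: md => _ h _ _; exact/h. Qed.
Lemma dist_symm x y : d x y = d y x. Proof. by case: md. Qed.
Lemma dist_triangle y x z : d x z <= d x y + d y z. Proof. by case: md. Qed.

Lemma separable_code : metric_separable d -> exists (f : Z -> nat) (D : set Z),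
  (forall x y, D x -> D y -> f x = f y -> x = y) /\
  forall x e, 0 < e -> exists2 y, D y & d x y < e.
Proof.
move=> [D [/countable_injP[f fI] Dd]]; exists f, D; split=> // x y Dx Dy.
by apply: fI; rewrite inE.
Qed.

Definition jointly_closed (C : (nat -> nat) -> Z -> Prop) := forall al z, ~ C al z ->
  exists N e, 0 < e /\ forall al' z', (forall i, (i < N)%N -> al i = al' i) ->
    d z z' < e -> ~ C al' z'.

(* Projections to [Z] of closed subsets of (nat -> nat) * Z. *)
Definition souslin (A : set Z) := exists C, jointly_closed C /\
  forall z, A z <-> exists al, C al z.

Lemma souslin_open U : metric_open d U -> souslin U.
Proof.
move=> oU; exists (fun al z => forall z', d z z' < 2 ^- al 0%N -> U z'); split.
  move=> al z /existsNP[w /not_implyP[zw nUw]].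
  exists 1%N, (2 ^- al 0%N - d z w); split; first by rewrite subr_gt0.
  move=> al' z' E zz' H; apply: nUw; apply: H; rewrite -E //.
  have := dist_triangle z z' w; rewrite (dist_symm z' z); lra.
move=> z; split=> [Uz|[al]]; last by apply; rewrite dist_refl invr_gt0 exprn_gt0.
have [e e0 eU] := oU z Uz; have [n ne] := pow2_small e0.
by exists (fun=> n) => z' /lt_trans/(_ ne)/eU.
Qed.

Lemma souslin_openC U : metric_open d U -> souslin (~` U).
Proof.
move=> oU; exists (fun _ z => ~ U z); split.
  move=> al z /contrapT Uz; have [e e0 eU] := oU z Uz.
  by exists 0%N, e; split=> // _ z' _ /eU Uz'; apply.
by move=> z; split=> [|[]] //; exists (fun=> 0%N).
Qed.

Definition fiber (n : nat) (al : nat -> nat) : nat -> nat := fun j => al (pickle (n, j)).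

Lemma fiber_surj (al : nat -> nat -> nat) : exists be, forall n, fiber n be = al n.
Proof.
exists (fun k => if unpickle k is Some (n, j) then al n j else 0%N) => n.
by apply/funext => j; rewrite /fiber pickleK.
Qed.

Lemma jointly_closed_fiber n C : jointly_closed C ->
  jointly_closed (fun al z => C (fiber n al) z).
Proof.
move=> cC al z /cC[N [e [e0 H]]].
exists (\max_(j < N) pickle (n, nat_of_ord j)).+1, e; split=> // al' z' E.
apply: H => j jN; apply: E; rewrite ltnS.
exact: (leq_bigmax (F := fun j : 'I_N => pickle (n, nat_of_ord j)) (Ordinal jN)).
Qed.

Lemma souslin_bigcap (A : nat -> set Z) : (forall n, souslin (A n)) ->
  souslin [set z | forall n, A n z].
Proof.
move=> /choice[C CP]; exists (fun al z => forall n, C n (fiber n al) z); split.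
  move=> al z /existsNP[n nC].
  have [N [e [e0 H]]] := jointly_closed_fiber (CP n).1 nC.
  by exists N, e; split=> // al' z' E zz' h; apply: (H al' z').
move=> z; split=> [Az|[al Cal] n]; last by apply/(CP n).2; exists (fiber n al).
have /choice[al alP] : forall n, exists al, C n al z by move=> n; apply/(CP n).2; exact: Az.
by have [be beE] := fiber_surj al; exists be => n; rewrite beE.
Qed.

(** The first entry of the sequence names a member of the union, the rest is a witness for that
    member. *)
Lemma souslin_bigcup (A : nat -> set Z) : (forall n, souslin (A n)) ->
  souslin [set z | exists n, A n z].
Proof.
move=> /choice[C CP]; exists (fun al z => C (al 0%N) (fiber 0 (al \o S)) z); split.
  move=> al z nC; have [N [e [e0 H]]] := jointly_closed_fiber (CP (al 0%N)).1 nC.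
  exists N.+1, e; split=> // al' z' E zz'; rewrite -E //.
  by apply: (H (al' \o S)) => // i iN; exact: (E i.+1).
move=> z; split=> [[n /(CP n).2[al Cal]]|[al Cal]].
  have [be beE] := fiber_surj (fun=> al).
  by exists (fun k => if k is k'.+1 then be k' else n); rewrite /= -/(be \o id) beE.
by exists (al 0%N); apply/(CP _).2; exists (fiber 0 (al \o S)).
Qed.

(** The class of Souslin sets is not closed under complements, so the induction carries each set
    together with its complement. *)
Lemma borel_souslin A : <<s [set U | metric_open d U]>> A -> souslin A.
Proof.
move=> bA; suff [] : souslin A /\ souslin (~` A) by [].
move: A bA; apply: smallest_sub => [|U oU]; last first.
  by split; [exact: souslin_open|exact: souslin_openC].
split=> /=.
- have o0 : metric_open d set0 by [].
  by split; [exact: souslin_open|exact: souslin_openC].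
- by move=> A [h1 h2]; rewrite setTD setCK.
- move=> A SA; split.
    have := souslin_bigcup (fun n => (SA n).1); congr souslin.
    by apply/seteqP; split=> z [n]; [exists n|move=> _; exists n].
  have := souslin_bigcap (fun n => (SA n).2); congr souslin.
  apply/seteqP; split=> z /= H; first by move=> [n _]; exact: H.
  by move=> n An; apply: H; exists n.
Qed.

End metric_spaces.

(** * The tree of approximations to a preimage *)

Section tree_of_analytic.
Context {R : realType} {Y Z : Type} (dY : Y -> Y -> R) (d : Z -> Z -> R).
Hypotheses (mY : is_metric dY) (sepY : metric_separable dY).
Hypotheses (mZ : is_metric d) (compZ : metric_complete d) (sepZ : metric_separable d).
Notation SY := (<<s [set U | metric_open dY U]>>).
Notation SZ := (<<s [set U | metric_open d U]>>).
Variable g : Z -> Y.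
Hypothesis bg : borel_map SZ SY g.

Definition decode (n : nat) : nat * nat := odflt (0%N, 0%N) (unpickle n).

Lemma decode_pickle (p : nat * nat) : decode (pickle p) = p.
Proof. by rewrite /decode pickleK. Qed.

(** Balls about the points of a countable dense set, [n] coding the centre and the radius; the ball
    is empty when no centre has that code. *)
Lemma countable_base : exists U : nat -> set Y,
  (forall n, metric_open dY (U n)) /\ forall y y', (forall n, U n y -> U n y') ->
    y = y'.
Proof.
have [f [D [fI Dd]]] := separable_code sepY.
exists (fun n y => exists c, [/\ D c, f c = (decode n).1 & dY c y < 2 ^- (decode n).2]).
split.
  move=> n y [c [Dc fc cy]]; exists (2 ^- (decode n).2 - dY c y); first by rewrite subr_gt0.
  move=> z yz; exists c; split=> //.
  have := dist_triangle mY y c z; lra.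
move=> y y' H; case: (mY) => _ h0 _ _; apply/h0/eqP.
rewrite eq_le (dist_nonneg mY) andbT.
apply: (@le_pow2_lim _ _ _ 2 0%N) => // k _.
have e0 : 0 < 2 ^- k :> R by rewrite invr_gt0 exprn_gt0.
have [c Dc yc] := Dd y _ e0.
have [|c' [Dc' fc' cy']] := H (pickle (f c, k)).
  by exists c; rewrite decode_pickle; split=> //; rewrite (dist_symm mY).
move: fc' cy'; rewrite !decode_pickle /= => /(fI _ _ Dc' Dc) -> cy'.
have := dist_triangle mY c y y'; lra.
Qed.

(** A branch codes points of a dense set converging to some [z], and one sequence whose fibers
    witness [U n (g z)] whenever [U n y]. As the [U n] separate points, [g z = y]. A node imposes
    conditions on [y] only through finitely many of the Borel facts [U n y]. *)
Lemma tree_of_analytic : exists T : Y -> set (seq nat),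
  [/\ forall y s n, T y (rcons s n) -> T y s, forall s, SY [set y | T y s] &
    forall y, (exists z, g z = y) <-> exists sg, forall k, T y (mkseq sg k)].
Proof.
have [U [oU Usep]] := countable_base.
have [f [D [fI Dd]]] := separable_code sepZ.
have sSY : sigma_algebra setT SY by exact: smallest_sigma_algebra.
have SU n : SY (U n) by apply: sub_sigma_algebra; exact: oU.
have SgU n : SZ (g @^-1` U n) by exact: bg.
have /choice[C CP] : forall n, exists C, jointly_closed d C /\
    forall z, U n (g z) <-> exists al, C al z.
  by move=> n; exact: (borel_souslin mZ (SgU n)).
pose pt (h : nat -> nat) i := (decode (h i)).1.
pose sq (h : nat -> nat) i := (decode (h i)).2.
(* At stage [i] the closed condition [E] is only asked of some pair that agrees with the branch up
   to [i]; closedness passes it to the limit. *)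
pose near_ (h : nat -> nat) (n i : nat) (E : (nat -> nat) -> Z -> Prop) :=
  exists q be z, [/\ D q, f q = pt h i, forall j, (j < i)%N -> be j = sq h j,
    d q z < 2 ^- i & E (fiber n be) z].
pose cond y h i := [/\ exists2 q, D q & f q = pt h i &
  forall n, (n <= i)%N -> U n y -> near_ h n i (C n)].
pose link h i := exists q q', [/\ D q /\ f q = pt h i, D q' /\ f q' = pt h i.+1 &
  d q q' < 2 ^- i].
pose T y s := forall i, (i < size s)%N -> cond y (nth 0%N s) i /\
  ((i.+1 < size s)%N -> link (nth 0%N s) i).
have condE y h h' i : (forall j, (j <= i)%N -> h j = h' j) -> cond y h i -> cond y h' i.
  move=> E [Eq H]; have nearE n (F : (nat -> nat) -> Z -> Prop) :
      near_ h n i F -> near_ h' n i F.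
    move=> [q [be [z [h1 h2 h3 h4 h5]]]]; exists q, be, z; split=> //.
      by rewrite h2 /pt E.
    by move=> j ji; rewrite h3 // /sq E // ltnW.
  split; first by move: Eq; rewrite /pt E.
  by move=> n ni Uy; apply: nearE; exact: H.
have linkE h h' i : (forall j, (j <= i.+1)%N -> h j = h' j) -> link h i -> link h' i.
  move=> E [q [q' [h1 h2 h3]]]; exists q, q'; split=> //.
    by rewrite -(_ : pt h i = pt h' i) // /pt E.
  by rewrite -(_ : pt h i.+1 = pt h' i.+1) // /pt E.
exists T; split.
- move=> y s n Ts i is_; have [|h1 h2] := Ts i; first by rewrite size_rcons ltnW.
  split.
    apply: condE h1 => j ji; rewrite nth_rcons.
    by rewrite (leq_ltn_trans ji is_).
  move=> i1s; apply: linkE (h2 _) => [j ji|]; last by rewrite size_rcons ltnW.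
  by rewrite nth_rcons (leq_ltn_trans ji i1s).
- move=> s; apply: (sigma_forall sSY) => // i; apply: (sigma_cst_imp sSY) => // _.
  apply: (sigma_and sSY) => //; last exact: (sigma_cst sSY).
  apply: (@sigma_and _ _ sSY [set _ | exists2 q, D q & f q = pt (nth 0%N s) i]
    [set y | forall n, (n <= i)%N -> U n y -> near_ (nth 0%N s) n i (C n)]).
    exact: (sigma_cst sSY).
  apply: (sigma_forall sSY) => n; apply: (sigma_cst_imp sSY) => _.
  by apply: (sigma_imp sSY) => //; exact: (sigma_cst sSY).
- move=> y; split=> [[z gz]|[sg Tsg]].
    have /choice[q qP] : forall i, exists q, D q /\ d z q < 2 ^- i.+2.
      move=> i; have [|q Dq zq] := Dd z (2 ^- i.+2); last by exists q.
      by rewrite invr_gt0 exprn_gt0.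
    have /choice[al alP] : forall n, exists al, U n y -> C n al z.
      move=> n; have [Uy|nUy] := pselect (U n y); last by exists id.
      have [al] : exists al, C n al z by apply/(CP n).2; rewrite gz.
      by exists al.
    have [be beE] := fiber_surj al.
    pose sg i := pickle (f (q i), be i).
    have ptE i : pt sg i = f (q i) by rewrite /pt decode_pickle.
    have sqE i : sq sg i = be i by rewrite /sq decode_pickle.
    exists sg => k i; rewrite size_mkseq => ik.
    have p0 j : 0 < 2 ^- j :> R by rewrite invr_gt0 exprn_gt0.
    have pS j : 2 ^- j.+1 = 2^-1 * 2 ^- j :> R by rewrite exprS invfM.
    split.
      apply: (@condE y sg) => [j ji|].
        by rewrite nth_mkseq // (leq_ltn_trans ji ik).
      split; first by exists (q i); [exact: (qP i).1|rewrite ptE].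
      have qz : d (q i) z < 2 ^- i.
        rewrite (dist_symm mZ); apply: lt_trans (qP i).2 _.
        by rewrite !pS; have := p0 i; lra.
      move=> n ni Uy; exists (q i), be, z; split; rewrite ?ptE ?beE //; last exact: alP.
      by have [] := qP i.
    move=> i1k; apply: (@linkE sg) => [j ji|].
      by rewrite nth_mkseq // (leq_ltn_trans ji i1k).
    exists (q i), (q i.+1); rewrite !ptE; split; [by have [? _] := qP i|by have [? _] := qP i.+1|].
    have := dist_triangle mZ z (q i) (q i.+1); rewrite (dist_symm mZ (q i) z).
    by have := (qP i).2; have := (qP i.+1).2; rewrite !pS; have := p0 i; lra.
  have csg i : cond y sg i.
    have [|h _] := Tsg i.+1 i; first by rewrite size_mkseq.
    by apply: condE h => j ji; rewrite nth_mkseq.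
  have lsg i : link sg i.
    have [|_ h] := Tsg i.+2 i; first by rewrite size_mkseq ltnW.
    apply: linkE (h _) => [j ji|]; last by rewrite size_mkseq.
    by rewrite nth_mkseq.
  have /choice[q qP] : forall i, exists q, D q /\ f q = pt sg i.
    by move=> i; have [[q Dq fq] _] := csg i; exists q.
  have qU i q' : D q' -> f q' = pt sg i -> q' = q i.
    by move=> Dq' fq'; apply: fI => //; [case: (qP i)|rewrite fq'; case: (qP i)].
  have qq i : d (q i) (q i.+1) < 2 ^- i.
    have [q1 [q2 [[D1 f1] [D2 f2] dq]]] := lsg i.
    by rewrite -(qU _ _ D1 f1) -(qU _ _ D2 f2).
  have qd i j : d (q i) (q (i + j)%N) <= 2 * 2 ^- i - 2 * 2 ^- (i + j).
    elim: j => [|j IH]; first by rewrite addn0 subrr dist_refl.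
    have := dist_triangle mZ (q (i + j)%N) (q i) (q (i + j).+1).
    have := qq (i + j)%N; rewrite addnS exprS invfM.
    by move: IH; set p := 2 ^- (i + j); set p' := 2 ^- i => IH h1 h2; lra.
  have qd' i j : (i <= j)%N -> d (q i) (q j) <= 2 * 2 ^- i.
    move=> ij; have := qd i (j - i)%N; rewrite subnKC //.
    have : 0 < 2 ^- j :> R by rewrite invr_gt0 exprn_gt0.
    lra.
  have [z zP] : exists z, forall e, 0 < e ->
      exists N, forall n, (N <= n)%N -> d (q n) z < e.
    apply: compZ => e e0; have e8 : 0 < e / 8 by rewrite divr_gt0.
    have [N NP] := pow2_small e8; exists N => k l Nk Nl.
    have := dist_triangle mZ (q N) (q k) (q l); rewrite (dist_symm mZ (q k) (q N)).
    by have := qd' _ _ Nk; have := qd' _ _ Nl; lra.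
  pose be j := sq sg j.
  have main n (E : (nat -> nat) -> Z -> Prop) : jointly_closed d E ->
      (forall i, (n <= i)%N -> near_ sg n i E) -> E (fiber n be) z.
    move=> cE H; apply: contrapT => /(jointly_closed_fiber cE)[N [e [e0 NE]]].
    have e2 : 0 < e / 2 by rewrite divr_gt0.
    have [M MP] := zP _ e2; have [k kP] := pow2_small e2.
    pose i := maxn (maxn n N) (maxn M k).
    have [|q' [be' [z' [D' f' beE qz EE]]]] := H i; first by rewrite !leq_max leqnn.
    apply: (NE be' z') EE => [j jN|].
      by rewrite beE // !leq_max jN orbT.
    rewrite (qU _ _ D' f') in qz.
    have h1 : d (q i) z < e / 2 by apply: MP; rewrite !leq_max leqnn !orbT.
    have h2 : 2 ^- i <= 2 ^- k :> R.
      by rewrite lef_pV2 ?posrE ?exprn_gt0 // ler_eXn2l ?ltr1n // !leq_max leqnn !orbT.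
    have := dist_triangle mZ (q i) z z'; rewrite (dist_symm mZ z (q i)).
    lra.
  exists z; symmetry; apply: Usep => n Uy; apply/(CP n).2.
  exists (fiber n be); apply: main; first exact: (CP n).1.
  by move=> i ni; have [_ /(_ n ni Uy)] := csg i.
Qed.

End tree_of_analytic.

Theorem analytic_tree (R : realType) (Y : Type) (SY : set (set Y)) (B : set Y) :
  standard_borel R SY -> analytic R SY B -> exists T : Y -> set (seq nat),
  [/\ forall y s n, T y (rcons s n) -> T y s, forall s, SY [set y | T y s] &
    forall y, B y <-> exists sg, forall k, T y (mkseq sg k)].
Proof.
move=> [dY [mY cY sY ->]] [Z [SZ [[d [mZ cZ sZ ->]] [g [bg gB]]]]].
have [T [T1 T2 T3]] := tree_of_analytic mY sY mZ cZ sZ bg.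
exists T; split=> // y; rewrite -T3 -gB; split=> [[z _ <-]|[z <-]]; first by exists z.
by exists z.
Qed.

(** * The two halves of completeness *)

Lemma C_UB_hard (R : realType) (Y : Type) (SY : set (set Y)) (B : set Y) :
  standard_borel R SY -> analytic R SY B ->
  exists f : Y -> SB R, borel_map SY (@Effros R) f /\ f @^-1` (@C_UB R) = B.
Proof.
move=> stdY anB; have [T [Tp ST TB]] := analytic_tree stdY anB.
have sSY : sigma_algebra setT SY.
  by have [d [_ _ _ ->]] := stdY; exact: smallest_sigma_algebra.
exists (fun y => tree_space R (T y)); split; last first.
  apply/seteqP; split=> y /=; first by move/(branch_tree_space (Tp y)) => H; apply/TB.
  by move/TB => [sg]; exact: tree_space_branch.
apply: borel_map_gen => // _ [U oU <-].
(* For a fixed list of nodes, whether some coefficients lead into [U] does not depend on [y]. The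
   preimage becomes a countable union over lists. *)
pose hits (ss : seq (seq nat)) := exists l : seq (R * seq nat),
  map snd l = ss /\ U (comb (embed R) l).
pose inside (ss : seq (seq nat)) y := forall i, (i < size ss)%N -> T y (nth [::] ss i).
rewrite (_ : _ @^-1` _ = [set y | exists ss, inside ss y /\ hits ss]).
  apply: (sigma_exists_count sSY) => ss.
  apply: (@sigma_and _ _ sSY (inside ss) [set _ | hits ss]); last exact: (sigma_cst sSY).
  by apply: (sigma_forall sSY) => i; apply: (sigma_cst_imp sSY) => _; exact: ST.
apply/seteqP; split=> y /=.
  move=> /(cspan_meets (T y) (@cont_embed R) oU)[l [lT Ul]].
  exists (map snd l); split; last by exists l.
  move=> i; rewrite size_map => il; rewrite (nth_map (0 : R, [::] : seq nat)) //.
  by apply: lT; exact: mem_nth.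
move=> [ss [ins [l [lE Ul]]]].
apply/(cspan_meets (T y) (@cont_embed R) oU); exists l; split=> // p pl.
have ip : (index p l < size l)%N by rewrite index_mem.
have := ins (index p l); rewrite -lE size_map (nth_map (0 : R, [::] : seq nat)) // nth_index //.
by apply.
Qed.

(** * Closed sets of continuous functions as Polish spaces *)

Section continuous_functions.
Variable R : realType.
Implicit Types f g : fn R.
Notation nle := (nle [set: cantor_space]).

Definition supdist f g : R := sup [set `|f t - g t| | t in [set: cantor_space]].

Lemma le_supdist f g t : cont f -> cont g -> `|f t - g t| <= supdist f g.
Proof.
move=> /cont_bounded[M fM] /cont_bounded[N gN]; apply: ub_le_sup; last by exists t.
by exists (M + N) => _ [u _ <-]; exact: (nleB fM gN).
Qed.

Lemma supdist_le f g c : (forall t, `|f t - g t| <= c) -> supdist f g <= c.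
Proof.
move=> H; apply: ge_sup; first by exists (`|f (fun=> false) - g (fun=> false)|), (fun=> false).
by move=> _ [t _ <-].
Qed.

Lemma supdist_metric (P : set (fn R)) : P `<=` @cont R ->
  is_metric (fun f g : {f | P f} => supdist (sval f) (sval g)).
Proof.
move=> Pc; have cP (f : {f | P f}) : cont (sval f) by apply: Pc; exact: (svalP f).
split=> [f g|f g|f g|f g h].
- by apply: le_trans (le_supdist (fun=> false) (cP f) (cP g)).
- split=> [fg|->].
    apply: eq_sig_hprop => [h|]; first exact: Prop_irrelevance.
    apply/funext => t; apply/eqP; rewrite -subr_eq0 -normr_le0 -fg.
    exact: le_supdist.
  apply/eqP; rewrite eq_le; apply/andP; split.
    by apply: supdist_le => t; rewrite subrr normr0.
  by apply: le_trans (le_supdist (fun=> false) (cP g) (cP g)).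
- by congr sup; apply/seteqP; split=> _ [t _ <-]; exists t => //; rewrite distrC.
- apply: supdist_le => t; apply: le_trans (ler_distD (sval g t) _ _) _.
  by rewrite lerD // le_supdist.
Qed.

(** Rational-valued functions of finitely many bits form a countable dense family. *)
Definition step_code := {N : nat & {ffun N.-tuple bool -> rat}}.

Definition step_fun (k : step_code) : fn R :=
  fun t => ratr (tagged k [tuple t i | i < tag k]).

Lemma step_dense f e : cont f -> 0 < e -> exists k, forall t, `|f t - step_fun k t| <= e.
Proof.
move=> cf e0; have e2 : 0 < e / 2 by rewrite divr_gt0.
have [N NP] := cont_uniform cf e2.
have /choice[q qP] : forall s : N.-tuple bool, exists q : rat,
    `|f (prefix_ext s) - ratr q| <= e / 2.
  move=> s; have [q] := @rat_in_itvoo R (f (prefix_ext s)) (f (prefix_ext s) + e / 2)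
    (ltr_pwDr e2 (lexx _)).
  rewrite in_itv /= => /andP[h1 h2]; exists q.
  by rewrite ler_norml; apply/andP; split; lra.
exists (Tagged (fun N => {ffun N.-tuple bool -> rat}) [ffun s => q s]) => t.
rewrite /step_fun /= ffunE; set s := [tuple _ | _ < _].
have ts : agree N t (prefix_ext s).
  by move=> i iN; rewrite /prefix_ext -[i]/(nat_of_ord (Ordinal iN)) -tnth_nth tnth_mktuple.
have := NP _ _ ts; have := qP s.
have := ler_normD (f t - f (prefix_ext s)) (f (prefix_ext s) - ratr (q s)).
rewrite addrA subrK; lra.
Qed.

(** Step functions need not lie in [P], so an element of [P] is chosen near each of them, with
    [None] where there is none. *)
Lemma subset_separable (P : set (fn R)) : P `<=` @cont R ->
  exists sel : nat -> option (fn R), (forall n f, sel n = Some f -> P f) /\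
    forall f e, P f -> 0 < e -> exists n g, sel n = Some g /\ forall t, `|f t - g t| <= e.
Proof.
move=> Pc.
have /choice[s sP] : forall p : step_code * nat, exists o : option (fn R),
    if o is Some f then P f /\ forall t, `|f t - step_fun p.1 t| <= 2 ^- p.2
    else forall f, P f -> ~ forall t, `|f t - step_fun p.1 t| <= 2 ^- p.2.
  move=> p; have [[f fP]|none] := pselect (exists f,
    P f /\ forall t, `|f t - step_fun p.1 t| <= 2 ^- p.2); first by exists (Some f).
  by exists None => f Pf h; apply: none; exists f.
exists (fun n => obind s (unpickle n)); split=> [n f|f e Pf e0].
  by case: unpickle => //= p sp; have := sP p; rewrite sp => -[].
have [j jP] := pow2_small (divr_gt0 e0 (ltr0n R 2)).
have [|k kP] := @step_dense f (2 ^- j) (Pc _ Pf); first by rewrite invr_gt0 exprn_gt0.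
exists (pickle (k, j)); rewrite pickleK /=.
have := sP (k, j); case: (s (k, j)) => [g [Pg gP]|/(_ f Pf)/(_ kP)//].
exists g; split=> // t; have := kP t; have := gP t; rewrite /= => h1 h2.
have := ler_normB (f t - step_fun k t) (g t - step_fun k t).
have -> : f t - step_fun k t - (g t - step_fun k t) = f t - g t by ring.
lra.
Qed.

Lemma supdist_separable (P : set (fn R)) : P `<=` @cont R ->
  metric_separable (fun f g : {f | P f} => supdist (sval f) (sval g)).
Proof.
move=> Pc; have [sel [selP seld]] := subset_separable Pc.
exists [set f | exists n, sel n = Some (sval f)]; split.
  apply/countable_injP.
  have /choice[idx idxP] : forall f : {f | P f}, exists n,
      (exists n, sel n = Some (sval f)) -> sel n = Some (sval f).
    move=> f; have [[n nP]|h] := pselect (exists n, sel n = Some (sval f)).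
      by exists n.
    by exists 0%N => /h.
  exists idx => f g; rewrite !inE => /idxP hf /idxP hg E.
  apply: eq_sig_hprop => [h|]; first exact: Prop_irrelevance.
  by move: hf; rewrite E hg => -[].
move=> f e e0; have [n [g [gn fg]]] := seld _ _ (svalP f) (divr_gt0 e0 (ltr0n R 2)).
exists (exist _ g (selP _ _ gn)); first by exists n.
apply: (@le_lt_trans _ _ (e / 2)); first exact: supdist_le.
by rewrite ltr_pdivrMr // ltr_pMr // ltr1n.
Qed.

Lemma supdist_complete (P : set (fn R)) : P `<=` @cont R ->
  (forall g, (forall e, 0 < e -> exists2 f, P f & forall t, `|f t - g t| <= e) -> P g) ->
  metric_complete (fun f g : {f | P f} => supdist (sval f) (sval g)).
Proof.
move=> Pc clP u cu; have cP (f : {f | P f}) : cont (sval f) by apply: Pc; exact: (svalP f).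
have p0 k : 0 < 2 ^- k :> R by rewrite invr_gt0 exprn_gt0.
have /choice[N NP] : forall k : nat, exists N : nat, forall m n, (N <= m)%N -> (N <= n)%N ->
    supdist (sval (u m)) (sval (u n)) < 2 ^- k by move=> k; exact: cu.
pose v k := sval (u (N k)).
have [||g gP] := @uniform_limit_pow2 R _ v 1.
- by [].
- move=> k l t; pose M := maxn (N k) (N l).
  have h1 := le_supdist t (cP (u (N k))) (cP (u M)).
  have h2 := le_supdist t (cP (u (N l))) (cP (u M)).
  have h3 := NP k (N k) M (leqnn _) (leq_maxl _ _).
  have h4 := NP l (N l) M (leqnn _) (leq_maxr _ _).
  have := ler_normB (v k t - sval (u M) t) (v l t - sval (u M) t).
  have -> : v k t - sval (u M) t - (v l t - sval (u M) t) = v k t - v l t by ring.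
  rewrite /v; lra.
have Pg : P g.
  apply: clP => e e0; have [k kP] := pow2_eventually ler01 e0.
  exists (v k); first exact: (svalP (u (N k))).
  by move=> t; apply: le_trans (gP k t) (kP k (leqnn k)).
exists (exist _ g Pg) => e e0; have e4 : 0 < e / 4 by rewrite divr_gt0.
have [k kP] := pow2_small e4; exists (N k) => n Nn.
apply: (@le_lt_trans _ _ (e / 2)); last by rewrite ltr_pdivrMr // ltr_pMr // ltr1n.
apply: supdist_le => t /=.
have h1 := le_supdist t (cP (u n)) (cP (u (N k))).
have h2 := NP k n (N k) Nn (leqnn _); have h3 := gP k t.
have := ler_normD (sval (u n) t - v k t) (v k t - g t); rewrite addrA subrK.
move: h1 h2 h3; rewrite -/(v k) mul1r; lra.
Qed.

End continuous_functions.

(** * A Polish space of codes for spaces with an unconditional basic sequence *)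

Section coding_sequences.
Variable R : realType.
Implicit Types f g F : fn R.
Notation nle := (nle [set: cantor_space]).
Notation uncond := (uncond [set: cantor_space]).
Notation nonzero := (nonzero [set: cantor_space]).

(* A single continuous function codes the sequence of its restrictions to the
   clopen pieces 0^n 1 Delta, recentred at its value at 0^oo; that value itself codes
   a constant. *)
Definition spike n (t : nat -> bool) : nat -> bool := fun i =>
  if (i < n)%N then false else if i == n then true else t (i - n.+1)%N.

Definition tail n (t : nat -> bool) : nat -> bool := fun i => t (i + n.+1)%N.

Definition top F : R := F (fun=> false).

Definition part F n : fn R := fun t => F (spike n t) - top F.

Definition glue (K : R) (y : nat -> fn R) : fn R := fun t =>
  K + match pselect (exists n, t n) with
      | left h => y (ex_minn h) (tail (ex_minn h) t)
      | right _ => 0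
      end.

Lemma glue_first K y (t : nat -> bool) n : t n -> (forall i, (i < n)%N -> ~~ t i) ->
  glue K y t = K + y n (tail n t).
Proof.
move=> tn tlt; rewrite /glue; case: pselect => [h|]; last by case; exists n.
case: ex_minnP => m tm mmin; suff -> : m = n by [].
apply/eqP; rewrite eqn_leq mmin //= leqNgt; apply/negP => /tlt.
by rewrite tm.
Qed.

Lemma top_glue K y : top (glue K y) = K.
Proof. by rewrite /top /glue; case: pselect => [[]//|_]; rewrite addr0. Qed.

Lemma part_glue K y n : part (glue K y) n = y n.
Proof.
apply/funext => t; rewrite /part top_glue (@glue_first _ _ _ n).
- rewrite addrC addKr; congr (y n _); apply/funext => i.
  by rewrite /tail /spike ltnNge ltnW ?leq_addl //= gtn_eqF ?leq_addl // addnK.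
- by rewrite /spike ltnn eqxx.
- by move=> i il; rewrite /spike il.
Qed.

Lemma cont_part F n : cont F -> cont (part F n).
Proof.
move=> /contP mF; apply/contP => t e e0; have [N NP] := mF (spike n t) e e0.
exists N => u tu; rewrite /part opprB addrA subrK; apply: NP => i iN.
rewrite /spike; case: ifP => // _; case: ifP => // _; apply: tu; lia.
Qed.

Lemma cont_glue K y : (forall n, cont (y n)) -> (forall n, nle (y n) (2 ^- n)) ->
  cont (glue K y).
Proof.
move=> cy y2; apply/contP => t e e0.
have [[n0 tn0]|none] := pselect (exists n, t n).
  have ex : exists n, t n by exists n0.
  case: (ex_minnP ex) => n tn nmin.
  have tlt i : (i < n)%N -> ~~ t i by rewrite ltnNge; apply: contra => /nmin.
  have /contP/(_ (tail n t) e e0)[N NP] := cy n.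
  exists (n.+1 + N)%N => u tu.
  rewrite (glue_first K y tn tlt) (@glue_first K y u n).
  - rewrite opprD addrACA subrr add0r; apply: NP => i iN; rewrite /tail; apply: tu; lia.
  - by rewrite -tu //; lia.
  - by move=> i il; rewrite -tu ?tlt //; lia.
have [N Ne] := pow2_small e0; exists N => u tu.
have -> : glue K y t = K by rewrite /glue; case: pselect => // _; rewrite addr0.
have [[n0 un0]|noneu] := pselect (exists n, u n); last first.
  by rewrite /glue; case: pselect => // _; rewrite addr0 subrr normr0 ltW.
have ex : exists n, u n by exists n0.
case: (ex_minnP ex) => n un nmin.
have ult i : (i < n)%N -> ~~ u i by rewrite ltnNge; apply: contra => /nmin.
rewrite (glue_first K y un ult) opprD addrA subrr add0r normrN.
have Nn : (N <= n)%N.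
  by rewrite leqNgt; apply/negP => nN; apply: none; exists n; rewrite tu.
apply: le_trans (y2 n _ I) (le_trans _ (ltW Ne)).
by rewrite lef_pV2 ?posrE ?exprn_gt0 // ler_eXn2l // ltr1n.
Qed.

(** [top F] codes the constant, the even parts the unconditional sequence, and the odd parts are
    free. The lower bounds keep the even parts nonzero; their form with [e] makes them survive
    uniform limits. *)
Definition good : set (fn R) := [set F | [/\ cont F,
  forall i e, 0 < e -> exists t, 2 ^- i.*2.+1 - e <= `|part F i.*2 t| &
  uncond `|top F| (fun i => part F i.*2)]].

Lemma good_cont : good `<=` @cont R. Proof. by move=> F []. Qed.

Lemma part_near F G e n t : (forall u, `|F u - G u| <= e) ->
  `|part F n t - part G n t| <= 2 * e.
Proof.
move=> FG; have := ler_normB (F (spike n t) - G (spike n t)) (F (fun=> false) - G (fun=> false)).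
have := FG (spike n t); have := FG (fun=> false); rewrite /part /top.
have -> : F (spike n t) - F (fun=> false) - (G (spike n t) - G (fun=> false)) =
  F (spike n t) - G (spike n t) - (F (fun=> false) - G (fun=> false)) by ring.
lra.
Qed.

Lemma good_closed g :
  (forall e, 0 < e -> exists2 F, good F & forall t, `|F t - g t| <= e) -> good g.
Proof.
move=> H; have p0 k : 0 < 2 ^- k :> R by rewrite invr_gt0 exprn_gt0.
split.
- have /choice[u uP] : forall n : nat, exists F, good F /\ forall t, `|F t - g t| <= 2 ^- n.
    by move=> n; have [F gF Fg] := H _ (p0 n); exists F.
  apply: (@cont_unif _ u) => [n|e e0]; first exact/good_cont/(uP n).1.
  have [N NP] := pow2_eventually ler01 e0; exists N => n Nn t.
  by apply: le_trans ((uP n).2 t) _; rewrite -[leLHS]mul1r; exact: NP.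
- move=> i e e0; have e4 : 0 < e / 4 by rewrite divr_gt0.
  have [F [_ Fn _] Fg] := H _ e4; have [t tP] := Fn i _ (divr_gt0 e0 (ltr0n R 2)).
  exists t; have := part_near i.*2 t Fg.
  have := ler_normD (part F i.*2 t - part g i.*2 t) (part g i.*2 t).
  rewrite subrK; lra.
- move=> b n a c gc t _; have c0 := nle_nonneg gc.
  pose A := \sum_(0 <= i < n) `|a i|; have A0 : 0 <= A by exact: sumr_ge0.
  have near F e : (forall t, `|F t - g t| <= e) -> forall (B : pred nat) u,
      `|\sum_(0 <= i < n | B i) a i * part F i.*2 u -
        \sum_(0 <= i < n | B i) a i * part g i.*2 u| <= A * (2 * e).
    move=> Fg B u; have e0 : 0 <= e by exact: le_trans (Fg u).
    rewrite -sumrB (le_trans (ler_norm_sum _ _ _)) // /A mulr_suml.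
    rewrite big_mkcond ler_sum // => i _; case: ifP => _; last by rewrite !mulr_ge0.
    by rewrite -mulrBr normrM ler_wpM2l // part_near.
  (* For an error [e <= 1] in [F], all resulting error terms add up to at most [D * e]. *)
  pose D := c + 4 * A + 2 * A * `|top g|.
  have D0 : 0 <= D by rewrite !addr_ge0 ?mulr_ge0.
  apply: (@le_pow2_lim _ _ _ D 0%N) => // k _; set e := 2 ^- k.
  have e1 : e <= 1 by rewrite invf_le1 ?exprn_gt0 // exprn_ege1 // ler1n.
  have e0 : 0 < e by exact: p0.
  have [F [_ _ uF] Fg] := H e e0.
  have Fc : nle (fun t => \sum_(0 <= i < n) a i * part F i.*2 t) (c + A * (2 * e)).
    move=> u _; have := gc u I; have := near F e Fg xpredT u.
    have := ler_normD (\sum_(0 <= i < n) a i * part F i.*2 u -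
      \sum_(0 <= i < n) a i * part g i.*2 u) (\sum_(0 <= i < n) a i * part g i.*2 u).
    rewrite subrK; lra.
  have h1 := uF b n a _ Fc t I; have h2 := near F e Fg b t.
  have h3 : `|top F| <= `|top g| + e.
    have := Fg (fun=> false); have := ler_normD (top F - top g) (top g).
    by rewrite subrK /top; lra.
  have h4 : `|top F| * (c + A * (2 * e)) <= (`|top g| + e) * (c + A * (2 * e)).
    by rewrite ler_wpM2r // addr_ge0 // mulr_ge0 // mulr_ge0 // ltW.
  have h5 : A * (e * e) <= A * (e * 1) by rewrite ler_wpM2l // ler_wpM2l // ltW.
  have := ler_normB (\sum_(0 <= i < n | b i) a i * part F i.*2 t)
    (\sum_(0 <= i < n | b i) a i * part F i.*2 t -
      \sum_(0 <= i < n | b i) a i * part g i.*2 t).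
  have -> : \sum_(0 <= i < n | b i) a i * part F i.*2 t -
    (\sum_(0 <= i < n | b i) a i * part F i.*2 t -
      \sum_(0 <= i < n | b i) a i * part g i.*2 t) =
      \sum_(0 <= i < n | b i) a i * part g i.*2 t by ring.
  move: h1 h2 h4 h5; rewrite /D; move: (`|\sum_(_ <= _ < _ | _) _ - _|) => w1.
  move: (`|\sum_(_ <= _ < _ | _) _ * part F _ _|) => w2.
  move: (`|\sum_(_ <= _ < _ | _) _|) => w3 => h1 h2 h4 h5 h6.
  have : (`|top g| + e) * (c + A * (2 * e)) =
    `|top g| * c + 2 * A * `|top g| * e + c * e + 2 * (A * (e * e)) by ring.
  lra.
Qed.

Lemma cspan_subset (I : eqType) (E : I -> fn R) (S : set I) (X : set (fn R)) :
  closed_subspace X -> (forall i, S i -> X (E i)) -> cspan E S `<=` X.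
Proof.
move=> [Xc X0 XD XZ XC] XE f [cf fP].
have Xcomb l : (forall p, p \in l -> S p.2) -> X (comb E l).
  elim: l => [|p l IH] lS.
    by rewrite (_ : comb E [::] = fun=> 0) //; apply/funext => t; rewrite /comb big_nil.
  rewrite (_ : comb E _ = fun t => p.1 * E p.2 t + comb E l t).
    apply: XD; first by apply/XZ/XE/lS; exact: mem_head.
    by apply: IH => q ql; apply: lS; rewrite inE ql orbT.
  by apply/funext => t; rewrite /comb big_cons.
have /choice[l lP] : forall n : nat, exists l : seq (R * I), (forall p, p \in l -> S p.2) /\
    nle (fun t => f t - comb E l t) (2 ^- n).
  by move=> n; apply: fP; rewrite invr_gt0 exprn_gt0.
apply: (XC (fun n => comb E (l n))) => [n|e e0]; first exact/Xcomb/(lP n).1.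
have [N NP] := pow2_eventually ler01 e0; exists N => n Nn t.
by rewrite distrC; apply: le_trans ((lP n).2 t Logic.I) _; rewrite -[leLHS]mul1r; exact: NP.
Qed.

Definition coded_space (F : {F | good F}) : SB R :=
  exist _ (cspan (part (sval F)) setT) (cspan_closed (part (sval F)) setT).

Notation dist := (fun F G : {F | good F} => supdist (sval F) (sval G)).

(** A finite combination of parts depends continuously on [F], so the preimages of the generating
    sets are even open. *)
Lemma coded_space_borel :
  borel_map <<s [set U | metric_open dist U]>> (@Effros R) coded_space.
Proof.
apply: borel_map_gen; first exact: smallest_sigma_algebra.
move=> _ [U oU <-]; apply: sub_sigma_algebra => F /=.
have cp (G : {F | good F}) n : cont (part (sval G) n).
  by apply: cont_part; exact: good_cont (svalP G).
move=> /(cspan_meets setT (cp F) oU)[l [_ Ul]].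
have [e e0 eU] := oU.2 _ Ul.
pose A := \sum_(p <- l) `|p.1|; have A0 : 0 <= A by exact: sumr_ge0.
have A1 : 0 < 2 * A + 1 by rewrite ltr_wpDl // mulr_ge0.
exists (e / (2 * A + 1)) => [|G FG]; first by rewrite divr_gt0.
apply/(cspan_meets setT (cp G) oU); exists l; split=> //.
apply: eU => [|t]; first exact: cont_comb.
have h t' : `|sval F t' - sval G t'| <= e / (2 * A + 1).
  apply: le_trans (ltW FG); apply: le_supdist; exact: good_cont (svalP _).
rewrite /comb -sumrB; apply: le_trans (ler_norm_sum _ _ _) _.
apply: (@le_trans _ _ (\sum_(p <- l) `|p.1| * (2 * (e / (2 * A + 1))))).
  by apply: ler_sum => p _; rewrite -mulrBr normrM ler_wpM2l // part_near.
rewrite -mulr_suml -/A mulrA mulrA ler_pdivrMr //.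
have : 0 <= A * e by rewrite mulr_ge0 // ltW.
nra.
Qed.

(** To code a given space, the even parts are taken to be multiples of its unconditional sequence
    and the odd ones multiples of a dense sequence of the space. The factors [2 ^- n] make the glued
    function continuous at its top. *)
Lemma coded_space_range : coded_space @` setT = @C_UB R.
Proof.
apply/seteqP; split=> [_ [[F [cF nF uF]] _ <-]|[X clX] [x [xX ux]]].
  exists (fun i => part F i.*2); split.
    by move=> n; apply: cspan_mem => // k; exact: cont_part.
  apply: (@ubs_of_uncond _ _ `|top F|) => //.
    by move=> n; exact: cont_part.
  move=> n; have p0 : 0 < 2 ^- n.*2.+1 / 2 :> R.
    by rewrite divr_gt0 // invr_gt0 exprn_gt0.
  have [t tP] := nF n _ p0; exists t => //; rewrite -normr_gt0.
  by apply: lt_le_trans tP; move: p0; lra.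
have [Xc X0 XD XZ XC] := clX; rewrite /= in xX.
have cx n : cont (x n) by exact: Xc.
have [K uK] := uncond_of_ubs cx ux.
have uK' : uncond `|K| x by apply: uncond_le uK; exact: ler_norm.
have nx := ubs_nonzero cx ux.
have [sel [selX seld]] := subset_separable Xc.
(* Indices without a selected function get the zero function, which also lies in [X]. *)
pose w n := odflt (fun=> 0) (sel n).
have wX n : X (w n) by rewrite /w; case E : (sel n) => [h|] //=; exact: (selX n).
have /choice[lx lxP] : forall n, exists l : R, [/\ 0 < l, nle (fun t => l * x n t) 1 &
    exists2 t, [set: cantor_space] t & 2^-1 <= `|l * x n t|].
  by move=> n; have [M xM] := cont_bounded (cx n); exact: normalize xM (nx n).
have /choice[lw lwP] : forall n, exists l : R, 0 < l /\ nle (fun t => l * w n t) 1.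
  move=> n; have [M wM] := cont_bounded (Xc _ (wX n)); have M0 := nle_nonneg wM.
  have M1 : 0 < M + 1 by rewrite ltr_wpDl.
  exists (M + 1)^-1; rewrite invr_gt0; split=> //.
  apply: nleW (nleZ _ wM); rewrite gtr0_norm ?invr_gt0 // ler_pdivrMl // mulr1.
  by rewrite lerDl.
pose z n : fn R := if odd n then (fun t => lw n./2 * w n./2 t) else (fun t => lx n./2 * x n./2 t).
pose y n : fn R := fun t => 2 ^- n * z n t.
have p0 k : 0 < 2 ^- k :> R by rewrite invr_gt0 exprn_gt0.
have yX n : X (y n) by apply: (XZ _ (z n)); rewrite /z; case: ifP => _; exact: XZ.
have y2 n : nle (y n) (2 ^- n).
  have z1 : nle (z n) 1 by rewrite /z; case: ifP => _; [exact: (lwP _).2|by have [] := lxP n./2].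
  by apply: nleW (nleZ _ z1); rewrite gtr0_norm // mulr1.
have yE i : y i.*2 = fun t => (2 ^- i.*2 * lx i) * x i t.
  by apply/funext => t; rewrite /y /z odd_double doubleK mulrA.
have yO i : y i.*2.+1 = fun t => (2 ^- i.*2.+1 * lw i) * w i t.
  by apply/funext => t; rewrite /y /z /= odd_double /= uphalf_double mulrA.
have gF : good (glue `|K| y).
  split.
  - by apply: cont_glue => // n; exact: Xc.
  (* The bound [2 ^- i.*2.+1] is the scaling factor [2 ^- i.*2] times the 1/2 of [normalize]. *)
  - move=> i e e0; have [_ _ [t _ tP]] := lxP i; exists t.
    rewrite part_glue yE -mulrA normrM gtr0_norm // exprS invfM mulrC.
    rewrite lerBlDr; apply: le_trans (_ : 2 ^- i.*2 * `|lx i * x i t| <= _).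
      by rewrite ler_wpM2l // ltW.
    by rewrite lerDl ltW.
  - rewrite top_glue normr_id.
    rewrite (_ : (fun i => part _ i.*2) = fun i t => (2 ^- i.*2 * lx i) * x i t).
      exact: (uncond_scale (l := fun i => 2 ^- i.*2 * lx i) uK').
    by apply/funext => i; rewrite part_glue yE.
exists (exist _ _ gF) => //.
apply: eq_sig_hprop => [h|]; first exact: Prop_irrelevance.
have partE : part (glue `|K| y) = y by apply/funext => n; exact: part_glue.
rewrite /= partE; apply/seteqP; split; first exact: cspan_subset.
move=> f Xf; split; first exact: Xc.
move=> e e0; have [n [h [nh fh]]] := seld f e Xf e0.
exists [:: ((2 ^- n.*2.+1 * lw n)^-1, n.*2.+1)]; split=> // t _.
rewrite /comb big_seq1 /= yO mulKf; last by rewrite gt_eqF // mulr_gt0 // (lwP n).1.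
by rewrite /w nh; exact: fh.
Qed.

Lemma C_UB_analytic : analytic R (@Effros R) (@C_UB R).
Proof.
exists {F | good F}, <<s [set U | metric_open dist U]>>; split.
  exists dist; split=> //.
  - exact: supdist_metric good_cont.
  - exact: supdist_complete good_cont good_closed.
  - exact: supdist_separable good_cont.
by exists coded_space; split; [exact: coded_space_borel|exact: coded_space_range].
Qed.

End coding_sequences.

Theorem theorem5p15 (R : realType) : sigma11_complete R (@Effros R) (@C_UB R).
Proof.
split; first exact: C_UB_analytic.
by move=> Y SY stdY B; exact: C_UB_hard.
Qed.
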